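(* Let $(U(\underline{\varsigma}))_{\underline{\varsigma}\in\{+,-\}^{\mathbb{N}}}$ be the family of smooth functions on $\mathbb{T}$ described in the context, let $\underline{\varsigma}_0\in\{+,-\}^{\mathbb{N}}$, and put $U_0=U(\underline{\varsigma}_0)$. (1) If $\underline{\varsigma}_0$ is the constant sequence equal to $+$ (resp. $-$), then the one-parameter family of Gibbs measures $(\rho_{\beta\cdot U_0})_{\beta>0}$ converges to the ferromagnetic (resp. antiferromagnetic) phase as $\beta\to+\infty$. In particular, for such $\underline{\varsigma}_0$ the interaction $\Phi_{U_0}$ is non-chaotic. (2) If $\underline{\varsigma}_0$ has infinitely many $+$'s and infinitely many $-$'s, then the one-parameter family of Gibbs measures $(\rho_{\beta\cdot U_0})_{\beta>0}$ accumulates at the same time on the ferromagnetic and the antiferromagnetic phases as $\beta\to+\infty$. Thus, for such $\underline{\varsigma}_0$ the interaction $\Phi_{U_0}$ is chaotic.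
   Context: $\mathbb{T}=\mathbb{R}/\mathbb{Z}$ with its additive group structure and Lebesgue probability measure $\mathrm{Leb}$; $\mathbb{N}=\{1,2,\dots\}$; $\{+,-\}^{\mathbb{N}}$ has the product topology. For $U\colon\mathbb{T}\to\mathbb{R}$, $\Phi_U$ is the nearest-neighbor interaction on $\mathbb{T}^{\mathbb{Z}}$ given by $\Phi_U(\{k,k+1\})((\theta_n)_{n\in\mathbb{Z}})=-U(\theta_k-\theta_{k+1})$ for $k\in\mathbb{Z}$, and zero on all other finite subsets of $\mathbb{Z}$. When $U$ is continuous there is a unique Gibbs measure for $\Phi_U$ (a Borel probability measure on $\mathbb{T}^{\mathbb{Z}}$ satisfying the DLR equations with a priori measure $\mathrm{Leb}$), denoted $\rho_U$. Convergence and accumulation of measures are in the weak* topology. An interaction $\Phi$ is chaotic if there is a sequence $(\beta_\ell)_{\ell\in\mathbb{N}}$ of inverse temperatures with $\beta_\ell\to+\infty$ such that, however one chooses for each $\ell$ a Gibbs measure $\rho_\ell$ for $\beta_\ell\cdot\Phi$, the sequence $(\rho_\ell)_{\ell\in\mathbb{N}}$ does not converge. A configuration $(\theta_n)_{n\in\mathbb{Z}}$ is ferromagnetic (resp. antiferromagnetic) if $\theta_{n+1}=\theta_n$ (resp. $\theta_{n+1}=\theta_n+\tfrac12$) for every $n$; it is determined by $\theta_0$. The ferromagnetic (resp. antiferromagnetic) phase is the measure on $\mathbb{T}^{\mathbb{Z}}$ evenly distributed on ferromagnetic (resp. antiferromagnetic) configurations, i.e. the image of $\mathrm{Leb}$ under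 the map sending $\theta_0$ to the corresponding configuration. The family $(U(\underline{\varsigma}))$: let $\pi((\theta_n)_{n\in\mathbb{Z}})=\theta_0-\theta_1$ and $\beta_m=2^{(m+10)^3}$ for $m\ge1$. The paper constructs a family of smooth functions $U(\underline{\varsigma})\colon\mathbb{T}\to\mathbb{R}$, depending continuously on $\underline{\varsigma}\in\{+,-\}^{\mathbb{N}}$ in the $C^\infty$ topology, such that for every $\underline{\varsigma}=(\varsigma(m))_{m\in\mathbb{N}}$, all integers $\widehat{m}\ge m\ge1$ with $\varsigma(m)=\cdots=\varsigma(\widehat{m})$, and every $\beta\in[\beta_m,\beta_{\widehat{m}}]$, one has $\rho_{\beta\cdot U(\underline{\varsigma})}(\pi^{-1}([-2^{-(m+1)^2},2^{-(m+1)^2}]))\ge1-2^{-m}$ if $\varsigma(m)=+$, and $\rho_{\beta\cdot U(\underline{\varsigma})}(\pi^{-1}([\tfrac12-2^{-(m+1)^2},\tfrac12+2^{-(m+1)^2}]))\ge1-2^{-m}$ if $\varsigma(m)=-$. This is the family meant in the claim. Background: for every $\underline{\varsigma}_0$ the function $U_0=U(\underline{\varsigma}_0)$ has the following sensitivity property: for every sequence of positive numbers $\widehat{\beta}_\ell\to+\infty$ there is an arbitrarily $C^\infty$-small smooth perturbation $U$ of $U_0$ such that $(\rho_{\widehat{\beta}_\ell\cdot U})_{\ell\in\mathbb{N}}$ accumulates at the same time on the ferromagnetic and antiferromagnetic phases. *)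

(* Defs.v *)
From HB Require Import structures.
From mathcomp Require Import all_boot all_order all_algebra.
From mathcomp Require Import finmap generic_quotient ring_quotient.
From mathcomp Require Import all_classical all_reals all_analysis.
From mathcomp Require Import measurable_realfun.

Set Implicit Arguments.
Unset Strict Implicit.
Unset Printing Implicit Defensive.

Import Order.TTheory GRing.Theory Num.Theory.
Import numFieldNormedType.Exports.

Local Open Scope classical_set_scope.
Local Open Scope ring_scope.

(* [Num.int_num_subdef] is the predicate underlying [_ \is a Num.int]. *)
Definition integers (R : realType) : zmodClosed R :=
  Algebra.ZmodClosed.clone R (@Num.int_num_subdef R) _.

Definition circle (R : realType) : Type :=
  quotient_topology {ideal_quot (integers R)}.

HB.instance Definition _ (R : realType) := Quotient.on (circle R).
HB.instance Definition _ (R : realType) := Topological.on (circle R).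
HB.instance Definition _ (R : realType) := Pointed.on (circle R).
HB.instance Definition _ (R : realType) :=
  GRing.Zmodule.copy (circle R) {ideal_quot (integers R)}.
HB.instance Definition _ (R : realType) :=
  Measurable.copy (circle R) (g_sigma_algebraType (open : set (set (circle R)))).

Definition circ (R : realType) (x : R) : circle R := \pi_(circle R)%qT x.

Lemma circ_zmod_morphism (R : realType) : zmod_morphism (@circ R).
Proof. exact: (pi_is_zmod_morphism {ideal_quot (integers R)}). Qed.

HB.instance Definition _ (R : realType) :=
  GRing.isZmodMorphism.Build R (circle R) (@circ R) (@circ_zmod_morphism R).

Lemma circ_eqP (R : realType) (x y : R) :
  reflect (circ x = circ y) (x - y \is a Num.int).
Proof.
have := Quotient.idealrBE (integers R) x y.
rewrite -[_ \in _]/(x - y \is a Num.int) => ->.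
by apply: (iffP idP) => [/eqP //|e]; apply/eqP.
Qed.

Lemma continuous_circ (R : realType) : continuous (@circ R).
Proof. exact: pi_continuous. Qed.

Lemma measurable_circ (R : realType) :
  measurable_fun setT (@circ R : measurableTypeR R -> circle R).
Proof.
apply: (measurability (open : set (set (circle R)))) => //.
move=> _ [A oA <-]; rewrite setTI; apply: open_measurable.
by move/continuousP: (@continuous_circ R); apply.
Qed.

Definition image_probability d1 d2 (T1 : measurableType d1)
    (T2 : measurableType d2) (R : realType) (P : probability T1 R)
    (f : T1 -> T2) (mf : measurable_fun setT f) : probability T2 R :=
  distribution P (mfun_Sub (mem_set mf)).

Definition leb (R : realType) : probability (circle R) R :=
  image_probability (uniform_prob (@ltr01 R)) (@measurable_circ R).

Definition conf (R : realType) : Type := prod_topology (fun _ : int => circle R).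

HB.instance Definition _ (R : realType) := Topological.on (conf R).
HB.instance Definition _ (R : realType) := Pointed.on (conf R).
HB.instance Definition _ (R : realType) :=
  Measurable.copy (conf R) (g_sigma_algebraType (open : set (set (conf R)))).

(* Weak* topology on the Borel probability measures on T^Z: the coarsest one
   making mu |-> \int f dmu continuous for every continuous real function f. *)
Definition weak_eval (R : realType) (mu : probability (conf R) R) :
    {ptws continuousType (conf R) R -> R} :=
  fun f => \int[mu]_x f x.

HB.instance Definition _ (R : realType) :=
  Topological.copy (probability (conf R) R) (initial_topology (@weak_eval R)).

Definition interaction (R : realType) := {fset int} -> conf R -> R.

(* For a given D the sum has at most one term. *)
Definition nearest_neighbor (R : realType) (U : circle R -> R) : interaction R :=
  fun D x =>
    \sum_(k \in [set k : int | D = [fset k; (k + 1)%R]%fset])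
      - U (x k - x (k + 1)).

Definition scale_interaction (R : realType) (b : R) (Phi : interaction R) :
    interaction R :=
  fun D x => b * Phi D x.

(* Energy of the sites of L given the rest. [\sum_(_ \in _)] is the sum over
   the support, here finite: only finite-range interactions are considered. *)
Definition hamiltonian (R : realType) (Phi : interaction R) (L : {fset int})
    (x : conf R) : R :=
  \sum_(D \in [set D : {fset int} | ~~ [disjoint D & L]%fset]) Phi D x.

(* Integral of F over the coordinates in L against the product of Lebesgue
   measures, the coordinates outside L being those of x. *)
Definition leb_integral (R : realType) (L : {fset int}) (F : conf R -> \bar R) :
    conf R -> \bar R :=
  foldr (fun k G x => (\int[leb R]_t G (dfwith x k t))%E) F L.

Definition gibbs_kernel (R : realType) (Phi : interaction R) (L : {fset int})
    (A : set (conf R)) (x : conf R) : \bar R :=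
  ((fine (leb_integral L (fun y => (expR (- hamiltonian Phi L y))%:E) x))^-1%:E *
   leb_integral L (fun y => (expR (- hamiltonian Phi L y) * \1_A y)%:E) x)%E.

(* DLR equations: [mu] is invariant under the kernel of every finite [L]. *)
Definition is_gibbs (R : realType) (Phi : interaction R)
    (mu : probability (conf R) R) : Prop :=
  forall (L : {fset int}) (A : set (conf R)), measurable A ->
    mu A = (\int[mu]_x gibbs_kernel Phi L A x)%E.

(* The Gibbs measure of the nearest-neighbor interaction of a continuous U is
   unique; measures being compared on measurable sets only, [get] selects a
   representative. *)
Definition gibbs_measure (R : realType) (U : circle R -> R) :
    probability (conf R) R :=
  get (is_gibbs (nearest_neighbor U)).

Definition chaotic (R : realType) (Phi : interaction R) : Prop :=
  exists b : nat -> R, [/\ forall l, 0 < b l, b @ \oo --> +oo &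
    forall rho : nat -> probability (conf R) R,
      (forall l, is_gibbs (scale_interaction (b l) Phi) (rho l)) ->
      ~ exists mu : probability (conf R) R, rho @ \oo --> mu].

Definition half (R : realType) : circle R := circ 2^-1.

Lemma continuous_circle_shift (R : realType) (c : circle R) :
  continuous (fun t : circle R => t + c).
Proof.
have [r ->] : exists r, c = circ r by exists (repr c); rewrite /circ reprK.
apply/quotient_continuous.
rewrite (_ : _ \o _ = @circ R \o (fun x => x + r)); last first.
  apply/funext => x /=; apply/esym.
  exact: raddfD.
move=> x; apply: continuous_comp; last exact: continuous_circ.
by apply: cvgD; [exact: cvg_id|exact: cvg_cst].
Qed.

(* The (anti)ferromagnetic configuration with value t at site 0. *)
Definition ferro_conf (R : realType) (t : circle R) : conf R := fun=> t.

Definition antiferro_conf (R : realType) (t : circle R) : conf R :=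
  fun n => t + half R *~ n.

Lemma ferro_confP (R : realType) (x : conf R) :
  (forall n, x (n + 1) = x n) <-> x = ferro_conf (x 0).
Proof.
split=> [h|-> //]; apply/funext => n; rewrite /ferro_conf.
elim/int_ind: n => // n IH; first by rewrite -addn1 PoszD h.
by rewrite -IH -[in RHS](subrK 1 (- n%:Z)) h -addn1 PoszD opprD.
Qed.

Lemma antiferro_confP (R : realType) (x : conf R) :
  (forall n, x (n + 1) = x n + half R) <-> x = antiferro_conf (x 0).
Proof.
split=> [h|-> n]; last by rewrite /antiferro_conf mulrzDr mulr1z addrA.
apply/funext => n; rewrite /antiferro_conf.
elim/int_ind: n => [|n IH|n IH]; first by rewrite mulr0z addr0.
  by rewrite -addn1 PoszD h IH mulrzDr mulr1z addrA.
have := h (- n.+1%:Z); rewrite -addn1 PoszD opprD subrK IH => e.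
by rewrite mulrzBr mulr1z addrA e addrK.
Qed.

Lemma measurable_borel_conf (R : realType) (f : circle R -> conf R) :
  (forall n, continuous (f ^~ n)) -> measurable_fun setT f.
Proof.
move=> cf; apply: (measurability (open : set (set (conf R)))) => //.
move=> _ [A oA <-]; rewrite setTI; apply: sub_sigma_algebra.
suff /continuousP : continuous f by apply.
move=> x; apply/cvg_sup; first exact: (fmap_filter _ (nbhs_filter x)).
move=> n U [_ [[W oW <-] Wfx] WU].
have : nbhs (f x n) W by apply: open_nbhs_nbhs; split; [exact: oW|exact: Wfx].
move=> /(cf n x); apply: (@filterS _ _ (nbhs_filter x)) => y Wy.
exact: WU.
Qed.

Lemma measurable_ferro_conf (R : realType) : measurable_fun setT (@ferro_conf R).
Proof. by apply: measurable_borel_conf => n x; exact: cvg_id. Qed.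

Lemma measurable_antiferro_conf (R : realType) :
  measurable_fun setT (@antiferro_conf R).
Proof. by apply: measurable_borel_conf => n; exact: continuous_circle_shift. Qed.

Definition ferro_phase (R : realType) : probability (conf R) R :=
  image_probability (leb R) (@measurable_ferro_conf R).

Definition antiferro_phase (R : realType) : probability (conf R) R :=
  image_probability (leb R) (@measurable_antiferro_conf R).

(* The term of index m >= 1 of a sequence indexed by {1, 2, ...}. *)
Definition sgn_at (s : cantor_space) (m : nat) : bool := s m.-1.

(* The 1-periodic function on R induced by U. *)
Definition periodic_lift (R : realType) (U : circle R -> R) : R -> R := U \o @circ R.

Definition smooth (R : realType) (U : circle R -> R) : Prop :=
  forall n x, derivable (derive1n n (periodic_lift U)) x 1.

(* Continuity for the C^oo topology: every derivative depends continuously on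
   the parameter for the topology of uniform convergence. *)
Definition Cinfty_continuous (R : realType) (X : topologicalType)
    (U : X -> circle R -> R) : Prop :=
  forall n, continuous
    (fun s => derive1n n (periodic_lift (U s)) : {uniform R -> R}).

Definition beta_ (R : realType) (m : nat) : R := 2 ^+ ((m + 10) ^ 3).

Definition bond (R : realType) (x : conf R) : circle R := x 0 - x 1.

Definition circle_arc (R : realType) (a r : R) : set (circle R) :=
  @circ R @` `[a - r, a + r].

(* [true] stands for +, [false] for -. *)
Definition concentrated (R : realType) (U : cantor_space -> circle R -> R) : Prop :=
  forall (s : cantor_space) (m n : nat) (b : R), (1 <= m <= n)%N ->
    (forall j, (m <= j <= n)%N -> sgn_at s j = sgn_at s m) ->
    beta_ R m <= b <= beta_ R n ->
    let near_center :=
      circle_arc (if sgn_at s m then 0 else 2^-1) (2 ^- (m.+1 ^ 2)) in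
    ((1 - 2 ^- m)%:E <=
      gibbs_measure (fun t => b * U s t)%R (@bond R @^-1` near_center))%E.

(* Main.v *)
(* For U bounded and measurable, the DLR equations of Phi_U are solved by the
   law of the configuration whose value at the site 0 is uniform and whose
   increments are independent with density e^U / Z, all of them being read off
   the binary digits of a single uniform variable. Since changing the boundary
   condition multiplies the kernels by a bounded factor K^2 only, a Gibbs measure
   dominates d = 1 / (K^2 + 1) times any other one; removing this part and
   iterating gives domination by 1 - (1 - d)^n, hence uniqueness. So every Gibbs
   measure has a uniform marginal at 0 and identically distributed bonds
   x k - x (k + 1), and the concentration of the bond at 0 forces all bonds in a
   window to be close to 0 (or 1/2). By compactness of T^Z a continuous function
   is then nearly constant between x and the (anti)ferromagnetic configuration
   through x 0, whose law is the phase: this gives convergence. *)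

Require Import Defs.
From HB Require Import structures.
From mathcomp Require Import all_boot all_order all_algebra.
From mathcomp Require Import finmap generic_quotient.
From mathcomp Require Import all_classical all_reals all_analysis.
From mathcomp Require Import measurable_realfun.
From mathcomp Require Import ring lra zify.

Set Implicit Arguments.
Unset Strict Implicit.
Unset Printing Implicit Defensive.

Import Order.TTheory GRing.Theory Num.Theory.
Import numFieldNormedType.Exports.

Local Open Scope classical_set_scope.
Local Open Scope ring_scope.

(** Everything about [gibbs_measure] goes through existence and uniqueness: [get] returns a Gibbs
    measure only if there is one, and [chaotic] quantifies over all choices of Gibbs measures, while
    the concentration hypothesis speaks of one bond under the selected one. The constant K is exp(4
    C) when |U| is at most C: in dimension one a window of sites meets its complement in two bonds
    only, and the energy of each changes by at most 2 C, whatever the size of the window. This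
    uniformity is what lets the comparison of kernels on cylinders pass to all Borel sets. A single
    uniform variable suffices for the construction because its digits can be split in two again and
    again, so that a pushforward replaces an infinite product of probability spaces. Measures are
    compared on measurable sets only and the weak* topology sees integrals only, so two different
    limits are told apart by an explicit test function, cos(2 pi (x 0 - x 1)), equal to 1 on
    ferromagnetic and to -1 on antiferromagnetic configurations. *)

Lemma circ_intr (R : realType) (z : int) : circ (z%:~R : R) = 0.
Proof. by rewrite -(raddf0 (@circ R)); apply/circ_eqP; rewrite subr0 intr_int. Qed.

Lemma circDz (R : realType) (x : R) (z : int) : circ (x + z%:~R) = circ x.
Proof. by rewrite raddfD /= circ_intr addr0. Qed.

(** [repr] gives an arbitrary representative; removing its integer part gives the one in [0, 1),
    which makes [crep] a measurable section of [circ]. *)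
Definition crep (R : realType) (t : circle R) : R :=
  repr t - (Num.floor (repr t))%:~R.

Lemma crepK (R : realType) : cancel (@crep R) (@circ R).
Proof.
by move=> t; rewrite /crep -mulrNz circDz /circ reprK.
Qed.

Lemma crep_itv (R : realType) (t : circle R) : 0 <= crep t < 1.
Proof.
have := floor_itv (repr t); rewrite /crep intrD => /andP[h1 h2].
by rewrite subr_ge0 h1 /= ltrBlDl.
Qed.

Lemma circ_inj_itv (R : realType) (x y : R) :
  0 <= x < 1 -> 0 <= y < 1 -> circ x = circ y -> x = y.
Proof.
move=> /andP[x0 x1] /andP[y0 y1] /circ_eqP /intrP[z xyz].
have z1 : z%:~R < 1 :> R by lra.
have z2 : -1 < z%:~R :> R by lra.
have : z = 0 by move: z1 z2; rewrite -(rmorphN1 intr) -(mulr1z 1) !ltr_int; lia.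
by move=> z0; move: xyz; rewrite z0 mulr0z; lra.
Qed.

Lemma circK (R : realType) (x : R) : 0 <= x < 1 -> crep (circ x) = x.
Proof.
move=> x01; apply: circ_inj_itv => //; first exact: crep_itv.
exact: crepK.
Qed.

(** * Topology and measurability of the circle *)

Lemma open_circle (R : realType) (A : set (circle R)) :
  open (@circ R @^-1` A) -> open A.
Proof. by []. Qed.

Lemma closed_circle (R : realType) (A : set (circle R)) :
  closed (@circ R @^-1` A) -> closed A.
Proof. by rewrite -!openC preimage_setC; exact: open_circle. Qed.

Lemma circle_arcP (R : realType) (a r y : R) :
  circle_arc a r (circ y) <-> exists n : int, `|y - a - n%:~R| <= r.
Proof.
split=> [[x /=]|[n yn]].
  rewrite in_itv /= => /andP[x1 x2] /esym/circ_eqP/intrP[n yxn].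
  by exists n; rewrite ler_norml; apply/andP; split; lra.
exists (y - n%:~R); last by rewrite -mulrNz circDz.
by rewrite /= in_itv /=; move: yn; rewrite ler_norml => /andP[? ?]; apply/andP; split; lra.
Qed.

Lemma closed_circle_arc (R : realType) (a r : R) : closed (circle_arc a r).
Proof.
apply: closed_circle; rewrite -openC openE => y /= yar.
have far n : r < `|y - a - n%:~R|.
  by rewrite ltNge; apply/negP => h; apply: yar; apply/circle_arcP; exists n.
pose m := Num.floor (y - a).
(* Among the integer translates, the two integers around [y - a] are the closest ones, so their two
   margins already bound the margin of every [n]. *)
pose e := Num.min (`|y - a - m%:~R| - r) (`|y - a - (m + 1)%:~R| - r).
have e0 : 0 < e by rewrite lt_min !subr_gt0 !far.
apply/nbhs_ballP; exists e => // z /=; rewrite /ball /= => yz.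
move=> /circle_arcP[n zn].
have /andP[m1 m2] := floor_itv (y - a).
have : e + r <= `|y - a - n%:~R|.
  have [nm|mn] := leP n m.
    rewrite -lerBrDr; apply: (@le_trans _ _ (`|y - a - m%:~R| - r)).
      by rewrite /e ge_min lexx.
    have nm' : n%:~R <= m%:~R :> R by rewrite ler_int.
    by rewrite lerD2r; rewrite /m in nm' *; rewrite !ger0_norm; lra.
  rewrite -lerBrDr; apply: (@le_trans _ _ (`|y - a - (m + 1)%:~R| - r)).
    by rewrite /e ge_min lexx orbT.
  have nm' : (m + 1)%:~R <= n%:~R :> R by rewrite ler_int lezD1.
  by rewrite lerD2r; rewrite /m in nm' *; rewrite !ler0_norm; lra.
apply/negP; rewrite -ltNge.
have -> : y - a - n%:~R = (y - z) + (z - a - n%:~R) by ring.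
by apply: (le_lt_trans (ler_normD _ _)); apply: ltr_leD.
Qed.

Lemma measurable_circle_arc (R : realType) (a r : R) :
  measurable (circle_arc a r).
Proof.
rewrite -[circle_arc a r]setCK; apply: measurableC; apply: sub_sigma_algebra.
by rewrite openC; exact: closed_circle_arc.
Qed.

Lemma compact_circle (R : realType) : compact [set: circle R].
Proof.
rewrite (_ : setT = @circ R @` `[0, 1]); last first.
  apply/esym/seteqP; split=> // t _; exists (crep t); last exact: crepK.
  by rewrite /= in_itv /=; have /andP[-> /ltW] := crep_itv t.
apply: continuous_compact; last exact: segment_compact.
by apply: continuous_subspaceT => x; exact: continuous_circ.
Qed.

(** [crep] jumps at 0, so preimages of open sets need not be open. But the set where [crep] is below
    [r] is a countable union of closed arcs, the images of [0, r - 1/(n+1)]; centre and radius are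
    both half of that right endpoint. *)
Lemma measurable_crep (R : realType) :
  measurable_fun setT (@crep R : circle R -> measurableTypeR R).
Proof.
apply: (measurability (@RGenCInfty.G R)).
  exact: RGenCInfty.measurableE.
move=> _ [_ [r ->] <-]; rewrite setTI.
rewrite -[X in measurable X]setCK; apply: measurableC.
have [r0|r0] := leP r 0.
  rewrite (_ : ~` _ = set0) //; apply/seteqP; split => // t /=.
  by rewrite in_itv /= andbT; have /andP[? _] := crep_itv t; apply; lra.
have [r1|r1] := ltP 1 r.
  rewrite (_ : ~` _ = setT) //; apply/seteqP; split => // t _ /=.
  by rewrite in_itv /= andbT; have /andP[_ ?] := crep_itv t => ?; lra.
rewrite (_ : ~` _ = \bigcup_n circle_arc (r / 2 - n.+1%:R^-1 / 2) (r / 2 - n.+1%:R^-1 / 2)).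
  by apply: bigcupT_measurable => n; exact: measurable_circle_arc.
apply/seteqP; split => [t /=|t [n _ [x /=]]].
  rewrite in_itv /= andbT => /negP; rewrite -ltNge => tr.
  have [n nr] := ltr_add_invr tr.
  exists n => //; exists (crep t); last exact: crepK.
  have /andP[t0 _] := crep_itv t.
  rewrite /= in_itv /=; move: nr t0; set z := _^-1 => nr t0; apply/andP; split; lra.
have n0 : 0 < n.+1%:R^-1 :> R by [].
rewrite !in_itv /= andbT; move: n0; set z := _^-1 => n0 /andP[x0 xr] <-.
have xr' : x < r by lra.
rewrite circK; last by apply/andP; split; lra.
by apply/negP; rewrite -ltNge.
Qed.

(** Going through [crep] turns the difference on the circle into a difference of real functions, so
    no product structure on the Borel sets of the circle is involved. *)
Lemma measurable_fun_circleB d (T : measurableType d) (R : realType) (f g : T -> circle R) :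
  measurable_fun setT f -> measurable_fun setT g ->
  measurable_fun setT (fun x => f x - g x).
Proof.
move=> mf mg.
have -> : (fun x => f x - g x) = @circ R \o (fun x => crep (f x) - crep (g x)).
  by apply/funext => x /=; rewrite raddfB /= !crepK.
apply: measurableT_comp; first exact: measurable_circ.
apply: measurable_funB.
  exact: (measurableT_comp (@measurable_crep R)).
exact: (measurableT_comp (@measurable_crep R)).
Qed.

(** * The Borel sets of the configuration space *)

Definition box (R : realType) (c : seq (int * (rat * rat))) : set (conf R) :=
  [set x | all (fun i => x i.1 \in @circ R @` `]ratr i.2.1, ratr i.2.2[) c].

Lemma open_circ_itv (R : realType) (p q : R) : open (@circ R @` `]p, q[).
Proof.
apply: open_circle.
rewrite (_ : _ @^-1` _ =
    \bigcup_(n : int) ((fun y : R => y - n%:~R) @^-1` `]p, q[)).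
  apply: bigcup_open => n _; apply: open_comp; last exact: interval_open.
  by move=> x _; apply: cvgB; [exact: cvg_id|exact: cvg_cst].
apply/seteqP; split => [y [x xpq /esym/circ_eqP/intrP[n yxn]]|y [n _ ypq]].
  by exists n => //=; rewrite -yxn opprB addrC subrK.
by exists (y - n%:~R) => //; rewrite -mulrNz circDz.
Qed.

Lemma measurable_box (R : realType) c : measurable (@box R c).
Proof.
rewrite /box; elim: c => [|[k [p q]] c IH] /=.
  by rewrite (_ : [set _ | _] = setT) //; apply/seteqP; split.
rewrite (_ : [set _ | _] =
    (fun x : conf R => x k) @^-1` (@circ R @` `]ratr p, ratr q[) `&` @box R c).
  apply: measurableI; last exact: IH.
  apply: sub_sigma_algebra.
  apply: open_comp; last exact: open_circ_itv.
  move=> x _; exact: (@proj_continuous int (fun=> circle R) k).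
apply/seteqP; split => x /=; first by move=> /andP[/set_mem].
by move=> [h1 h2]; apply/andP; split => //; apply/mem_set.
Qed.

(** Boxes are indexed by a countable type (finite lists of sites with rational endpoints), so this
    union is countable: this is what reduces Borel measurability on T^Z to single coordinates. The
    boxes containing [x] generate a filter, and its convergence to [x] is checked one coordinate at
    a time. *)
Lemma open_conf_box (R : realType) (A : set (conf R)) : open A ->
  A = \bigcup_(c in [set c | @box R c `<=` A]) @box R c.
Proof.
move=> oA; apply/seteqP; split => [x Ax|x [c cA]]; last exact: cA.
pose F := filter_from [set c | @box R c x] (@box R).
have FF : Filter F.
  apply: filter_from_filter; first by exists [::].
  move=> c1 c2 x1 x2; exists (c1 ++ c2) => [|y]; rewrite /box /= all_cat.
    by apply/andP.
  by move=> /andP[].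
suff /(_ A) [] : F --> (x : conf R).
- by apply: open_nbhs_nbhs.
- by move=> c xc cA; exists c.
apply/cvg_sup => k U [_ [[W oW <-] Wx] WU].
have : nbhs (crep (x k)) (@circ R @^-1` W).
  apply: open_nbhs_nbhs; split => //=; last by rewrite crepK.
move=> /nbhs_ballP[e /= e0 eW].
have ltp : crep (x k) - e < crep (x k) by lra.
have [p] := rat_in_itvoo ltp.
have ltq : crep (x k) < crep (x k) + e by lra.
have [q] := rat_in_itvoo ltq.
rewrite !in_itv /= => /andP[q1 q2] /andP[p1 p2].
exists [:: (k, (p, q))] => [|y]; rewrite /box /=.
  rewrite andbT; apply/mem_set; exists (crep (x k)); last exact: crepK.
  by rewrite /= in_itv /= p2 q1.
rewrite andbT => /set_mem[z /=]; rewrite in_itv /= => /andP[pz zq] zy.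
apply: WU; rewrite /= -zy; apply: eW; rewrite /ball /= ltr_norml.
by apply/andP; split; lra.
Qed.

Lemma measurable_fun_conf d (T : measurableType d) (R : realType) (f : T -> conf R) :
  (forall k, measurable_fun setT (fun x => f x k)) -> measurable_fun setT f.
Proof.
move=> mf; apply: (measurability (open : set (set (conf R)))) => //.
move=> _ [A oA <-]; rewrite setTI (open_conf_box oA).
rewrite preimage_bigcup bigcup_mkcond.
apply: countable_bigcupT_measurable => // c; case: ifPn => _ //.
elim: c => [|[k [p q]] c IH].
  by rewrite (_ : _ @^-1` _ = setT) //; apply/seteqP; split.
rewrite (_ : _ @^-1` _ = (fun x => f x k) @^-1` (@circ R @` `]ratr p, ratr q[)
    `&` f @^-1` (@box R c)).
  apply: measurableI; last exact: IH.
  rewrite -[X in measurable X]setTI; apply: mf => //.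
  by apply: sub_sigma_algebra; exact: open_circ_itv.
apply/seteqP; split => x /=; first by move=> /andP[/set_mem].
by move=> [h1 h2]; apply/andP; split => //; apply/mem_set.
Qed.

Lemma measurable_proj_conf (R : realType) (k : int) :
  measurable_fun setT (fun x : conf R => x k).
Proof.
apply: (measurability (open : set (set (circle R)))) => //.
move=> _ [A oA <-]; rewrite setTI; apply: sub_sigma_algebra.
apply: open_comp => // x _; exact: (@proj_continuous int (fun=> circle R) k).
Qed.

Lemma measurable_bond_at (R : realType) (k l : int) :
  measurable_fun setT (fun x : conf R => x k - x l).
Proof. by apply: measurable_fun_circleB; exact: measurable_proj_conf. Qed.

Lemma measurable_dfwith d (T : measurableType d) (R : realType) (k : int)
    (f : T -> conf R) (g : T -> circle R) :
  measurable_fun setT f -> measurable_fun setT g ->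
  measurable_fun setT (fun u => dfwith (f u) k (g u) : conf R).
Proof.
move=> mf mg; apply: measurable_fun_conf => l.
have [<-|kl] := eqVneq k l.
  by under eq_fun do rewrite dfwithin.
under eq_fun do rewrite dfwithout//.
exact: (measurableT_comp (@measurable_proj_conf R l)).
Qed.

Lemma dfwithC (I : eqType) (T : Type) (x : I -> T) k l t u : k != l ->
  dfwith (dfwith x k t) l u = dfwith (dfwith x l u) k t.
Proof.
move=> kl; apply/funext => j.
have [<-|lj] := eqVneq l j; first by rewrite dfwithin dfwithout// dfwithin.
have [<-|kj] := eqVneq k j; first by rewrite dfwithout// ?dfwithin // eq_sym.
by rewrite !dfwithout.
Qed.

(** * Iterated integrals over finitely many sites *)

Section leb_integral_seq.
Context (R : realType).
Local Open Scope ereal_scope.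
Implicit Types (s : seq int) (F G : conf R -> \bar R).

(** The same fold as [leb_integral], over a sequence instead of a finite set, so that sites can be
    concatenated and permuted. *)
Definition lebI s F : conf R -> \bar R :=
  foldr (fun k G x => \int[leb R]_t G (dfwith x k t)) F s.

Lemma lebI_cat s1 s2 F : lebI (s1 ++ s2) F = lebI s1 (lebI s2 F).
Proof. exact: foldr_cat. Qed.

Lemma lebI_ge0 s F : (forall x, 0 <= F x) -> forall x, 0 <= lebI s F x.
Proof. by move=> F0; elim: s => //= k s IH x; apply: integral_ge0. Qed.

Lemma measurable_dfwith_l F x k : measurable_fun setT F ->
  measurable_fun setT (fun t => F (dfwith x k t)).
Proof.
move=> mF; apply: (measurableT_comp mF).
exact: measurable_dfwith.
Qed.

Lemma measurable_lebI s F : measurable_fun setT F -> (forall x, 0 <= F x) ->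
  measurable_fun setT (lebI s F).
Proof.
move=> mF F0; elim: s => //= k s IH.
apply: (@measurable_fun_fubini_tonelli_F _ _ _ _ _ (leb R)
  (fun z : conf R * circle R => lebI s F (dfwith z.1 k z.2))) => [|z].
  apply: (measurableT_comp IH); exact: measurable_dfwith.
exact: lebI_ge0.
Qed.

Lemma lebI_swap k l F x : measurable_fun setT F -> (forall x, 0 <= F x) ->
  lebI [:: k; l] F x = lebI [:: l; k] F x.
Proof.
move=> mF F0 /=; have [->//|kl] := eqVneq k l.
rewrite (@fubini_tonelli _ _ _ _ _ (leb R) (leb R)
  (fun z => F (dfwith (dfwith x k z.1) l z.2))) //; last first.
  apply: (measurableT_comp mF); apply: measurable_dfwith => //.
  exact: measurable_dfwith.
by apply: eq_integral => t _; apply: eq_integral => u _; rewrite dfwithC.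
Qed.

(** Tonelli's theorem exchanges two neighbouring sites; the head of [s1] is moved to the front of
    [s2] by crossing the sites of [a] one at a time. *)
Lemma lebI_perm s1 s2 F : measurable_fun setT F -> (forall x, 0 <= F x) ->
  perm_eq s1 s2 -> lebI s1 F = lebI s2 F.
Proof.
move=> mF F0; elim: s1 s2 => [|k s1 IH] s2 p12.
  by move: p12; rewrite perm_sym => /perm_nilP ->.
have : k \in s2 by rewrite -(perm_mem p12) mem_head.
move=> /path.splitPr s2E; case: s2E p12 => a b.
rewrite perm_sym perm_catC cat_cons perm_cons perm_catC perm_sym => p12.
rewrite /= (IH _ p12) -[X in X = _]/(lebI (k :: a ++ b) F).
elim: a {p12} => [//|l a IHa]; apply/funext => x.
rewrite -[in RHS]/(lebI (l :: (a ++ k :: b)) F x) /= -IHa.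
exact: (@lebI_swap k l (lebI (a ++ b) F) x (measurable_lebI _ mF F0) (lebI_ge0 _ F0)).
Qed.

Lemma le_lebI s F G : measurable_fun setT F -> measurable_fun setT G ->
  (forall x, 0 <= F x) -> (forall x, F x <= G x) ->
  forall x, lebI s F x <= lebI s G x.
Proof.
move=> mF mG F0 FG; have G0 x : 0 <= G x by apply: le_trans (FG x).
elim: s => //= k s IH x; apply: ge0_le_integral => //.
- by move=> t _; exact: lebI_ge0.
- by apply: measurable_dfwith_l; exact: measurable_lebI.
- by apply: measurable_dfwith_l; exact: measurable_lebI.
Qed.

Definition indep_of (Y : Type) s (f : conf R -> Y) :=
  forall x k t, k \in s -> f (dfwith x k t) = f x.

Lemma lebI_Zl s (c : conf R -> \bar R) F : measurable_fun setT F ->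
  (forall x, 0 <= F x) -> (forall x, 0 <= c x) -> indep_of s c ->
  forall x, lebI s (fun y => c y * F y) x = c x * lebI s F x.
Proof.
move=> mF F0 c0; elim: s => //= k s IH ic x.
rewrite -ge0_integralZl //; first last.
- by move=> t _; exact: lebI_ge0.
- by apply: measurable_dfwith_l; exact: measurable_lebI.
apply: eq_integral => t _; rewrite IH ?ic ?mem_head//.
by move=> y l u ls; apply: ic; rewrite in_cons ls orbT.
Qed.

Lemma lebI_cst s (r : \bar R) x : lebI s (cst r) x = r.
Proof.
elim: s x => //= k s IH x; under eq_integral do rewrite IH.
by rewrite (integral_cst (leb R) measurableT) [X in _ * X]probability_setT mule1.
Qed.

(* Two boundary conditions are compared coordinatewise on the sites of s. *)
Lemma le_lebI2 s F G : measurable_fun setT F -> measurable_fun setT G ->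
  (forall x, 0 <= F x) -> (forall x, 0 <= G x) ->
  forall x y, (forall x' y', (forall k, k \in s -> x' k = y' k) ->
     (forall k, k \notin s -> x' k = x k) -> (forall k, k \notin s -> y' k = y k) ->
     F x' <= G y') ->
  lebI s F x <= lebI s G y.
Proof.
move=> mF mG F0 G0; elim: s => [|k s IH] x y FG /=; first exact: FG.
apply: ge0_le_integral => //.
- by move=> t _; exact: lebI_ge0.
- by apply: measurable_dfwith_l; exact: measurable_lebI.
- by apply: measurable_dfwith_l; exact: measurable_lebI.
move=> t _; apply: IH => x' y' xy x'x y'y; apply: FG.
- move=> j; have [js _|js] := boolP (j \in s); first exact: xy.
  by rewrite in_cons (negbTE js) orbF => /eqP jk; rewrite x'x// y'y// jk !dfwithin.
- move=> j; rewrite in_cons negb_or => /andP[jk js].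
  by rewrite x'x// dfwithout // eq_sym.
- move=> j; rewrite in_cons negb_or => /andP[jk js].
  by rewrite y'y// dfwithout // eq_sym.
Qed.

End leb_integral_seq.

(** * The uniform distribution *)

Definition U01 (R : realType) : probability (measurableTypeR R) R :=
  uniform_prob (@ltr01 R).

Section lebesgue_reflection.
Context (R : realType).
Notation mu := (@lebesgue_measure R).
Local Open Scope ereal_scope.

Lemma lebesgue_measure_reflection (r : R) (A : set R) : measurable A ->
  mu ((fun x => r - x)%R @^-1` A) = mu A.
Proof.
move=> mA; have mr : @measurable_fun _ _ (measurableTypeR R) (measurableTypeR R) setT (fun x => r - x)%R.
  by apply: measurable_funB.
pose f : {mfun measurableTypeR R >-> measurableTypeR R} :=
  @mfun_Sub _ _ (measurableTypeR R) (measurableTypeR R) _ (mem_set mr).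
apply/esym; apply: (@lebesgue_measure_unique R (pushforward mu f)) => //.
move=> X [[a b] _ <-] /=.
rewrite /pushforward /= (_ : _ @^-1` _ = `[(r - b)%R, (r - a)%R[%classic); last first.
  by apply/seteqP; split => x /=; rewrite !in_itv /= => /andP[? ?]; apply/andP; split; lra.
rewrite !lebesgue_measure_itv /= !lte_fin.
by rewrite ltrD2l ltrN2; case: ifP => // _; rewrite -!EFinD; congr EFin; ring.
Qed.

(** A translation is the composition of two reflections. *)
Lemma lebesgue_measure_translation1 (A : set R) : measurable A ->
  mu ((fun x => x + 1)%R @^-1` A) = mu A.
Proof.
move=> mA.
have mr : measurable_fun setT (fun x : measurableTypeR R => 1 - x : measurableTypeR R)%R.
  by apply: measurable_funB.
have mA' : measurable ((fun x : measurableTypeR R => 1 - x)%R @^-1` A).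
  by rewrite -[X in measurable X]setTI; exact: mr.
rewrite -(lebesgue_measure_reflection 1 mA) -(lebesgue_measure_reflection 0 mA').
congr (mu _); apply/seteqP; split => x /=; rewrite (_ : 1 - (0 - x) = x + 1)%R //; ring.
Qed.

Lemma uniform_probE (A : set R) : measurable A ->
  U01 R A = mu (A `&` `[0%R, 1%R[).
Proof.
move=> mA; rewrite -[U01 R A]/(uniform_prob (@ltr01 R) A) /uniform_prob integral_uniform_pdf.
rewrite (eq_integral (cst 1)); last first.
  by move=> x; rewrite inE /= in_itv /= /uniform_pdf => -[_ ->]; rewrite subr0 invr1.
rewrite integral_cst ?mul1e; last exact: measurableI.
apply/eqP; rewrite eq_le; apply/andP; split; last first.
  apply: le_measure; rewrite ?inE; try exact: measurableI.
  by apply: setIS => x /=; rewrite !in_itv /= => /andP[-> /ltW ->].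
rewrite -(@measureU0 _ _ _ mu (A `&` `[0%R, 1%R[) [set 1%R]); first last.
- exact: lebesgue_measure_set1.
- exact: measurable_set1.
- exact: measurableI.
apply: le_measure; rewrite ?inE; first exact: measurableI.
  by apply: measurableU; [exact: measurableI|exact: measurable_set1].
move=> x [Ax]; rewrite /= !in_itv /= => /andP[x0].
by rewrite le_eqVlt => /orP[/eqP|x1]; [right|left; split => //; apply/andP].
Qed.

Lemma uniform_prob_oo (A : set R) : measurable A ->
  U01 R A = mu (A `&` `]0%R, 1%R[).
Proof.
move=> mA; rewrite uniform_probE //.
have m01 : measurable (A `&` `]0%R, 1%R[) by exact: measurableI.
apply/eqP; rewrite eq_le; apply/andP; split; last first.
  apply: le_measure; rewrite ?inE //; first exact: measurableI.
  by apply: setIS => x /=; rewrite !in_itv /= => /andP[/ltW -> ->].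
rewrite -(@measureU0 _ _ _ mu _ [set 0%R] m01); first last.
- exact: lebesgue_measure_set1.
- exact: measurable_set1.
apply: le_measure; rewrite ?inE; first exact: measurableI.
  by apply: measurableU => //; exact: measurable_set1.
move=> x [Ax]; rewrite /= !in_itv /= => /andP[x0 x1].
by move: x0; rewrite le_eqVlt => /orP[/eqP <-|x0]; [right|left; split => //; apply/andP].
Qed.

Lemma uniform_prob_oc (A : set R) : measurable A ->
  U01 R A = mu (A `&` `]0%R, 1%R]).
Proof.
move=> mA; rewrite uniform_prob_oo //.
have m01 : measurable (A `&` `]0%R, 1%R[) by exact: measurableI.
apply/eqP; rewrite eq_le; apply/andP; split.
  apply: le_measure; rewrite ?inE //; first exact: measurableI.
  by apply: setIS => x /=; rewrite !in_itv /= => /andP[-> /ltW ->].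
rewrite -[leRHS](@measureU0 _ _ _ mu _ [set 1%R] m01); first last.
- exact: lebesgue_measure_set1.
- exact: measurable_set1.
apply: le_measure; rewrite ?inE; first exact: measurableI.
  by apply: measurableU => //; exact: measurable_set1.
move=> x [Ax]; rewrite /= !in_itv /= => /andP[x0].
by rewrite le_eqVlt => /orP[/eqP|x1]; [right|left; split => //; apply/andP].
Qed.

Lemma uniform_prob_itv (r : R) : (0 <= r <= 1)%R -> U01 R `]-oo, r]%classic = r%:E.
Proof.
move=> /andP[r0 r1]; rewrite uniform_prob_oc //.
rewrite (_ : _ `&` _ = `]0%R, r]%classic); last first.
  apply/seteqP; split => x /=; rewrite !in_itv /=; first by move=> [-> /andP[->]].
  by move=> /andP[-> xr]; split=> //; rewrite (le_trans xr).
rewrite lebesgue_measure_itv /= lte_fin; case: ltP => [_|]; first by rewrite -EFinD subr0.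
by move=> r0'; congr EFin; apply/eqP; rewrite eq_le r0 r0'.
Qed.

(** On representatives the reflection sends [0, 1) onto (r - 1, r]. The piece (r - 1, 0] is carried
    to (r, 1] by the translation by 1, which preserves the periodic set [B]; the piece (0, r] is
    common to both sides. *)
Lemma leb_reflection (c : circle R) (A : set (circle R)) : measurable A ->
  leb R ((fun t => c - t)%R @^-1` A) = leb R A.
Proof.
move=> mA; pose B := @circ R @^-1` A; pose r := crep c.
have /andP[r0 r1] : (0 <= r < 1)%R := crep_itv c.
have mB : measurable (B : set (measurableTypeR R)).
  by rewrite -[X in measurable X]setTI; exact: measurable_circ.
have B1 x : B (x + 1)%R = B x by rewrite /B /= -[1%R]/(1%:~R : R) circDz.
have mrefl : measurable_fun setT (fun x : measurableTypeR R => r - x : measurableTypeR R)%R.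
  by apply: measurable_funB.
rewrite -[LHS]/(U01 R (@circ R @^-1` ((fun t => c - t)%R @^-1` A))) -[RHS]/(U01 R B).
rewrite (_ : _ @^-1` _ = (fun x => r - x)%R @^-1` B); last first.
  by apply/seteqP; split => x /=; rewrite /B /= raddfB /= crepK.
rewrite uniform_probE; last by rewrite -[X in measurable X]setTI; exact: mrefl.
rewrite uniform_prob_oc //.
have mC : measurable (B `&` `](r - 1)%R, r]) by exact: measurableI.
rewrite (_ : _ `&` _ = (fun x => r - x)%R @^-1` (B `&` `](r - 1)%R, r])); last first.
  apply/seteqP; split => x /=; rewrite !in_itv /= => -[Bx /andP[h1 h2]]; split => //; apply/andP; split; lra.
rewrite lebesgue_measure_reflection //.
have mD : measurable (B `&` `]r, 1%R]) by exact: measurableI.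
have mE : measurable (B `&` `]0%R, r]) by exact: measurableI.
rewrite (_ : B `&` `]0%R, 1%R] = (B `&` `]r, 1%R]) `|` (B `&` `]0%R, r])); last first.
  rewrite -setIUr; congr (_ `&` _); apply/seteqP; split => x /=; rewrite !in_itv /=.
    by move=> /andP[x0 x1]; have [xr|rx] := leP x r; [right; rewrite x0|left; rewrite x1].
  by move=> [|] /andP[h1 h2]; apply/andP; split; lra.
rewrite (_ : B `&` `](r - 1)%R, r] = (B `&` `](r - 1)%R, 0%R]) `|` (B `&` `]0%R, r])); last first.
  rewrite -setIUr; congr (_ `&` _); apply/seteqP; split => x /=; rewrite !in_itv /=.
    by move=> /andP[x0 x1]; have [xr|rx] := leP x 0%R; [left; rewrite x0|right; rewrite x1].
  by move=> [|] /andP[h1 h2]; apply/andP; split; lra.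
have mF : measurable (B `&` `](r - 1)%R, 0%R]) by exact: measurableI.
rewrite !measureU //; last 2 first.
- apply/seteqP; split => // x /= [[_ h1] [_]]; move: h1; rewrite !in_itv /=.
  by move=> /andP[h1 h2] /andP[h3 h4]; lra.
- apply/seteqP; split => // x /= [[_ h1] [_]]; move: h1; rewrite !in_itv /=.
  by move=> /andP[h1 h2] /andP[h3 h4]; lra.
congr (_ + _); rewrite -[RHS]/(mu (B `&` `]r, 1%R])) -(lebesgue_measure_translation1 mD); congr (mu _).
apply/seteqP; split => x /=; rewrite B1 !in_itv /= => -[Bx /andP[h1 h2]];
  by split => //; apply/andP; split; lra.
Qed.

Lemma measurable_circleB_l (c : circle R) : measurable_fun setT (fun t : circle R => c - t)%R.
Proof. exact: measurable_fun_circleB. Qed.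

Lemma integral_leb_reflection (c : circle R) (f : circle R -> \bar R) :
  measurable_fun setT f -> (forall t, 0 <= f t) ->
  \int[leb R]_t f (c - t)%R = \int[leb R]_t f t.
Proof.
move=> mf f0; have mc := measurable_circleB_l c.
rewrite -[LHS]/(\int[leb R]_(t in (fun t => c - t)%R @^-1` setT) (f \o (fun t => c - t)%R) t).
rewrite -(ge0_integral_pushforward mc) //.
apply: (@eq_measure_integral _ _ _ _ (leb R) (image_probability (leb R) mc)) => B mB _.
exact: leb_reflection.
Qed.

Lemma integral_leb_translation (c : circle R) (f : circle R -> \bar R) :
  measurable_fun setT f -> (forall t, 0 <= f t) ->
  \int[leb R]_t f (c + t)%R = \int[leb R]_t f t.
Proof.
move=> mf f0; rewrite -[RHS](integral_leb_reflection c mf f0).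
rewrite -[RHS](@integral_leb_reflection 0%R (fun t => f (c - t)%R)) //.
  by apply: eq_integral => t _; rewrite sub0r opprK.
by apply: (measurableT_comp mf); exact: measurable_circleB_l.
Qed.

Lemma integral_leb (f : circle R -> \bar R) :
  measurable_fun setT f -> (forall t, 0 <= f t) ->
  \int[leb R]_t f t = \int[U01 R]_u f (circ u).
Proof.
move=> mf f0.
rewrite -[RHS]/(\int[U01 R]_(u in @circ R @^-1` setT) (f \o @circ R) u).
by rewrite -(ge0_integral_pushforward (@measurable_circ R)).
Qed.

End lebesgue_reflection.

(* Without this, simplification exposes the integral defining [uniform_prob]. *)
Opaque U01.

Lemma measurable_halflineE (R : realType) :
  (@measurable _ (measurableTypeR R)) =
  <<s [set A : set R | exists r, A = `]-oo, r]%classic] >>.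
Proof.
set G := (X in <<s X >>).
apply/seteqP; split; last first.
  apply: smallest_sub; first exact: sigma_algebra_measurable.
  by move=> _ [r ->]; exact: measurable_itv.
rewrite RGenInftyO.measurableE.
apply: smallest_sub; first exact: smallest_sigma_algebra.
move=> _ [r ->].
rewrite -(setCK `]-oo, r[%classic) setCitvl itvcyEbigcap.
apply: (@measurableC _ (g_sigma_algebraType G)).
apply: (@bigcapT_measurable _ (g_sigma_algebraType G)) => k.
rewrite -setCitvl; apply: (@measurableC _ (g_sigma_algebraType G)).
by apply: sub_sigma_algebra; eexists; reflexivity.
Qed.

(** Half-lines are stable under intersection, so Dynkin's lemma applies: laws on the line are
    compared through their distribution functions. *)
Lemma halfline_induction (R : realType) (P : set R -> Prop) :
  P setT -> (forall r, P `]-oo, r]%classic) ->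
  (forall A, measurable A -> P A -> P (~` A)) ->
  (forall F : (set R)^nat, (forall n, measurable (F n)) -> trivIset setT F ->
    (forall n, P (F n)) -> P (\bigcup_n F n)) ->
  forall A, measurable A -> P A.
Proof.
move=> PT PI PC PU A mA.
have GE := measurable_halflineE R.
apply: (dynkin_induction GE) => //.
- by move=> _ _ [r ->] [s ->]; exists (Num.min r s); apply/seteqP; split => x /=;
     rewrite !in_itv /= le_min; [move=> [-> ->]|move=> /andP[]].
- by move=> _ [r ->].
- by rewrite -GE.
Qed.

(** * Two independent uniform variables from one *)

(* The binary digits of [digits b n m] are b m, b (m / 4), b (m / 16), ...: for
   b = odd and b = (fun m => odd m./2) they are the bits of m at even and at odd
   positions. *)
Fixpoint digits (b : nat -> bool) (n m : nat) : nat :=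
  if n is n'.+1 then ((digits b n' m./2./2).*2 + b m)%N else 0%N.

Lemma digitsS b n m : digits b n.+1 m = ((digits b n m./2./2).*2 + b m)%N.
Proof. by []. Qed.

Lemma sum_nat_double (V : nmodType) (N : nat) (g : nat -> V) :
  \sum_(0 <= m < N.*2) g m = \sum_(0 <= m < N) (g m.*2 + g m.*2.+1).
Proof.
elim: N => [|N IH]; first by rewrite !big_geq.
by rewrite doubleS !big_nat_recr //= IH addrA.
Qed.

(** Splitting the bits of [m] by the parity of their position is a bijection from [0, 4^n) onto
    pairs in [0, 2^n). The induction peels off the two lowest bits of [m], that is, one bit of each
    component. *)
Lemma sum_digits (V : nmodType) (n : nat) (f : nat -> nat -> V) :
  \sum_(0 <= m < 4 ^ n)
     f (digits odd n m) (digits (fun m => odd m./2) n m) =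
  \sum_(0 <= i < 2 ^ n) \sum_(0 <= j < 2 ^ n) f i j.
Proof.
elim: n f => [|n IH] f; first by rewrite !expn0 !big_nat1.
rewrite (_ : 4 ^ n.+1 = (4 ^ n).*2.*2)%N; last by rewrite expnS; lia.
rewrite (_ : 2 ^ n.+1 = (2 ^ n).*2)%N; last by rewrite expnS; lia.
rewrite !sum_nat_double.
pose g i j := f i.*2 j.*2 + f i.*2.+1 j.*2 + (f i.*2 j.*2.+1 + f i.*2.+1 j.*2.+1).
transitivity (\sum_(0 <= m < 4 ^ n)
     g (digits odd n m) (digits (fun m => odd m./2) n m)).
  apply: eq_bigr => m _; rewrite !digitsS.
  have h0 : (m.*2.*2)./2 = m.*2 by rewrite doubleK.
  have h1 : (m.*2.*2.+1)./2 = m.*2 by lia.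
  have h2 : (m.*2.+1.*2)./2 = m.*2.+1 by rewrite doubleK.
  have h3 : (m.*2.+1.*2.+1)./2 = m.*2.+1 by lia.
  have h4 : (m.*2.+1)./2 = m by lia.
  have o1 k : odd k.*2.+1 = true by rewrite /= odd_double.
  by rewrite h0 h1 h2 h3 h4 doubleK !o1 !odd_double !addn0 !addn1.
rewrite IH; apply: eq_bigr => i _.
rewrite !sum_nat_double -big_split; apply: eq_bigr => j _ /=.
by rewrite /g addrACA.
Qed.

Section bit_interleaving.
Context (R : realType).
Implicit Types (u r s : R) (b : nat -> bool).
Notation mu := (@lebesgue_measure R).

(** For [m] below 4^n, the numbers of [0, 1) whose first 2n binary digits spell [m]. *)
Definition cell (n m : nat) : set R := `[m%:R / 4 ^+ n, m.+1%:R / 4 ^+ n[%classic.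

Lemma cellP n m u : cell n m u <-> m%:R <= 4 ^+ n * u < m.+1%:R.
Proof.
have n0 : 0 < 4 ^+ n :> R by rewrite exprn_gt0.
by rewrite /cell /= in_itv /= ler_pdivrMr // ltr_pdivlMr // mulrC.
Qed.

Lemma cell_exists n u : 0 <= u < 1 -> exists2 m, (m < 4 ^ n)%N & cell n m u.
Proof.
move=> /andP[u0 u1].
have n0 : 0 < 4 ^+ n :> R by rewrite exprn_gt0.
have v0 : 0 <= 4 ^+ n * u by rewrite mulr_ge0 // ltW.
have h := truncn_itv v0.
exists (Num.trunc (4 ^+ n * u)); last exact/cellP.
move: h => /andP[h _]; rewrite -(ltr_nat R) natrX.
by apply: (le_lt_trans h); rewrite -[ltRHS]mulr1 ltr_pM2l.
Qed.

Lemma cell_uniq n m m' u : cell n m u -> cell n m' u -> m = m'.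
Proof.
move=> /cellP/andP[h1 h2] /cellP/andP[h3 h4].
have := le_lt_trans h1 h4; have := le_lt_trans h3 h2.
by rewrite !ltr_nat !ltnS => *; apply/eqP; rewrite eqn_leq; apply/andP.
Qed.

Lemma cell_itv n m u : (m < 4 ^ n)%N -> cell n m u -> 0 <= u < 1.
Proof.
move=> mn /cellP/andP[h1 h2].
have n0 : 0 < 4 ^+ n :> R by rewrite exprn_gt0.
apply/andP; split; first by rewrite -(pmulr_rge0 _ n0) (le_trans _ h1).
rewrite -(ltr_pM2l n0) mulr1 (lt_le_trans h2) //.
by rewrite -natrX ler_nat.
Qed.

Lemma cell_half n m u : cell n.+1 m u -> cell n m./2./2 u.
Proof.
move=> /cellP; rewrite exprS -mulrA; set v := _ * u => /andP[h1 h2].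
have e1 : (m./2./2 * 4 <= m)%N by lia.
have e2 : (m.+1 <= (m./2./2).+1 * 4)%N by lia.
move: e1 e2; rewrite -!(ler_nat R) !natrM => e1 e2.
by apply/cellP; rewrite -/v; apply/andP; split; lra.
Qed.

Lemma measurable_cell n m : measurable (cell n m : set (measurableTypeR R)).
Proof. exact: measurable_itv. Qed.

Lemma lebesgue_measure_cell n m : mu (cell n m) = (4 ^- n)%:E.
Proof.
have n0 : 0 < 4 ^+ n :> R by rewrite exprn_gt0.
rewrite /cell lebesgue_measure_itv /= lte_fin ltr_pM2r ?invr_gt0 // ltr_nat ltnSn.
by rewrite -EFinD -mulrBl -natrB // subSnn mul1r.
Qed.

(** Independence of the two digit strings, exact at each finite level: all cells have measure 4^-n,
    and by [sum_digits] the number of selected cells is a product of two counts. *)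
Lemma lebesgue_measure_cells n (p q : pred nat) :
  mu (\big[setU/set0]_(m < 4 ^ n | p (digits odd n m) &&
      q (digits (fun m => odd m./2) n m)) cell n m) =
  ((\sum_(0 <= i < 2 ^ n) (p i)%:R) / 2 ^+ n *
   ((\sum_(0 <= i < 2 ^ n) (q i)%:R) / 2 ^+ n))%:E.
Proof.
rewrite [LHS](measure_bigsetU_ord_cond mu); first last.
- apply/trivIsetP => i j _ _ ij; apply/seteqP; split => // u [ui uj].
  by move: ij; rewrite -val_eqE /= (cell_uniq ui uj) eqxx.
- by move=> i _; exact: measurable_cell.
rewrite (eq_bigr (fun=> (4 ^- n)%:E)); last by move=> i _; exact: lebesgue_measure_cell.
rewrite sumEFin; congr EFin.
rewrite mulrACA -invfM -exprMn -[2 * 2]natrM /=.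
transitivity (4 ^- n * \sum_(0 <= m < 4 ^ n)
    (p (digits odd n m))%:R * (q (digits (fun m => odd m./2) n m))%:R : R).
  rewrite mulr_sumr big_mkcond big_mkord; apply: eq_bigr => i _.
  by case: (p _); case: (q _); rewrite /= ?mulr1 ?mul1r ?mulr0 ?mul0r.
rewrite mulrC (@sum_digits _ n (fun i j => (p i)%:R * (q j)%:R)).
congr (_ * _); rewrite mulr_suml; apply: eq_bigr => i _.
by rewrite mulr_sumr.
Qed.

Lemma natr_sum1 (N : nat) : N%:R = \sum_(0 <= i < N) 1 :> R.
Proof. by rewrite big_mkord sumr_const card_ord. Qed.

Lemma count_le_ub (N : nat) (x : R) : 0 <= x ->
  \sum_(0 <= i < N) (i%:R <= x)%R%:R <= x + 1.
Proof.
move=> x0; have [Nx|xN] := leP N%:R (x + 1).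
  apply: le_trans Nx; rewrite natr_sum1.
  by apply: ler_sum => i _; case: (i%:R <= x).
elim: N xN => [|N IH] xN; first by lra.
rewrite big_nat_recr //=; move: xN; rewrite -natr1 => xN.
rewrite [(_ <= x)]lt_geF /=; last by lra.
rewrite addr0; have [Nx|/IH//] := leP N%:R (x + 1).
apply: le_trans Nx; rewrite natr_sum1.
by apply: ler_sum => i _; case: (i%:R <= x).
Qed.

Lemma count_le_lb (N : nat) (x : R) : x <= N%:R ->
  x - 1 <= \sum_(0 <= i < N) (i.+1%:R <= x)%R%:R.
Proof.
elim: N => [|N IH] xN; first by rewrite big_geq //; lra.
have [xN'|Nx] := leP x N%:R.
  by apply: (le_trans (IH xN')); rewrite big_nat_recr //= lerDl.
apply: (@le_trans _ _ N%:R); first by move: xN; rewrite -natr1; lra.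
rewrite big_nat_recr //= -[leLHS]addr0 lerD //.
rewrite natr_sum1; apply: ler_sum_nat => i /andP[_ iN].
by rewrite (le_trans _ (ltW Nx)) // ler_nat.
Qed.

Definition dyadic b n u : R :=
  \sum_(m < 4 ^ n) (digits b n m)%:R / 2 ^+ n * \1_(cell n m) u.

Lemma dyadic_cell b n m u : (m < 4 ^ n)%N -> cell n m u ->
  dyadic b n u = (digits b n m)%:R / 2 ^+ n.
Proof.
move=> mn um; rewrite /dyadic (bigD1 (Ordinal mn)) //= indicE mem_set // mulr1.
rewrite big1 ?addr0 // => i im; rewrite indicE memNset ?mulr0 // => ui.
by move: im; rewrite -val_eqE /= (cell_uniq ui um) eqxx.
Qed.

Lemma dyadic_out b n u : ~~ (0 <= u < 1) -> dyadic b n u = 0.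
Proof.
move=> u01; rewrite /dyadic big1 // => i _; rewrite indicE memNset ?mulr0 // => ui.
by move/negP: u01; apply; exact: cell_itv ui.
Qed.

Lemma dyadicS b n u :
  dyadic b n u <= dyadic b n.+1 u <= dyadic b n u + 2 ^- n.+1.
Proof.
have n0 : 0 < 2 ^- n.+1 :> R by rewrite invr_gt0 exprn_gt0.
have [u01|u01] := boolP (0 <= u < 1); last first.
  by rewrite !dyadic_out // add0r lexx ltW.
have [m mn um] := cell_exists n.+1 u01.
have mn' : (m./2./2 < 4 ^ n)%N by move: mn; rewrite expnS; lia.
rewrite (dyadic_cell b mn um) (dyadic_cell b mn' (cell_half um)) /=.
have -> : 2 ^- n = 2 * 2 ^- n.+1 :> R.
  by rewrite exprS invfM mulrA divff ?mul1r // pnatr_eq0.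
set e := 2 ^- n.+1 in n0 *.
rewrite natrD -mul2n natrM.
set d := (digits b n m./2./2)%:R.
by case: (b m); apply/andP; split; rewrite /= ?addr0; nra.
Qed.

(** The number whose binary digits are the digits of [u] selected by [b]. The truncations
    [dyadic b n u] increase with [n] and are within 2^-n of it, so the supremum is their limit. *)
Definition digit_map b u : R := sup (range (fun n => dyadic b n u)).

Lemma dyadic_nondecreasing b u : nondecreasing_seq (fun n => dyadic b n u).
Proof. by apply/nondecreasing_seqP => n; have /andP[] := dyadicS b n u. Qed.

Lemma dyadic_nonincreasing b u : nonincreasing_seq (fun n => dyadic b n u + 2 ^- n).
Proof.
apply/nonincreasing_seqP => n; have /andP[_ h] := dyadicS b n u.
have -> : 2 ^- n = 2 * 2 ^- n.+1 :> R.
  by rewrite exprS invfM mulrA divff ?mul1r // pnatr_eq0.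
by set e := 2 ^- n.+1 in h *; lra.
Qed.

Lemma dyadic_cross b u m n : dyadic b m u <= dyadic b n u + 2 ^- n.
Proof.
have e0 k : 0 <= 2 ^- k :> R by rewrite invr_ge0 exprn_ge0.
have [mn|/ltnW nm] := leqP m n.
  by rewrite (le_trans (dyadic_nondecreasing b u mn)) // lerDl.
by rewrite (le_trans _ (dyadic_nonincreasing b u nm)) // lerDl.
Qed.

Lemma dyadic_le_digit_map b n u :
  dyadic b n u <= digit_map b u <= dyadic b n u + 2 ^- n.
Proof.
apply/andP; split.
  apply: ub_le_sup; last by exists n.
  by exists (dyadic b 0 u + 2 ^- 0) => _ [m _ <-]; exact: dyadic_cross.
apply: ge_sup; first by exists (dyadic b 0 u), 0%N.
by move=> _ [m _ <-]; exact: dyadic_cross.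
Qed.

Lemma measurable_digit_map b :
  @measurable_fun _ _ (measurableTypeR R) (measurableTypeR R) setT (digit_map b).
Proof.
apply: (@measurable_fun_cvg _ _ _ _ (fun n => dyadic b n)) => [n|u _].
  apply: measurable_sum => i; apply: measurable_funM => //.
  by apply: measurable_indic; exact: measurable_cell.
apply: nondecreasing_cvgn; first exact: dyadic_nondecreasing.
by exists (dyadic b 0 u + 2 ^- 0) => _ [m _ <-]; exact: dyadic_cross.
Qed.

Lemma digit_map_itv b u : 0 <= digit_map b u <= 1.
Proof.
have := dyadic_le_digit_map b 0 u.
have -> : dyadic b 0 u = 0.
  rewrite /dyadic big1 // => i _; rewrite (_ : digits b 0 i = 0%N) //.
  by rewrite !mul0r.
by rewrite expr0 invr1 add0r.
Qed.

End bit_interleaving.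

Section uniform_pair.
Context (R : realType).
Notation mu := (@lebesgue_measure R).
Local Open Scope ereal_scope.

Definition coord1 : R -> R := @digit_map R odd.
Definition coord2 : R -> R := @digit_map R (fun m => odd m./2).

Lemma measurable_coord1 :
  @measurable_fun _ _ (measurableTypeR R) (measurableTypeR R) setT coord1.
Proof. exact: measurable_digit_map. Qed.

Lemma measurable_coord2 :
  @measurable_fun _ _ (measurableTypeR R) (measurableTypeR R) setT coord2.
Proof. exact: measurable_digit_map. Qed.

Lemma measurable_coord1_preimage (A : set (measurableTypeR R)) :
  measurable A -> measurable (coord1 @^-1` A : set (measurableTypeR R)).
Proof. by move=> mA; rewrite -[X in measurable X]setTI; exact: measurable_coord1. Qed.

Lemma measurable_coord2_preimage (A : set (measurableTypeR R)) :
  measurable A -> measurable (coord2 @^-1` A : set (measurableTypeR R)).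
Proof. by move=> mA; rewrite -[X in measurable X]setTI; exact: measurable_coord2. Qed.

(** The rectangle is squeezed between unions of cells of level n, whose measures are explicit
    products; the error vanishes as n grows. *)
Lemma uniform_prob_coord_halfline01 (r s : R) : (0 <= r <= 1)%R -> (0 <= s <= 1)%R ->
  U01 R (coord1 @^-1` `]-oo, r] `&` coord2 @^-1` `]-oo, s]) = (r * s)%:E.
Proof.
move=> /andP[r0 r1] /andP[s0 s1].
set E := _ `&` _.
have mE : measurable (E : set (measurableTypeR R)).
  by apply: measurableI; [exact: measurable_coord1_preimage|exact: measurable_coord2_preimage].
have fE : U01 R E \is a fin_num by exact: fin_num_measure.
rewrite -(fineK fE); congr EFin; set x := fine _.
have xE : x%:E = mu (E `&` `[0%R, 1%R[) by rewrite /x fineK // uniform_probE.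
have mE' : measurable (E `&` `[0%R, 1%R[) by exact: measurableI.
have bnd n : (x <= (r + 2 ^- n) * (s + 2 ^- n) /\
    (2 ^- n <= r -> 2 ^- n <= s -> (r - 2 ^- n) * (s - 2 ^- n) <= x))%R.
  have n0 : (0 < 2 ^+ n :> R)%R by rewrite exprn_gt0.
  have le_count (p : nat -> bool) : (\sum_(0 <= i < 2 ^ n) (p i)%:R / 2 ^+ n : R)%R =
     ((\sum_(0 <= i < 2 ^ n) (p i)%:R) / 2 ^+ n)%R by rewrite mulr_suml.
  have S0 (p : nat -> bool) : (0 <= (\sum_(0 <= i < 2 ^ n) (p i)%:R) / 2 ^+ n :> R)%R.
    by rewrite divr_ge0 ?(ltW n0) // sumr_ge0.
  have msp (p q : pred nat) : measurable (\big[setU/set0]_(m < 4 ^ n | p (digits odd n m) &&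
      q (digits (fun m => odd m./2) n m)) @cell R n m : set (measurableTypeR R)).
    by apply: bigsetU_measurable => i _; exact: measurable_cell.
  split.
    (* Outer approximation: a cell can meet the event only if the left ends of both its digit
       intervals lie below the thresholds. *)
    pose p (t : R) (i : nat) := (i%:R <= 2 ^+ n * t)%R.
    rewrite -lee_fin xE.
    apply: (@le_trans _ _ (mu (\big[setU/set0]_(m < 4 ^ n |
        p r (digits odd n m) && p s (digits (fun m => odd m./2) n m)) @cell R n m))).
      apply: le_measure; [by rewrite inE; exact: mE'|by rewrite inE; exact: msp|].
      move=> u [[/= ur us]]; rewrite /= in_itv /= => u01.
      have [m mn um] := cell_exists n u01.
      rewrite -bigcup_seq_cond /=.
      exists (Ordinal mn) => //=; rewrite mem_index_enum /=.
      move: ur us; rewrite !in_itv /= => ur us; apply/andP; split.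
        have /andP[h _] := dyadic_le_digit_map odd n u.
        move: h; rewrite (dyadic_cell _ mn um) => h.
        by rewrite /p -ler_pdivrMl // mulrC (le_trans h).
      have /andP[h _] := dyadic_le_digit_map (fun m => odd m./2) n u.
      move: h; rewrite (dyadic_cell _ mn um) => h.
      by rewrite /p -ler_pdivrMl // mulrC (le_trans h).
    rewrite lebesgue_measure_cells lee_fin.
    have pb t : (0 <= t)%R -> ((\sum_(0 <= i < 2 ^ n) (p t i)%:R) / 2 ^+ n <= t + 2 ^- n)%R.
      move=> t0; rewrite ler_pdivrMr // mulrDl mulVf ?gt_eqF // [leRHS](_ : _ = 2 ^+ n * t + 1)%R.
        by apply: count_le_ub; rewrite mulr_ge0 // ltW.
      by rewrite mulrC.
    by apply: ler_pM => //; apply: pb.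
  move=> rn sn.
  (* Inner approximation: if the right ends lie below the thresholds, the whole cell is in the
     event. *)
  pose p (t : R) (i : nat) := (i.+1%:R <= 2 ^+ n * t)%R.
  rewrite -lee_fin xE.
  apply: (@le_trans _ _ (mu (\big[setU/set0]_(m < 4 ^ n |
      p r (digits odd n m) && p s (digits (fun m => odd m./2) n m)) @cell R n m))); last first.
    apply: le_measure; [by rewrite inE; exact: msp|by rewrite inE; exact: mE'|].
    move=> u; rewrite -bigcup_seq_cond /= => -[m /=]; rewrite mem_index_enum /= => /andP[pr ps] um.
    have u01 := cell_itv (ltn_ord m) um.
    split => //; rewrite /E /= !in_itv /=.
    have pd b t : p t (digits b n m) -> (@digit_map R b u <= t)%R.
      rewrite /p -ler_pdivrMl // mulrC -natr1 mulrDl mul1r => pt.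
      have /andP[_ h] := dyadic_le_digit_map b n u.
      by move: h; rewrite (dyadic_cell _ (ltn_ord m) um) => h; rewrite (le_trans h).
    by split; apply: pd.
  rewrite lebesgue_measure_cells lee_fin.
  have pb t : (t <= 1)%R -> (t - 2 ^- n <= (\sum_(0 <= i < 2 ^ n) (p t i)%:R) / 2 ^+ n)%R.
    move=> t1; rewrite ler_pdivlMr // mulrBl mulVf ?gt_eqF // [leLHS](_ : _ = 2 ^+ n * t - 1)%R.
      by apply: count_le_lb; rewrite natrX -[leRHS]mulr1 ler_pM2l.
    by rewrite mulrC.
  by apply: ler_pM; rewrite ?subr_ge0 //; apply: pb.
have e_small (e : R) : (0 < e)%R -> exists2 n, (2 ^- n < e)%R & (2 ^- n <= 1 :> R)%R.
  move=> e0; have [n nE] : exists n, (e^-1 < n%:R)%R.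
    by exists (Num.bound e^-1); rewrite archi_boundP // invr_ge0 ltW.
  exists n; last by rewrite invf_le1 ?exprn_gt0 // exprn_ege1 // ler1n.
  rewrite invf_plt ?posrE ?exprn_gt0 // (lt_le_trans nE) // -natrX ler_nat.
  exact/ltnW/ltn_expl.
have d0 n : (0 < 2 ^- n :> R)%R by rewrite invr_gt0 exprn_gt0.
apply/eqP; rewrite eq_le; apply/andP; split.
  apply/ler_addgt0Pr => e e0.
  (* With y = 2^-n and r, s, y at most 1, (r + y)(s + y) exceeds r s by at most 3 y. *)
  have [|n ne n1] := e_small (e / 3)%R; first by rewrite divr_gt0.
  have [h _] := bnd n; have := d0 n; set y := (2 ^- n)%R in h ne n1 * => y0.
  apply: (le_trans h); nra.
apply/ler_addgt0Pr => e e0.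
(* The inner bound requires 2^-n to be below [r] and [s], so zero thresholds are treated apart.
   Otherwise (r - y)(s - y) is at least r s - 2 y, whence [e / 2] below. *)
have [r00|r00] := eqVneq r 0%R.
  by rewrite r00 mul0r addr_ge0 ?(ltW e0) // fine_ge0.
have [s00|s00] := eqVneq s 0%R.
  by rewrite s00 mulr0 addr_ge0 ?(ltW e0) // fine_ge0.
have r0' : (0 < r)%R by rewrite lt_neqAle eq_sym r00.
have s0' : (0 < s)%R by rewrite lt_neqAle eq_sym s00.
have [|n ne n1] := e_small (Num.min (Num.min r s) (e / 2))%R.
  by rewrite !lt_min r0' s0' divr_gt0.
move: ne; rewrite !lt_min => /andP[/andP[nr ns] ne].
have [_ /(_ (ltW nr) (ltW ns)) h] := bnd n.
have := d0 n; set y := (2 ^- n)%R in h ne nr ns n1 * => y0.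
rewrite -lerBlDr (le_trans _ h) //; nra.
Qed.

Lemma uniform_prob_coord_halfline (r s : R) :
  U01 R (coord1 @^-1` `]-oo, r] `&` coord2 @^-1` `]-oo, s]) =
  U01 R `]-oo, r]%classic * U01 R `]-oo, s]%classic.
Proof.
(* For a nonnegative threshold, clamping to [0, 1] changes neither side, the variables having values
   in [0, 1]; a negative threshold makes both sides vanish. *)
pose c (t : R) := Num.max 0%R (Num.min t 1%R).
have c01 t : (0 <= c t <= 1)%R by rewrite /c le_max lexx /= ge_max ler01 ge_min lexx orbT.
have [r0|r0] := ltP r 0%R.
  rewrite (_ : _ `&` _ = set0) ?measure0; last first.
    apply/seteqP; split => // u [/=]; rewrite in_itv /= => ur.
    by have /andP[] := @digit_map_itv R odd u; rewrite leNgt (le_lt_trans ur r0).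
  rewrite (_ : U01 R `]-oo, r]%classic = 0) ?mul0e // uniform_probE // (_ : _ `&` _ = set0) ?measure0 //.
  by apply/seteqP; split => // u /=; rewrite !in_itv /= => -[ur /andP[u0 _]]; lra.
have [s0|s0] := ltP s 0%R.
  rewrite (_ : _ `&` _ = set0) ?measure0; last first.
    apply/seteqP; split => // u [/=]; rewrite !in_itv /= => _ us.
    by have /andP[] := @digit_map_itv R (fun m => odd m./2) u; rewrite leNgt (le_lt_trans us s0).
  rewrite (_ : U01 R `]-oo, s]%classic = 0) ?mule0 // uniform_probE // (_ : _ `&` _ = set0) ?measure0 //.
  by apply/seteqP; split => // u /=; rewrite !in_itv /= => -[ur /andP[u0 _]]; lra.
have cE t : (0 <= t)%R -> U01 R `]-oo, t]%classic = U01 R `]-oo, (c t)]%classic.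
  move=> t0; rewrite !uniform_probE //; congr (mu _); apply/seteqP; split => u /=;
    rewrite !in_itv /= /c => -[ut /andP[u0 u1]]; rewrite u0 u1; split => //; move: ut;
    rewrite le_max le_min ?(ltW u1) ?andbT.
    by move=> ->; rewrite orbT.
  by move=> /orP[u0'|//]; lra.
have dE b t : (0 <= t)%R -> @digit_map R b @^-1` `]-oo, t] = @digit_map R b @^-1` `]-oo, (c t)].
  move=> t0; apply/seteqP; split => u /=;
    rewrite !in_itv /= /c le_max le_min; have /andP[u0 u1] := @digit_map_itv R b u; rewrite u1 andbT.
    by move=> ->; rewrite orbT.
  by move=> /orP[u0'|//]; rewrite (le_trans u0').
rewrite (cE _ r0) (cE _ s0) /coord1 /coord2 (dE _ _ r0) (dE _ _ s0).
by rewrite uniform_prob_coord_halfline01 // !uniform_prob_itv // EFinM.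
Qed.

Lemma uniform_prob_coord (A B : set R) : measurable A -> measurable B ->
  U01 R (coord1 @^-1` A `&` coord2 @^-1` B) = U01 R A * U01 R B.
Proof.
pose ind (f g : R -> R) X Y := U01 R (f @^-1` X `&` g @^-1` Y) = U01 R X * U01 R Y.
(* One Dynkin extension in [X] for a fixed [Y]. It is used twice: for [coord1] against half-lines of
   [coord2], then for [coord2] against the resulting arbitrary set [A] of [coord1]. *)
have dynk (f g : R -> R) Y : measurable (g @^-1` Y : set (measurableTypeR R)) ->
    (forall X : set (measurableTypeR R), measurable X -> measurable (f @^-1` X : set (measurableTypeR R))) ->
    U01 R (g @^-1` Y) = U01 R Y ->
    (forall r, ind f g `]-oo, r]%classic Y) -> forall X, measurable X -> ind f g X Y.
  move=> mY mf gY fr; apply: halfline_induction => //.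
  - by rewrite /ind preimage_setT setTI probability_setT mul1e.
  - move=> D mD; rewrite /ind => DB.
    have -> : f @^-1` (~` D) `&` g @^-1` Y = g @^-1` Y `\` (f @^-1` D `&` g @^-1` Y).
      apply/seteqP; split => u /=; first by move=> [nD uB]; split => // -[].
      by move=> [uB nD]; split => // uD; apply: nD.
    have mD' := mf _ mD.
    rewrite measureD //; last 2 first.
    + exact: measurableI.
    + by rewrite -ge0_fin_numE // fin_num_measure.
    rewrite setIA (setIC (g @^-1` Y)) -setIA setIid [X in _ - X]DB [X in X - _]gY.
    have fD : U01 R D \is a fin_num by exact: fin_num_measure.
    have fY : U01 R Y \is a fin_num.
      by rewrite -gY; exact: fin_num_measure.
    by rewrite probability_setC // (@muleBl _ (U01 R Y) 1 (U01 R D)) ?mul1e // fin_num_adde_defr.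

  - move=> F mF tF FB; rewrite /ind preimage_bigcup setI_bigcupl.
    rewrite measure_bigcup //; last 2 first.
    + by move=> n _; apply: measurableI; [apply: mf; exact: mF|exact: mY].
    + apply: trivIset_setIr => i j _ _ [u [fi fj]]; apply: tF => //.
      by exists (f u).
    have fY : U01 R Y \is a fin_num.
      by rewrite -gY; exact: fin_num_measure.
    rewrite [X in _ = X * _](measure_bigcup (U01 R)) //; last by move=> n _; exact: mF.
    rewrite muleC -(fineK fY) -nneseriesZl //.
    by apply: eq_eseriesr => n _; rewrite fineK // muleC; exact: FB.
move=> mA mB.
have le1 b : @digit_map R b @^-1` `]-oo, 1%R] = setT.
  by apply/seteqP; split => // u _; rewrite /= in_itv /=; have /andP[] := @digit_map_itv R b u.
have U1 : U01 R `]-oo, 1%R]%classic = 1 by rewrite uniform_prob_itv // ler01 lexx.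
have half2 s : U01 R (coord2 @^-1` `]-oo, s]) = U01 R `]-oo, s]%classic.
  by have := uniform_prob_coord_halfline 1 s; rewrite U1 mul1e /coord1 le1 setTI.
have step1 s D : measurable D -> ind coord1 coord2 D `]-oo, s]%classic.
  apply: dynk => //.
  - exact: measurable_coord2_preimage.
  - exact: measurable_coord1_preimage.
  - by move=> r; exact: uniform_prob_coord_halfline.
have : ind coord2 coord1 B A.
  apply: dynk => //.
  - exact: measurable_coord1_preimage.
  - exact: measurable_coord2_preimage.
  - by have := step1 1%R _ mA; rewrite /ind U1 mule1 /coord2 le1 setIT.
  - by move=> s; rewrite /ind setIC muleC; exact: step1.
by rewrite /ind setIC muleC.
Qed.

Lemma integral_uniform_pair (G : R * R -> \bar R) :
  @measurable_fun _ _ (measurableTypeR R * measurableTypeR R)%type _ setT G ->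
  (forall z, 0 <= G z) ->
  \int[U01 R]_u G (coord1 u, coord2 u) = \int[U01 R]_s \int[U01 R]_t G (s, t).
Proof.
move=> mG G0.
have mc : @measurable_fun _ _ (measurableTypeR R)
    (measurableTypeR R * measurableTypeR R)%type setT (fun u => (coord1 u, coord2 u)).
  by apply: measurable_fun_pair; [exact: measurable_coord1|exact: measurable_coord2].
rewrite -[LHS]/(\int[U01 R]_(u in (fun u => (coord1 u, coord2 u)) @^-1` setT)
  (G \o (fun u => (coord1 u, coord2 u))) u).
rewrite -(ge0_integral_pushforward mc) //.
rewrite -[RHS](@fubini_tonelli1 _ _ _ _ _ (U01 R) (U01 R) _ mG G0).
apply: (@eq_measure_integral _ _ _ _ (U01 R \x U01 R) (image_probability (U01 R) mc)).
move=> D mD _; apply/esym.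
apply: (@product_measure_unique _ _ (measurableTypeR R) (measurableTypeR R) _ _ _
  (image_probability (U01 R) mc)) => //.
by move=> A B mA mB; exact: uniform_prob_coord.
Qed.

End uniform_pair.

(** * Sampling a density on the circle *)

Section quantile.
Context (R : realType) (m : probability (measurableTypeR R) R).
Local Open Scope ereal_scope.

(** The law [m] is seen as the law of the identity, so that [F] is a [cdf] and has the known limits
    and right continuity. *)
Let idTR : measurableTypeR R -> R := idfun.

#[local] HB.instance Definition _ :=
  @isMeasurableFun.Build _ _ _ _ idTR (@measurable_id _ _ setT).

Let F (t : R) : R := fine (m `]-oo, t]%classic).

Let FE : F = fine \o cdf (idTR : {RV m >-> R}).
Proof. by []. Qed.

Let EFinF t : (F t)%:E = m `]-oo, t]%classic.
Proof. by rewrite /F fineK // fin_num_measure. Qed.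

Let F_nd t u : (t <= u)%R -> (F t <= F u)%R.
Proof.
move=> tu; rewrite -lee_fin !EFinF.
exact: (cdf_nondecreasing (idTR : {RV m >-> R}) tu).
Qed.

(** The generalized inverse of the distribution function of [m]. The value 0 outside (0, 1) is a
    default on a set that is null for the uniform law. *)
Definition quantile (v : R) : R :=
  if (0 < v < 1)%R then inf [set t | (v <= fine (m `]-oo, t]%classic))%R] else 0%R.

(** The Galois connection between [quantile] and [F]. The limits of [F] at the two infinities make
    [S] nonempty and bounded below; right continuity puts the infimum of [S] in [S]. *)
Lemma quantile_le v t : (0 < v < 1)%R -> ((quantile v <= t) = (v <= F t))%R.
Proof.
move=> v01; rewrite /quantile v01; move: v01 => /andP[v0 v1].
set S := [set t | _].
have S0 : S !=set0.
  have Fy : F x @[x --> +oo%R] --> (1 : R)%R.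
    by rewrite FE; apply: fine_cvg; exact: cvg_cdfy1.
  have [w [_ Fw]] := cvgr_gt _ Fy _ v1.
  by exists (w + 1)%R; apply/ltW/Fw; rewrite ltrDl.
have lS : has_lbound S.
  have Fy : F x @[x --> -oo%R] --> (0 : R)%R.
    by rewrite FE; apply: fine_cvg; exact: cvg_cdfNy0.
  have [w [_ Fw]] := cvgr_lt _ Fy _ v0.
  exists w => x /= vx; rewrite leNgt; apply/negP => /Fw.
  by rewrite ltNge vx.
apply/idP/idP => [|vF]; last by apply: ge_inf.
move=> qt; apply: le_trans (F_nd qt); rewrite leNgt; apply/negP => Fv.
have Fr : F x @[x --> (inf S)^'+] --> F (inf S).
  by rewrite FE; apply: fine_cvg; rewrite fineK ?fin_num_measure //; exact: cdf_right_continuous.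
have [e /= e0 eF] := cvgr_lt _ Fr _ Fv.
have [|x Sx xe] := @inf_adherent _ S (e / 2) _ (conj S0 lS); first by rewrite divr_gt0.
have ix : (inf S <= x)%R by exact: ge_inf.
have [ixE|ix'] := eqVneq (inf S) x.
  by move: Fv; rewrite ixE ltNge Sx.
have : (F x < v)%R.
  apply: eF; last by rewrite lt_neqAle ix'.
  by rewrite /ball /= ltr_norml; apply/andP; split; lra.
by rewrite ltNge Sx.
Qed.

Lemma measurable_quantile :
  @measurable_fun _ _ (measurableTypeR R) (measurableTypeR R) setT quantile.
Proof.
apply: (measurability _ (measurable_halflineE R)) => _ [_ [t ->] <-]; rewrite setTI.
rewrite (_ : _ @^-1` _ = (`]0%R, 1%R[ `&` `]-oo, F t]) `|`
    (~` `]0%R, 1%R[ `&` [set _ | (0 <= t)%R])).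
  apply: measurableU; apply: measurableI => //; first exact: measurableC.
  have [t0|t0] := boolP (0 <= t)%R.
    by rewrite (_ : [set _ | _] = setT) //; apply/seteqP; split.
  by rewrite (_ : [set _ | _] = set0) //; apply/seteqP; split => // x /negP.
apply/seteqP; split => v /=; rewrite !in_itv /=.
  have [v01|v01] := boolP (0 < v < 1)%R; first by rewrite quantile_le // => vt; left.
  by rewrite /quantile (negbTE v01) => t0; right.
move=> [[v01]|[/negP v01 t0]]; first by rewrite quantile_le.
by rewrite /quantile (negbTE v01).
Qed.

Lemma uniform_prob_quantile (A : set R) : measurable A ->
  U01 R (quantile @^-1` A) = m A.
Proof.
have mq := measurable_quantile.
move: A; apply: (@halfline_induction R (fun A => U01 R (quantile @^-1` A) = m A)) => //.
- by rewrite preimage_setT !probability_setT.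
- move=> t; rewrite -EFinF -uniform_prob_itv; last first.
    by rewrite -!lee_fin EFinF measure_ge0 probability_le1.
  rewrite !uniform_prob_oo //; last by rewrite -[X in measurable X]setTI; exact: mq.
  congr (lebesgue_measure _); apply/seteqP; split => v /=; rewrite !in_itv /= => -[h v01];
    by split => //; move: h; rewrite quantile_le.
- move=> A mA mAq; rewrite preimage_setC !probability_setC //; last first.
    by rewrite -[X in measurable X]setTI; exact: mq.
  by rewrite [X in 1 - X]mAq.
- move=> A mA tA mAq; rewrite preimage_bigcup !measure_bigcup //.
  + by apply: eq_eseriesr => n _; exact: mAq.
  + by move=> n _; exact: mA.
  + by move=> n _; have := mq measurableT _ (mA n); rewrite setTI.
  + by move=> i j _ _ [u [fi fj]]; apply: tA => //; exists (quantile u).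
Qed.

End quantile.

Section density.
Context d (T : measurableType d) (R : realType) (mu : {measure set T -> \bar R}).
Context (h : T -> R) (mh : measurable_fun setT h) (h0 : forall x, 0 <= h x).
Local Open Scope ereal_scope.

(** The two hypotheses are arguments of the set function so that the measure structure declared
    below can be attached to the term itself. *)
Definition density of measurable_fun setT h & (forall x, 0 <= h x)%R :=
  fun A => \int[mu]_(x in A) (h x)%:E.

Local Notation dens := (density mh h0).

Let dens0 : dens set0 = 0.
Proof. by rewrite /density integral_set0. Qed.

Let dens_ge0 A : 0 <= dens A.
Proof. by apply: integral_ge0 => x _; rewrite lee_fin. Qed.

Let dens_sigma_additive : semi_sigma_additive dens.
Proof.
move=> F mF tF mUF; rewrite /density; apply: cvg_toP.
  apply: ereal_nondecreasing_is_cvgn => m n mn.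
  apply: lee_sum_nneg_natr => // k _ _.
  by apply: integral_ge0 => x _; rewrite lee_fin.
rewrite ge0_integral_bigcup//=.
- by apply/measurable_funTS/measurable_EFinP.
- by move=> x _; rewrite lee_fin.
Qed.

HB.instance Definition _ := isMeasure.Build _ _ _ dens
  dens0 dens_ge0 dens_sigma_additive.

Import HBNNSimple.

Let integral_density_nnsfun (f : {nnsfun T >-> R}) :
  \int[dens]_x (f x)%:E = \int[mu]_x ((f x)%:E * (h x)%:E).
Proof.
under [LHS]eq_integral do rewrite fimfunE -fsumEFin//.
rewrite [LHS]ge0_integral_fsum//; last 2 first.
  - by move=> r; exact/measurable_EFinP/measurableT_comp.
  - by move=> n x _; rewrite EFinM nnfun_muleindic_ge0.
under [RHS]eq_integral.
  move=> x xD; rewrite fimfunE -fsumEFin// ge0_mule_fsuml; last first.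
    by move=> r; rewrite EFinM nnfun_muleindic_ge0.
  over.
rewrite [RHS]ge0_integral_fsum//; last 2 first.
  - move=> r; apply: emeasurable_funM; last exact/measurable_EFinP.
    exact/measurable_EFinP/measurableT_comp.
  - move=> n x _; apply: mule_ge0; last by rewrite lee_fin.
    by rewrite EFinM nnfun_muleindic_ge0.
apply: eq_fsbigr => r _.
have mfr : measurable (f @^-1` [set r]) by exact: measurable_sfunP.
have [r0|r0] := leP 0%R r; last first.
  rewrite preimage_nnfun0 //.
  under eq_integral do rewrite indic0 mulr0.
  under [RHS]eq_integral do rewrite indic0 mulr0 mul0e.
  by rewrite !integral0.
under eq_integral do rewrite EFinM.
have mi : measurable_fun setT (fun x => (\1_(f @^-1` [set r]) x)%:E : \bar R).
  by apply/measurable_EFinP; exact: measurable_indic.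
rewrite (ge0_integralZl _ measurableT mi) //.
under [RHS]eq_integral do rewrite EFinM -muleA.
rewrite ge0_integralZl//; last 2 first.
- by apply: emeasurable_funM => //; exact/measurable_EFinP.
- by move=> x _; rewrite mule_ge0 // lee_fin.
rewrite integral_indic // setIT; congr (_ * _).
rewrite -[LHS]/(\int[mu]_(x in f @^-1` [set r]) (h x)%:E) integral_mkcond.
apply: eq_integral => x _; rewrite patchE indicE.
by case: ifPn => _; rewrite ?mul1e ?mul0e.
Qed.

Lemma integral_density (f : T -> \bar R) : measurable_fun setT f ->
  (forall x, 0 <= f x) -> \int[dens]_x f x = \int[mu]_x (f x * (h x)%:E).
Proof.
move=> mf f0; pose f_ := nnsfun_approx measurableT mf.
transitivity (lim (\int[dens]_x (f_ n x)%:E @[n --> \oo])).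
  rewrite -monotone_convergence//=.
  - apply: eq_integral => ? /[!inE] xD; apply/esym/cvg_lim => //=.
    exact: cvg_nnsfun_approx.
  - by move=> n; exact/measurable_EFinP/measurable_funTS.
  - by move=> n ? _; rewrite lee_fin.
  - by move=> ? _ ? ? mn; rewrite lee_fin; exact/lefP/nd_nnsfun_approx.
transitivity (lim (\int[mu]_x ((f_ n x)%:E * (h x)%:E) @[n --> \oo])); last first.
  rewrite -monotone_convergence//=.
  - apply: eq_integral => x _; apply/cvg_lim => //.
    apply: cvgeZr => //; exact: cvg_nnsfun_approx.
  - move=> n; apply: emeasurable_funM; last exact/measurable_EFinP.
    exact/measurable_EFinP/measurable_funTS.
  - by move=> n x _; rewrite mule_ge0 // lee_fin.
  - move=> x _ a b ab; rewrite lee_wpmul2r ?lee_fin //.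
    exact/lefP/nd_nnsfun_approx.
by apply: congr_lim; apply/funext => n; exact: integral_density_nnsfun.
Qed.

End density.

Section sampler.
Context (R : realType) (h : circle R -> R) (mh : measurable_fun setT h)
  (h0 : forall t, 0 <= h t).
Local Open Scope ereal_scope.

Definition dens_prob of \int[leb R]_t (h t)%:E = 1 := density (leb R) mh h0.

Hypothesis h1 : \int[leb R]_t (h t)%:E = 1.

HB.instance Definition _ := Measure.on (dens_prob h1).

Let dens_prob_setT : dens_prob h1 setT = 1%:E.
Proof. by rewrite /dens_prob /density h1. Qed.

HB.instance Definition _ := @Measure_isProbability.Build _ _ R
  (dens_prob h1) dens_prob_setT.

(** The law of density [h] is carried to [0, 1) by [crep], sampled there by its quantile function,
    and brought back to the circle by [circ]. *)
Lemma exists_sampler : exists Q : R -> circle R,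
  @measurable_fun _ _ (measurableTypeR R) _ setT Q /\
  forall g : circle R -> \bar R, measurable_fun setT g -> (forall t, 0 <= g t) ->
    \int[U01 R]_v g (Q v) = \int[leb R]_t (g t * (h t)%:E).
Proof.
pose P : probability (circle R) R := dens_prob h1.
pose m := image_probability P (@measurable_crep R).
have mq := measurable_quantile m.
have mQ : @measurable_fun _ _ (measurableTypeR R) _ setT (@circ R \o quantile m).
  exact: (measurableT_comp (@measurable_circ R)).
exists (@circ R \o quantile m); split => // g mg g0.
rewrite -[RHS](@integral_density _ _ _ (leb R) _ mh h0) //.
transitivity (\int[pushforward (U01 R) (@circ R \o quantile m)]_t g t).
  by apply/esym/(ge0_integral_pushforward mQ).
apply: (@eq_measure_integral _ _ _ _ P (image_probability (U01 R) mQ)) => A mA _.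
have mB : measurable (@circ R @^-1` A : set (measurableTypeR R)).
  by rewrite -[X in measurable X]setTI; exact: measurable_circ.
rewrite -[LHS]/(U01 R (quantile m @^-1` (@circ R @^-1` A))) uniform_prob_quantile //.
rewrite -[LHS]/(P (@crep R @^-1` (@circ R @^-1` A))); congr (P _).
by apply/seteqP; split => t /=; rewrite crepK.
Qed.

End sampler.

(** * Configurations with independent increments *)

(* The sites 1, -1, 2, -2, ... are added in this order to {0}; the n-th one is
   joined to [parent n] by the bond [edge n]. *)
Definition site (n : nat) : int := if odd n then - (n./2.+1)%:Z else (n./2.+1)%:Z.
Definition parent (n : nat) : int := if odd n then - (n./2)%:Z else (n./2)%:Z.
Definition edge (n : nat) : int := if odd n then - (n./2.+1)%:Z else (n./2)%:Z.

Lemma absz_site n : `|site n|%N = n./2.+1.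
Proof. by rewrite /site; case: ifP => _; rewrite ?abszN. Qed.

Lemma site_inj : injective site.
Proof. by move=> i j; rewrite /site; case: ifP => oi; case: ifP => oj; lia. Qed.

Lemma edge_inj : injective edge.
Proof. by move=> i j; rewrite /edge; case: ifP => oi; case: ifP => oj; lia. Qed.

Definition bond_at (R : realType) (k : int) (x : conf R) : circle R := x k - x (k + 1).

Section random_configuration.
Context (R : realType) (h : circle R -> R) (mh : measurable_fun setT h)
  (h0 : forall t, 0 <= h t).
Context (Q : R -> circle R) (mQ : @measurable_fun _ _ (measurableTypeR R) _ setT Q).
Local Open Scope ereal_scope.
Hypothesis lawQ : forall g : circle R -> \bar R, measurable_fun setT g ->
  (forall t, 0 <= g t) -> \int[U01 R]_v g (Q v) = \int[leb R]_t (g t * (h t)%:E).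

(** Odd steps extend to the left and even steps to the right; with these signs the new bond
    [bond_at (edge n)] equals [xi] in both cases. *)
Definition grow (n : nat) (x : conf R) (xi : circle R) : conf R :=
  dfwith x (site n) (if odd n then x (parent n) + xi else x (parent n) - xi)%R.

(* The variables [coord1 (residue n u)] are independent and uniform. *)
Fixpoint residue (n : nat) (u : R) : R :=
  if n is n'.+1 then @coord2 R (residue n' u) else @coord2 R u.

Definition conf0 : conf R := fun=> 0%R.

Fixpoint theta (n : nat) (u : R) : conf R :=
  if n is n'.+1 then grow n' (theta n' u) (Q (@coord1 R (residue n' u)))
  else dfwith conf0 0%R (circ (@coord1 R u)).

Lemma measurable_grow d (T : measurableType d) n (f : T -> conf R) (g : T -> circle R) :
  measurable_fun setT f -> measurable_fun setT g ->
  measurable_fun setT (fun u => grow n (f u) (g u)).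
Proof.
move=> mf mg; apply: measurable_dfwith => //.
have mp : measurable_fun setT (fun u => f u (parent n)).
  exact: (measurableT_comp (@measurable_proj_conf R (parent n))).
case: (odd n); last exact: measurable_fun_circleB.
rewrite (_ : (fun _ => _) = (fun u => f u (parent n) - (0 - g u))%R); last first.
  by apply/funext => u; rewrite sub0r opprK.
by apply: measurable_fun_circleB => //; exact: measurable_fun_circleB.
Qed.

Lemma measurable_residue n :
  @measurable_fun _ _ (measurableTypeR R) (measurableTypeR R) setT (residue n).
Proof.
elim: n => [|n IH] /=; first exact: measurable_coord2.
exact: (measurableT_comp (@measurable_coord2 R)).
Qed.

Lemma measurable_theta n :
  @measurable_fun _ _ (measurableTypeR R) _ setT (theta n).
Proof.
elim: n => [|n IH] /=.
  apply: measurable_dfwith => //; apply: (measurableT_comp (@measurable_circ R)).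
  exact: measurable_coord1.
apply: measurable_grow => //; apply: (measurableT_comp mQ).
apply: (measurableT_comp (@measurable_coord1 R)); exact: measurable_residue.
Qed.

Lemma integral_coord1 (g : R -> \bar R) :
  @measurable_fun _ _ (measurableTypeR R) _ setT g -> (forall u, 0 <= g u) ->
  \int[U01 R]_u g (@coord1 R u) = \int[U01 R]_u g u.
Proof.
move=> mg g0.
have mg1 : @measurable_fun _ _ (measurableTypeR R * measurableTypeR R)%type _ setT
    (g \o fst) by exact: (measurableT_comp mg).
rewrite (@integral_uniform_pair R (g \o fst)) //=.
apply: eq_integral => u _.
by rewrite (integral_cst (U01 R) measurableT) [X in _ * X]probability_setT mule1.
Qed.

(** At each step the residue is split by [coord1] and [coord2] into two independent uniform
    variables: one is spent on the new site, the other is kept. So the residue stays uniform and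
    independent of the sites built so far. *)
Lemma theta_residue n (G : conf R * R -> \bar R) :
  @measurable_fun _ _ (conf R * measurableTypeR R)%type _ setT G -> (forall z, 0 <= G z) ->
  \int[U01 R]_u G (theta n u, residue n u) =
  \int[U01 R]_u \int[U01 R]_v G (theta n u, v).
Proof.
elim: n G => [|n IH] G mG G0 /=.
  pose G' (z : R * R) := G (dfwith conf0 0%R (circ z.1) : conf R, z.2).
  have mG' : @measurable_fun _ _ (measurableTypeR R * measurableTypeR R)%type _ setT G'.
    apply: (measurableT_comp mG); apply: measurable_fun_pair => //.
    by apply: measurable_dfwith => //; exact: (measurableT_comp (@measurable_circ R)).
  transitivity (\int[U01 R]_s \int[U01 R]_t G' (s, t)).
    exact: (integral_uniform_pair mG' (fun z => G0 _)).
  apply/esym/(@integral_coord1 (fun s => \int[U01 R]_t G' (s, t))).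
    by apply: (@measurable_fun_fubini_tonelli_F _ _ _ _ _ (U01 R) G') => // z; exact: G0.
  by move=> s; apply: integral_ge0 => t _; exact: G0.
have m1 : @measurable_fun _ _ (conf R * measurableTypeR R)%type _ setT
    (fun z => grow n z.1 (Q (@coord1 R z.2))).
  apply: measurable_grow => //; apply: (measurableT_comp mQ).
  exact: (measurableT_comp (@measurable_coord1 R)).
pose G1 (z : conf R * R) := G (grow n z.1 (Q (@coord1 R z.2)), @coord2 R z.2).
have mG1 : @measurable_fun _ _ (conf R * measurableTypeR R)%type _ setT G1.
  apply: (measurableT_comp mG); apply: measurable_fun_pair => //.
  exact: (measurableT_comp (@measurable_coord2 R)).
transitivity (\int[U01 R]_u \int[U01 R]_v G1 (theta n u, v)).
  exact: (IH _ mG1 (fun z => G0 _)).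
(* The induction hypothesis is used twice: on [G1] for the left side, and on [G2], where the new
   residue is already integrated out, for the right side. *)
pose G2 (z : conf R * R) := \int[U01 R]_v G (grow n z.1 (Q (@coord1 R z.2)), v).
have mG2 : @measurable_fun _ _ (conf R * measurableTypeR R)%type _ setT G2.
  apply: (@measurable_fun_fubini_tonelli_F _ _ _ _ _ (U01 R)
    (fun z => G (grow n z.1.1 (Q (@coord1 R z.1.2)), z.2))) => //.
  apply: (measurableT_comp mG); apply: measurable_fun_pair => //.
  exact: (measurableT_comp m1).
transitivity (\int[U01 R]_u \int[U01 R]_v G2 (theta n u, v)); last first.
  by apply/esym/(IH _ mG2) => z; apply: integral_ge0 => t _; exact: G0.
apply: eq_integral => u _.
pose G3 (z : R * R) := G (grow n (theta n u) (Q z.1), z.2).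
have mG3 : @measurable_fun _ _ (measurableTypeR R * measurableTypeR R)%type _ setT G3.
  apply: (measurableT_comp mG); apply: measurable_fun_pair => //.
  by apply: measurable_grow => //; exact: (measurableT_comp mQ).
transitivity (\int[U01 R]_s \int[U01 R]_t G3 (s, t)).
  exact: (integral_uniform_pair mG3 (fun z => G0 _)).
apply/esym/(@integral_coord1 (fun s => \int[U01 R]_t G3 (s, t))).
  by apply: (@measurable_fun_fubini_tonelli_F _ _ _ _ _ (U01 R) G3) => // z; exact: G0.
by move=> s; apply: integral_ge0 => t _; exact: G0.
Qed.

Lemma measurable_bond_h k : measurable_fun setT (fun x : conf R => h (bond_at k x)).
Proof. by apply: (measurableT_comp mh); exact: measurable_bond_at. Qed.

(** With [x] fixed, the value at the new site is a translate or a reflection of [Q v]. Both preserve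
    Lebesgue measure on the circle, so the increment can be replaced by the coordinate itself as
    integration variable. *)
Lemma integral_grow n x (F : conf R -> \bar R) :
  measurable_fun setT F -> (forall x, 0 <= F x) ->
  \int[U01 R]_v F (grow n x (Q v)) =
  lebI [:: site n] (fun y => F y * (h (bond_at (edge n) y))%:E) x.
Proof.
move=> mF F0 /=.
rewrite (lawQ (g := fun xi => F (grow n x xi))) //; last first.
  by apply: (measurableT_comp mF); exact: measurable_grow.
pose f t := F (dfwith x (site n) t) * (h (bond_at (edge n) (dfwith x (site n) t)))%:E.
have mf : measurable_fun setT f.
  apply: emeasurable_funM; first exact: measurable_dfwith_l.
  apply/measurable_EFinP/(measurableT_comp (measurable_bond_h _)).
  exact: measurable_dfwith.
have f0 t : 0 <= f t by rewrite /f mule_ge0 // lee_fin.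
rewrite -[RHS]/(\int[leb R]_t f t).
have [on|on] := boolP (odd n).
  rewrite -[RHS](integral_leb_translation (x (parent n)) mf f0).
  apply: eq_integral => t _; rewrite /f /grow on; congr (_ * (h _)%:E).
  have e : (edge n + 1)%R = parent n by rewrite /edge /parent on; lia.
  have es : edge n = site n by rewrite /edge /site on.
  rewrite /bond_at e es dfwithin dfwithout; last first.
    by rewrite /site /parent on; lia.
  by rewrite addrAC subrr add0r.
rewrite -[RHS](integral_leb_reflection (x (parent n)) mf f0).
apply: eq_integral => t _; rewrite /f /grow (negbTE on); congr (_ * (h _)%:E).
have e : (edge n + 1)%R = site n by rewrite /edge /site (negbTE on); lia.
have es : edge n = parent n by rewrite /edge /parent (negbTE on).
rewrite /bond_at e es dfwithin dfwithout; last first.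
  by rewrite /site /parent (negbTE on); lia.
by rewrite opprB addrC subrK.
Qed.

Definition weight n (x : conf R) : R := (\prod_(i < n) h (bond_at (edge i) x))%R.

Lemma measurable_weight n : measurable_fun setT (weight n).
Proof.
rewrite /weight; elim: n => [|n IH].
  by rewrite (_ : (fun _ => _) = cst 1%R) //; apply/funext => x; rewrite big_ord0.
rewrite (_ : (fun _ => _) = (fun x => (\prod_(i < n) h (bond_at (edge i) x)) * h (bond_at (edge n) x))%R).
  by apply: measurable_funM => //; exact: measurable_bond_h.
by apply/funext => x; rewrite big_ord_recr.
Qed.

Lemma weight_ge0 n x : (0 <= weight n x)%R.
Proof. by apply: prodr_ge0 => i _; exact: h0. Qed.

Definition sites n : seq int := 0%R :: map site (iota 0 n).

Lemma sitesS n : sites n.+1 = sites n ++ [:: site n].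
Proof. by rewrite /sites -addn1 iotaD add0n map_cat. Qed.

Lemma weight_indep n : indep_of [:: site n] (weight n).
Proof.
move=> x k t; rewrite mem_seq1 => /eqP ->; apply: eq_bigr => i _.
rewrite /bond_at !dfwithout //; have := ltn_ord i; move: (val i) => j jn.
  by rewrite /site /edge; case: ifP => on; case: ifP => oj; lia.
by rewrite /site /edge; case: ifP => on; case: ifP => oj; lia.
Qed.

(** Passing from the value at 0 and the increments to the coordinates is a triangular change of
    variables with measure-preserving steps, so the density is the product of [h] over the bonds.
    The factors already present do not see the new site and leave the inner integral. *)
Lemma law_theta n (F : conf R -> \bar R) :
  measurable_fun setT F -> (forall x, 0 <= F x) ->
  \int[U01 R]_u F (theta n u) =
  lebI (sites n) (fun x => (weight n x)%:E * F x) conf0.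
Proof.
elim: n F => [|n IH] F mF F0.
  have mg : measurable_fun setT (fun t => F (dfwith conf0 0%R t)) by exact: measurable_dfwith_l.
  rewrite [LHS](@integral_coord1 (fun u => F (dfwith conf0 0%R (circ u)))) //; last first.
    exact: (measurableT_comp mg (@measurable_circ R)).
  rewrite /=; under [RHS]eq_integral do rewrite /weight big_ord0 mul1e.
  by apply/esym/(integral_leb mg) => t; exact: F0.
have mF1 : @measurable_fun _ _ (conf R * measurableTypeR R)%type _ setT
    (fun z => F (grow n z.1 (Q (@coord1 R z.2)))).
  apply: (measurableT_comp mF); apply: measurable_grow => //; apply: (measurableT_comp mQ).
  exact: (measurableT_comp (@measurable_coord1 R)).
transitivity (\int[U01 R]_u \int[U01 R]_v F (grow n (theta n u) (Q (@coord1 R v)))).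
  by apply: (@theta_residue n (fun z => F (grow n z.1 (Q (@coord1 R z.2)))) mF1) => z; exact: F0.
pose F' x := lebI [:: site n] (fun y => F y * (h (bond_at (edge n) y))%:E) x.
have mFh : measurable_fun setT (fun y => F y * (h (bond_at (edge n) y))%:E).
  by apply: emeasurable_funM => //; apply/measurable_EFinP; exact: measurable_bond_h.
have Fh0 y : 0 <= F y * (h (bond_at (edge n) y))%:E by rewrite mule_ge0 // lee_fin.
transitivity (\int[U01 R]_u F' (theta n u)).
  apply: eq_integral => u _; rewrite /F' -integral_grow //.
  rewrite (@integral_coord1 (fun s => F (grow n (theta n u) (Q s)))) //.
  by apply: (measurableT_comp mF); apply: measurable_grow.
rewrite IH; last 2 first.
- exact: measurable_lebI.
- exact: lebI_ge0.
rewrite sitesS lebI_cat; congr (lebI _ _ _); apply/funext => x.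
rewrite /F' -(@lebI_Zl R [:: site n] (fun y => (weight n y)%:E) _ mFh Fh0).
- congr (lebI _ _ _); apply/funext => y.
  by rewrite /weight big_ord_recr /= EFinM -muleA (muleC (F y)).
- by move=> y; rewrite lee_fin weight_ge0.
- by move=> y k t ks; rewrite weight_indep.
Qed.

(** Site [k] is reached within the first 2|k| steps and never modified afterwards, so this diagonal
    reading is the limit of [theta n u] in every coordinate. *)
Definition Theta (u : R) : conf R := fun k => theta `|k|.*2 u k.

Lemma theta_Theta n u k : (`|k|.*2 <= n)%N -> theta n u k = Theta u k.
Proof.
rewrite /Theta; elim: n => [|n IH] kn.
  by rewrite (_ : `|k|.*2 = 0)%N //; lia.
move: kn; rewrite leq_eqVlt => /orP[/eqP -> //|kn].
rewrite /= /grow dfwithout ?IH //.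
by apply/eqP => sk; have := absz_site n; rewrite sk; lia.
Qed.

Lemma measurable_Theta : @measurable_fun _ _ (measurableTypeR R) _ setT Theta.
Proof.
apply: measurable_fun_conf => k.
exact: (measurableT_comp (@measurable_proj_conf R k) (measurable_theta _)).
Qed.

Lemma Theta0 u : Theta u 0%R = circ (@coord1 R u).
Proof. by rewrite /Theta /= dfwithin. Qed.

Lemma Theta_bond u (n : nat) :
  bond_at (edge n) (Theta u) = Q (@coord1 R (residue n u)).
Proof.
have bondE : bond_at (edge n) (Theta u) = bond_at (edge n) (theta n.+1 u).
  (* For even [n] the endpoint [edge n + 1] is covered by [theta_Theta] only from n + 2 on, while
     the bond is created at n + 1; the additional step touches neither endpoint. *)
  have t2 k : site n.+1 != k -> theta n.+2 u k = theta n.+1 u k.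
    by move=> sk; rewrite [LHS]dfwithout.
  have b1 : site n.+1 != edge n by rewrite /site /edge; case: ifP => on; case: ifP => on'; lia.
  have b2 : site n.+1 != (edge n + 1)%R.
    by rewrite /site /edge; case: ifP => on; case: ifP => on'; lia.
  have c1 : (`|edge n|.*2 <= n.+2)%N by rewrite /edge; case: ifP => on; lia.
  have c2 : (`|(edge n + 1)%R|.*2 <= n.+2)%N by rewrite /edge; case: ifP => on; lia.
  by rewrite /bond_at -(t2 _ b1) -(t2 _ b2) (theta_Theta _ c1) (theta_Theta _ c2).
rewrite bondE /= /grow /bond_at.
have [on|on] := boolP (odd n).
  have e : (edge n + 1)%R = parent n by rewrite /edge /parent on; lia.
  have es : edge n = site n by rewrite /edge /site on.
  rewrite e es dfwithin dfwithout; last by rewrite /site /parent on; lia.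
  by rewrite addrAC subrr add0r.
have e : (edge n + 1)%R = site n by rewrite /edge /site (negbTE on); lia.
have es : edge n = parent n by rewrite /edge /parent (negbTE on).
rewrite e es dfwithin dfwithout; last by rewrite /site /parent (negbTE on); lia.
by rewrite opprB addrC subrK.
Qed.

End random_configuration.

Lemma fset_edge_inj (k j : int) : [fset k; (k + 1)%R]%fset = [fset j; (j + 1)%R]%fset -> k = j.
Proof.
move=> /fsetP kj; have := kj k; have := kj j.
rewrite !inE !eqxx /= => /orP [/eqP -> //|/eqP jk] /esym /orP[/eqP -> //|/eqP].
by lia.
Qed.

Definition touches (L : {fset int}) (k : int) := (k \in L) || (k + 1 \in L).

Lemma nearest_neighborE (R : realType) (U : circle R -> R) (k : int) (x : conf R) :
  nearest_neighbor U [fset k; (k + 1)%R]%fset x = - U (bond_at k x).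
Proof.
rewrite /nearest_neighbor (_ : [set _ | _] = [set k]) ?fsbig_set1 //.
by apply/seteqP; split => j /=; [move/fset_edge_inj|move=> ->].
Qed.

(** The list [e] is left free: [edges N] serves for a set well inside the window, and a list with
    the two boundary bonds singled out serves for the full window. *)
Lemma hamiltonianE (R : realType) (U : circle R -> R) (L : {fset int})
    (e : seq int) (x : conf R) :
  uniq e -> (forall k, touches L k -> k \in e) ->
  hamiltonian (nearest_neighbor U) L x = \sum_(k <- e | touches L k) - U (bond_at k x).
Proof.
move=> ue Le.
have dis k : touches L k -> ~~ [disjoint [fset k; (k + 1)%R] & L]%fset.
  move=> kL; apply/negP => /fdisjointP dis; move: kL; rewrite /touches => /orP[] kL.
    by have := dis k; rewrite !inE eqxx /= kL => /(_ isT).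
  by have := dis (k + 1)%R; rewrite !inE eqxx orbT kL => /(_ isT).
rewrite /hamiltonian
  (@fsbigE _ _ _ _ _ [seq [fset k; (k + 1)%R]%fset | k <- e & touches L k]).
- rewrite big_map big_filter_cond; apply: eq_big => [k|k _]; last exact: nearest_neighborE.
  by rewrite andb_idr // => tk; apply/mem_set; exact: dis.
- by rewrite map_inj_in_uniq ?filter_uniq // => k j _ _ /fset_edge_inj.
- by move=> D /= /mapP[k]; rewrite mem_filter => /andP[kL _] ->; exact: dis.
- move=> D /= DL De; apply: fsbig1 => k /= Dk; exfalso.
  move: De; rewrite Dk => /negP; apply; apply/mapP; exists k => //.
  have tk : touches L k.
    rewrite /touches; apply: contraT; rewrite negb_or => /andP[kL k1L].
    exfalso; move/negP: DL; apply; rewrite Dk; apply/fdisjointP => j.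
    by rewrite !inE => /orP[/eqP ->|/eqP ->].
  by rewrite mem_filter tk Le.
Qed.

Definition edges (N : nat) : seq int := map edge (iota 0 N.*2).

Lemma uniq_edges N : uniq (edges N).
Proof. by rewrite map_inj_uniq ?iota_uniq //; exact: edge_inj. Qed.

Lemma mem_edges N k : (k \in edges N) = (- N%:Z <= k < N%:Z).
Proof.
apply/mapP/idP => [[n]|].
  by rewrite mem_iota /edge add0n => /= nN ->; case: ifP => on; lia.
move=> kN; case: k kN => k kN.
  exists k.*2; first by rewrite mem_iota; lia.
  by rewrite /edge odd_double doubleK.
exists k.*2.+1; first by rewrite mem_iota; lia.
by rewrite /edge /= odd_double /= uphalf_double NegzE.
Qed.

Lemma uniq_sites n : uniq (sites n).
Proof.
rewrite /sites /= map_inj_uniq ?iota_uniq ?andbT; last exact: site_inj.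
apply/mapP => -[m _]; rewrite /site; case: ifP; lia.
Qed.

Lemma mem_sites N k : (k \in sites N.*2) = (`|k| <= N)%N.
Proof.
rewrite /sites in_cons; have [->//|k0] /= := eqVneq k 0.
apply/mapP/idP => [[n]|kN].
  by rewrite mem_iota /site add0n => /= nN ->; case: ifP => on; lia.
case: k k0 kN => k k0 kN.
  have k0' : (0 < k)%N by rewrite lt0n; move: k0; case: k {kN}.
  exists k.-1.*2; first by rewrite mem_iota; lia.
  by rewrite /site odd_double doubleK prednK.
exists k.*2.+1; first by rewrite mem_iota; lia.
by rewrite /site /= odd_double /= uphalf_double NegzE.
Qed.

Lemma fset_bounded (L : {fset int}) : exists N : nat, forall k, k \in L -> (`|k| < N)%N.
Proof.
exists (\max_(k <- L) `|k|%N).+1 => k kL; rewrite ltnS.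
by apply: (@leq_bigmax_seq _ (enum_fset L) xpredT (fun k => `|k|%N)).
Qed.

Lemma touches_edges (L : {fset int}) (N : nat) : (forall k, k \in L -> (`|k| < N)%N) ->
  forall k, touches L k -> k \in edges N.
Proof. by move=> LN k; rewrite mem_edges => /orP[/LN|/LN]; lia. Qed.

Lemma lebI_nneseries (R : realType) (s : seq int) (F : nat -> conf R -> \bar R) x :
  (forall n, measurable_fun setT (F n)) -> (forall n y, 0 <= F n y)%E ->
  (lebI s (fun y => \sum_(n <oo) F n y) x = \sum_(n <oo) lebI s (F n) x)%E.
Proof.
move=> mF F0; elim: s x => //= k s IH x.
rewrite -integral_nneseries //.
- by apply: eq_integral => t _; exact: IH.
- by move=> n; apply: measurable_dfwith_l; exact: measurable_lebI.
- by move=> n t _; apply: lebI_ge0.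
Qed.

(** * The DLR equations *)

Section kernel.
Context (R : realType) (U : circle R -> R) (mU : measurable_fun setT U)
  (C : R) (UC : forall t, `|U t| <= C).
Implicit Types (L : {fset int}) (A : set (conf R)) (x : conf R).
Local Open Scope ereal_scope.

Let H := hamiltonian (nearest_neighbor U).

Definition boltzmann L x : R := expR (- H L x).

Lemma measurable_boltzmann L : measurable_fun setT (boltzmann L).
Proof.
have [N LN] := fset_bounded L.
apply: (measurableT_comp (@measurable_expR R)).
apply: (@measurableT_comp _ _ _ _ _ _ (@GRing.opp R)) => //.
rewrite (_ : H L = fun x => (\sum_(k <- edges N | touches L k) - U (bond_at k x))%R); last first.
  by apply/funext => x; rewrite /H (hamiltonianE _ _ (uniq_edges N) (touches_edges LN)).
under eq_fun do rewrite big_mkcond.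
apply: measurable_sum => k; case: (touches L k) => //.
apply: (@measurableT_comp _ _ _ _ _ _ (@GRing.opp R)) => //.
by apply: (measurableT_comp mU); exact: measurable_bond_at.
Qed.

Lemma boltzmann_bounded L : exists2 b : R, (0 < b)%R &
  forall x, (b <= boltzmann L x <= b^-1)%R.
Proof.
have [N LN] := fset_bounded L.
exists (expR (- (\sum_(k <- edges N) C)))%R; first exact: expR_gt0.
have HC x : (`|H L x| <= \sum_(k <- edges N) C)%R.
  rewrite /H (hamiltonianE _ _ (uniq_edges N) (touches_edges LN)).
  apply: (le_trans (ler_norm_sum _ _ _)); rewrite big_mkcond /=.
  apply: ler_sum => k _; case: ifP => _; first by rewrite normrN.
  exact: (le_trans (normr_ge0 _) (UC 0%R)).
move=> x; rewrite -expRN /boltzmann !ler_expR.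
by have := HC x; rewrite ler_norml => /andP[h1 h2]; apply/andP; split; lra.
Qed.

Definition partition_fun L x : \bar R := lebI L (fun y => (boltzmann L y)%:E) x.

Definition unnormalized L A x : \bar R :=
  lebI L (fun y => (boltzmann L y * \1_A y)%:E) x.

Lemma gibbs_kernelE L A x : gibbs_kernel (nearest_neighbor U) L A x =
  (fine (partition_fun L x))^-1%:E * unnormalized L A x.
Proof. by []. Qed.

Lemma boltzmann_ge0 L x : (0 <= boltzmann L x)%R.
Proof. exact: expR_ge0. Qed.

Let mB L : measurable_fun setT (fun y => (boltzmann L y)%:E).
Proof. by apply/measurable_EFinP; exact: measurable_boltzmann. Qed.

Let mBA L A : measurable A -> measurable_fun setT (fun y => (boltzmann L y * \1_A y)%:E).
Proof.
move=> mA; apply/measurable_EFinP; apply: measurable_funM; first exact: measurable_boltzmann.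
exact: measurable_indic.
Qed.

Lemma partition_fun_bounded L : exists2 b : R, (0 < b)%R &
  forall x, b%:E <= partition_fun L x <= b^-1%:E.
Proof.
have [b b0 bB] := boltzmann_bounded L; exists b => // x.
rewrite -{1}(@lebI_cst R L b%:E x) -(@lebI_cst R L b^-1%:E x) /cst.
apply/andP; split; apply: le_lebI => //.
- by move=> _; rewrite lee_fin ltW.
- by move=> y; rewrite lee_fin; have /andP[] := bB y.
- by move=> y; rewrite lee_fin boltzmann_ge0.
- by move=> y; rewrite lee_fin; have /andP[] := bB y.
Qed.

Lemma partition_fun_fin L x : partition_fun L x \is a fin_num.
Proof.
have [b b0 /(_ x)/andP[h1 h2]] := partition_fun_bounded L.
by rewrite ge0_fin_numE ?(le_lt_trans h2) ?ltry // (le_trans _ h1) // lee_fin ltW.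
Qed.

Lemma partition_fun_gt0 L x : (0 < fine (partition_fun L x))%R.
Proof.
have [b b0 /(_ x)/andP[h1 h2]] := partition_fun_bounded L.
by rewrite -lte_fin fineK ?partition_fun_fin // (lt_le_trans _ h1).
Qed.

Lemma measurable_partition_fun L : measurable_fun setT (partition_fun L).
Proof. by apply: measurable_lebI => // x; rewrite lee_fin boltzmann_ge0. Qed.

Lemma unnormalized_ge0 L A x : 0 <= unnormalized L A x.
Proof. by apply: lebI_ge0 => y; rewrite lee_fin mulr_ge0 // boltzmann_ge0. Qed.

Lemma measurable_unnormalized L A : measurable A -> measurable_fun setT (unnormalized L A).
Proof.
move=> mA; apply: measurable_lebI; first exact: mBA.
by move=> x; rewrite lee_fin mulr_ge0 // boltzmann_ge0.
Qed.

Lemma gibbs_kernel_ge0 L A x : 0 <= gibbs_kernel (nearest_neighbor U) L A x.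
Proof.
rewrite gibbs_kernelE mule_ge0 ?unnormalized_ge0 // lee_fin invr_ge0.
exact/ltW/partition_fun_gt0.
Qed.

Lemma measurable_gibbs_kernel L A : measurable A ->
  measurable_fun setT (gibbs_kernel (nearest_neighbor U) L A).
Proof.
move=> mA; rewrite (_ : gibbs_kernel _ L A =
  fun x => (fine (partition_fun L x))^-1%:E * unnormalized L A x) //.
apply: emeasurable_funM; last exact: measurable_unnormalized.
apply/measurable_EFinP.
(* The partition function being positive, its inverse is written exp(-ln), a composition of
   measurable functions. *)
rewrite (_ : (fun x => _) = fun x => expR (- ln (fine (partition_fun L x)))); last first.
  by apply/funext => x; rewrite expRN lnK // posrE partition_fun_gt0.
apply: (measurableT_comp (@measurable_expR R)).
apply: (@measurableT_comp _ _ _ _ _ _ (@GRing.opp R)) => //.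
apply: (measurableT_comp (@measurable_ln R)).
apply: (measurableT_comp (@fine_measurable R _ measurableT)).
exact: measurable_partition_fun.
Qed.

Lemma unnormalizedE L A x : unnormalized L A x =
  gibbs_kernel (nearest_neighbor U) L A x * partition_fun L x.
Proof.
rewrite gibbs_kernelE muleAC -[X in _ * X * _](fineK (partition_fun_fin L x)).
by rewrite -EFinM mulVf ?mul1e // gt_eqF // partition_fun_gt0.
Qed.

Lemma gibbs_kernelT L x : gibbs_kernel (nearest_neighbor U) L setT x = 1.
Proof.
rewrite gibbs_kernelE (_ : unnormalized L setT x = partition_fun L x).
  rewrite -[X in _ * X](fineK (partition_fun_fin L x)).
  by rewrite -EFinM mulVf // gt_eqF // partition_fun_gt0.
rewrite /unnormalized /partition_fun; congr (lebI _ _ _); apply/funext => y.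
by rewrite indicT mulr1.
Qed.

Lemma gibbs_kernel_bigcup L (F : (set (conf R))^nat) x :
  (forall n, measurable (F n)) -> trivIset setT F ->
  gibbs_kernel (nearest_neighbor U) L (\bigcup_n F n) x =
  \sum_(n <oo) gibbs_kernel (nearest_neighbor U) L (F n) x.
Proof.
move=> mF tF; rewrite gibbs_kernelE; under eq_eseriesr do rewrite gibbs_kernelE.
rewrite nneseriesZl; last by move=> n _; exact: unnormalized_ge0.
congr (_ * _); rewrite /unnormalized.
have -> : (fun y => (boltzmann L y * \1_(\bigcup_n F n) y)%:E) =
    (fun y => \sum_(n <oo) (boltzmann L y * \1_(F n) y)%:E).
  by apply/funext => y; rewrite EFinM indic_bigcup // -nneseriesZl.
apply: lebI_nneseries => [n|n y]; first exact: mBA.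
by rewrite lee_fin mulr_ge0 // boltzmann_ge0.
Qed.

Lemma gibbs_kernel_setC L A x : measurable A ->
  gibbs_kernel (nearest_neighbor U) L A x +
  gibbs_kernel (nearest_neighbor U) L (~` A) x = 1.
Proof.
move=> mA; have := @gibbs_kernel_bigcup L (bigcup2 A (~` A)) x.
rewrite bigcup2E setUv gibbs_kernelT => -> //.
- rewrite (nneseries_split _ 2) //=; last by move=> k _; exact: gibbs_kernel_ge0.
  rewrite !big_mkord !big_ord_recr big_ord0 /= add0e eseries0 ?adde0 // => -[|[|k]] //= _ _.
  rewrite gibbs_kernelE /unnormalized.
  rewrite (_ : (fun y => _) = cst 0) ?lebI_cst ?mule0 //.
  by apply/funext => y; rewrite /bigcup2 /= indic0 mulr0.
- by move=> [|[|n]] //=; exact: measurableC.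
- by rewrite -trivIset_bigcup2 setICr.
Qed.

End kernel.

(** * Local functions and cylinder sets *)

Definition local_fun (R : realType) (K : nat) (Y : Type) (f : conf R -> Y) :=
  forall x y : conf R, (forall k, (`|k| <= K)%N -> x k = y k) -> f x = f y.

Lemma local_fun_le (R : realType) (K K' : nat) (Y : Type) (f : conf R -> Y) :
  (K <= K')%N -> local_fun K f -> local_fun K' f.
Proof. by move=> KK' lf x y xy; apply: lf => k kK; apply: xy; exact: leq_trans KK'. Qed.

Lemma lebI_local (R : realType) (K : nat) s (F : conf R -> \bar R) :
  local_fun K F -> local_fun K (lebI s F).
Proof.
move=> lF; elim: s => //= k s IH x y xy.
apply: eq_integral => t _; apply: IH => j jK.
have [<-|kj] := eqVneq k j; first by rewrite !dfwithin.
by rewrite !dfwithout //; exact: xy.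
Qed.

Definition cylinders (R : realType) : set (set (conf R)) :=
  [set A | measurable A /\ exists K, local_fun K (fun x => x \in A)].

Lemma cylinder_box (R : realType) c : cylinders (@box R c).
Proof.
split; first exact: measurable_box.
exists (\max_(i <- c) `|i.1|%N) => x y xy.
suff : box c x = box c y by move=> e; apply/idP/idP => /set_mem bx; apply/mem_set; rewrite ?e // -e.
rewrite /box /=; congr is_true; apply: eq_in_all => i ic; rewrite xy //.
by apply: (@leq_bigmax_seq _ c xpredT (fun i => `|i.1|%N)).
Qed.

(** Boxes are cylinders and countably many of them exhaust any open set, so events that see finitely
    many sites generate the Borel sets. *)
Lemma measurable_cylindersE (R : realType) :
  (@measurable _ (conf R)) = <<s @cylinders R >>.
Proof.
apply/seteqP; split; last first.
  by apply: smallest_sub; [exact: sigma_algebra_measurable|move=> A []].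
apply: smallest_sub; first exact: smallest_sigma_algebra.
move=> A oA; rewrite (open_conf_box oA) bigcup_mkcond.
apply: (@countable_bigcupT_measurable _ (g_sigma_algebraType (@cylinders R))) => // c.
by case: ifPn => _; [apply: sub_sigma_algebra; exact: cylinder_box|exact: measurable0].
Qed.

Lemma cylinders_setI (R : realType) : setI_closed (@cylinders R).
Proof.
move=> A B [mA [K lA]] [mB [K' lB]]; split; first exact: measurableI.
exists (maxn K K') => x y xy; rewrite !in_setI.
rewrite (local_fun_le (leq_maxl K K') lA xy).
by rewrite (local_fun_le (leq_maxr K K') lB xy).
Qed.

Lemma cylinders_setC (R : realType) (A : set (conf R)) : cylinders A -> cylinders (~` A).
Proof.
move=> [mA [K lA]]; split; first exact: measurableC.
by exists K => x y xy; rewrite !in_setC (lA _ _ xy).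
Qed.

Lemma lebI_indep (R : realType) s (F : conf R -> \bar R) : indep_of s (lebI s F).
Proof.
elim: s => [x k t //|j s IH x k t]; rewrite in_cons => kjs /=.
apply: eq_integral => u _; have [<-|kj] := eqVneq k j.
  congr (lebI s F _); apply/funext => i.
  by have [<-|ki] := eqVneq k i; [rewrite !dfwithin|rewrite !dfwithout].
have ks : k \in s by move: kjs; rewrite (negbTE kj).
by rewrite dfwithC //; exact: IH.
Qed.

Section local_kernel.
Context (R : realType) (U : circle R -> R).

Lemma boltzmann_local (L : {fset int}) N : (forall k, k \in L -> (`|k| < N)%N) ->
  local_fun N (boltzmann U L).
Proof.
move=> LN x y xy; rewrite /boltzmann !(hamiltonianE _ _ (uniq_edges N) (touches_edges LN)).
congr (expR (- _)).
rewrite big_seq_cond [RHS]big_seq_cond; apply: eq_bigr => k /andP[+ _].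
by rewrite mem_edges => kN; rewrite /bond_at !xy //; lia.
Qed.

Lemma gibbs_kernel_local (L : {fset int}) N A : (forall k, k \in L -> (`|k| < N)%N) ->
  local_fun N (fun x => x \in A) ->
  local_fun N (gibbs_kernel (nearest_neighbor U) L A).
Proof.
move=> LN lA x y xy; have lB := boltzmann_local LN.
rewrite !gibbs_kernelE; congr ((fine _)^-1%:E * _)%E.
  by apply: lebI_local xy => x' y' xy'; rewrite (lB _ _ xy').
by apply: lebI_local xy => x' y' xy'; rewrite (lB _ _ xy') !indicE (lA _ _ xy').
Qed.

End local_kernel.

(** * The Gibbs property of the law with independent increments *)

Section dlr.
Context (R : realType) (U : circle R -> R) (mU : measurable_fun setT U)
  (C : R) (UC : forall t, `|U t| <= C).
Context (z : R) (z0 : 0 < z).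
Let h (t : circle R) : R := expR (U t) / z.
Context (Q : R -> circle R) (mQ : @measurable_fun _ _ (measurableTypeR R) _ setT Q).
Local Open Scope ereal_scope.
Hypothesis lawQ : forall g : circle R -> \bar R, measurable_fun setT g ->
  (forall t, 0 <= g t) -> \int[U01 R]_v g (Q v) = \int[leb R]_t (g t * (h t)%:E).

Let mh : measurable_fun setT h.
Proof.
by apply: measurable_funM => //; apply: (measurableT_comp (@measurable_expR R)).
Qed.

Let h0 t : (0 <= h t)%R.
Proof. by rewrite divr_ge0 ?expR_ge0 // ltW. Qed.

(** The factor of the weight carried by the bonds that do not touch [L], together with the
    normalizations of all 2N bonds. It is constant in the coordinates of [L]. *)
Let rest (L : {fset int}) N (x : conf R) : R :=
  (z^-1 ^+ N.*2 * \prod_(k <- edges N | ~~ touches L k) expR (U (bond_at k x)))%R.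

Let weightE (L : {fset int}) N x : (forall k, k \in L -> (`|k| < N)%N) ->
  weight h N.*2 x = (rest L N x * boltzmann U L x)%R.
Proof.
move=> LN; rewrite /rest /boltzmann (hamiltonianE _ _ (uniq_edges N) (touches_edges LN)).
rewrite sumrN opprK expR_sum -mulrA [X in (_ * X)%R]mulrC.
have <- : (\prod_(k <- edges N) expR (U (bond_at k x)) =
    (\prod_(k <- edges N | touches L k) expR (U (bond_at k x))) *
    \prod_(k <- edges N | ~~ touches L k) expR (U (bond_at k x)))%R.
  exact: (bigID (touches L)).
rewrite /edges big_map /weight.
rewrite -(big_mkord xpredT (fun i => h (bond_at (edge i) x))) /index_iota subn0.
rewrite big_split /= mulrC; congr (_ * _)%R.
by rewrite big_const_seq count_predT size_iota iter_mulr_1.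
Qed.

Let rest_ge0 L N x : (0 <= rest L N x)%R.
Proof.
rewrite mulr_ge0 ?exprn_ge0 ?invr_ge0 ?(ltW z0) //.
by apply: prodr_ge0 => k _; exact: expR_ge0.
Qed.

Let rest_indep (L : {fset int}) N : indep_of L (fun x => (rest L N x)%:E).
Proof.
move=> x k t kL; congr ((_ * _)%R)%:E; apply: eq_bigr => j jL.
move: jL; rewrite negb_or => /andP[jL j1L].
rewrite /bond_at !dfwithout //; first by apply: contraNneq j1L => <-.
by apply: contraNneq jL => <-.
Qed.

(** Once the sites of [L] are integrated innermost, the weight is [rest] times the Boltzmann factor.
    On the left the inner integral is [rest] times [unnormalized]. On the right the kernel does not
    depend on the sites of [L], so it comes out together with [rest] and leaves the partition
    function; the product is again [unnormalized]. *)
Lemma dlr_theta (L : {fset int}) N A : measurable A -> (forall k, k \in L -> (`|k| < N)%N) ->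
  \int[U01 R]_u (\1_A (theta Q N.*2 u))%:E =
  \int[U01 R]_u gibbs_kernel (nearest_neighbor U) L A (theta Q N.*2 u).
Proof.
move=> mA LN.
pose S' := [seq k <- sites N.*2 | k \notin L].
have SL : perm_eq (sites N.*2) (S' ++ L).
  rewrite -(perm_filterC (fun k => k \in L)) perm_catC perm_cat2l.
  apply: uniq_perm; [exact/filter_uniq/uniq_sites|exact: fset_uniq|].
  move=> k; rewrite mem_filter mem_sites; apply/andP/idP => [[]//|kL].
  by split => //; exact: ltnW (LN _ kL).
have mw : measurable_fun setT (fun x => (weight h N.*2 x)%:E).
  by apply/measurable_EFinP; exact: measurable_weight.
have w0 x : 0 <= (weight h N.*2 x)%:E by rewrite lee_fin weight_ge0.
have mK := measurable_gibbs_kernel mU UC L mA.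
have K0 := gibbs_kernel_ge0 mU UC L A.
have mi : measurable_fun setT (fun x : conf R => (\1_A x)%:E : \bar R).
  by apply/measurable_EFinP; exact: measurable_indic.
have mB : measurable_fun setT (fun y => (boltzmann U L y)%:E).
  by apply/measurable_EFinP; exact: measurable_boltzmann.
have B0 y : 0 <= (boltzmann U L y)%:E by rewrite lee_fin boltzmann_ge0.
have mBA : measurable_fun setT (fun y => (boltzmann U L y * \1_A y)%:E).
  by under eq_fun do rewrite EFinM; exact: emeasurable_funM.
transitivity (lebI S' (fun x => (rest L N x)%:E * unnormalized U L A x) (@conf0 R)).
  rewrite (law_theta mh h0 mQ lawQ _ mi) //.
  rewrite (lebI_perm _ _ SL); last 2 first.
  - exact: emeasurable_funM.
  - by move=> x; rewrite mule_ge0 // lee_fin.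
  rewrite lebI_cat; congr (lebI _ _ _); apply/funext => x.
  rewrite -(@lebI_Zl R L (fun y => (rest L N y)%:E) _ mBA).
  - congr (lebI _ _ _); apply/funext => y.
    by rewrite (weightE _ LN) -!EFinM mulrA.
  - by move=> y; rewrite lee_fin mulr_ge0 // boltzmann_ge0.
  - by move=> y; rewrite lee_fin rest_ge0.
  - exact: rest_indep.
rewrite (law_theta mh h0 mQ lawQ _ mK K0).
rewrite (lebI_perm _ _ SL); last 2 first.
- exact: emeasurable_funM.
- by move=> x; rewrite mule_ge0.
rewrite lebI_cat; congr (lebI _ _ _); apply/funext => x.
rewrite (unnormalizedE mU UC) muleA.
rewrite -(@lebI_Zl R L (fun y => (rest L N y)%:E * gibbs_kernel (nearest_neighbor U) L A y) _ mB B0).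
- congr (lebI _ _ _); apply/funext => y.
  by rewrite (weightE _ LN) EFinM muleAC.
- by move=> y; rewrite mule_ge0 // lee_fin rest_ge0.
- move=> y k t kL; congr (_ * _); first exact: (@rest_indep L N y k t kL).
  by rewrite !gibbs_kernelE /partition_fun /unnormalized !lebI_indep.
Qed.

Definition gibbs_law : probability (conf R) R :=
  image_probability (U01 R) (measurable_Theta mQ).

Lemma integral_gibbs_law (f : conf R -> \bar R) : measurable_fun setT f ->
  (forall x, 0 <= f x) -> \int[gibbs_law]_x f x = \int[U01 R]_u f (Theta Q u).
Proof. by move=> mf f0; exact: (ge0_integral_pushforward (measurable_Theta mQ)). Qed.

Lemma is_gibbs_gibbs_law : is_gibbs (nearest_neighbor U) gibbs_law.
Proof.
move=> L A; rewrite measurable_cylindersE.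
pose P (A : set (conf R)) :=
  gibbs_law A = \int[gibbs_law]_x gibbs_kernel (nearest_neighbor U) L A x.
move: A; apply: (@dynkin_induction _ _ _ P (measurable_cylindersE R)).
- exact: cylinders_setI.
- rewrite /P probability_setT (eq_integral (cst 1)).
    by rewrite (integral_cst gibbs_law measurableT) [X in _ * X]probability_setT mule1.
  by move=> x _; rewrite (gibbs_kernelT mU UC).
- move=> A [mA [K lA]]; rewrite /P.
  have [N0 LN0] := fset_bounded L.
  (* The window contains [L] with its neighbours and the sites seen by [A], so neither the indicator
     nor the kernel distinguishes [Theta] from [theta Q N.*2]. *)
  pose N := maxn N0 K.
  have LN k : k \in L -> (`|k| < N)%N by move=> /LN0 h1; rewrite leq_max h1.
  have lAN := local_fun_le (leq_maxr N0 K) lA.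
  have tT u k : (`|k| <= N)%N -> theta Q N.*2 u k = Theta Q u k.
    by move=> kN; apply: theta_Theta; rewrite leq_double.
  transitivity (\int[gibbs_law]_x (\1_A x)%:E); first by rewrite integral_indic // setIT.
  rewrite [LHS]integral_gibbs_law; first last.
  + by move=> x; rewrite lee_fin.
  + by apply/measurable_EFinP; exact: measurable_indic.
  rewrite [RHS]integral_gibbs_law; first last.
  + exact: (gibbs_kernel_ge0 mU UC).
  + exact: (measurable_gibbs_kernel mU UC).
  transitivity (\int[U01 R]_u (\1_A (theta Q N.*2 u))%:E).
    by apply: eq_integral => u _; rewrite !indicE (lAN _ _ (tT u)).
  rewrite (dlr_theta mA LN); apply: eq_integral => u _.
  exact: (gibbs_kernel_local U LN lAN (tT u)).
- move=> A mA PA; rewrite /P probability_setC // [X in 1 - X]PA.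
  have e : \int[gibbs_law]_x gibbs_kernel (nearest_neighbor U) L A x +
    \int[gibbs_law]_x gibbs_kernel (nearest_neighbor U) L (~` A) x = 1.
    rewrite -ge0_integralD //; first last.
    + by apply: measurable_gibbs_kernel => //; exact: measurableC.
    + by move=> x _; exact: (gibbs_kernel_ge0 mU UC).
    + exact: (measurable_gibbs_kernel mU UC).
    + by move=> x _; exact: (gibbs_kernel_ge0 mU UC).
    rewrite (eq_integral (cst 1)).
      by rewrite (integral_cst gibbs_law measurableT) [X in _ * X]probability_setT mule1.
    by move=> x _; by rewrite (gibbs_kernel_setC mU UC).
  rewrite -e addeAC subee ?add0e // -PA; exact: fin_num_measure.
- move=> F mF tF PF; rewrite /P measure_semi_bigcup //; last exact: bigcupT_measurable.
  under [RHS]eq_integral do rewrite (gibbs_kernel_bigcup mU L _ mF tF).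
  rewrite integral_nneseries //.
  + by apply: eq_eseriesr => n _; exact: PF.
  + by move=> n; exact: (measurable_gibbs_kernel mU UC).
  + by move=> n x _; exact: (gibbs_kernel_ge0 mU UC).
Qed.

End dlr.

Lemma lee_cvg_seq (R : realType) (u v : nat -> \bar R) (a b : \bar R) :
  u @ \oo --> a -> v @ \oo --> b -> (forall n, u n <= v n)%E -> (a <= b)%E.
Proof.
move=> ua vb uv; have : (limn u <= limn v)%E.
  by apply: lee_lim; [exact: cvgP ua|exact: cvgP vb|exact: nearW].
by rewrite (cvg_lim _ ua) // (cvg_lim _ vb).
Qed.

(** An inequality between measures is not stable under complements, so Dynkin's lemma is of no help.
    It is stable under monotone limits, and the cylinders form a ring: the monotone class theorem
    applies. *)
Lemma le_measure_cylinders (R : realType) (mu nu : probability (conf R) R) (c : {nonneg R}) :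
  (forall A, cylinders A -> c%:num%:E * nu A <= mu A)%E ->
  forall A, measurable A -> (c%:num%:E * nu A <= mu A)%E.
Proof.
move=> le_cyl A; pose m := mscale c nu.
pose G := [set A : set (conf R) | measurable A /\ (m A <= mu A)%E].
rewrite measurable_cylindersE => sA.
suff [] : G A by [].
have cylD : setD_closed (@cylinders R).
  by move=> X Y cX cY; rewrite setDE; apply: cylinders_setI => //; exact: cylinders_setC.
have cylT : cylinders [set: conf R].
  by split => //; exists 0%N => x y _; rewrite !in_setT.
have ringC : setring (@cylinders R).
  split => //; first by rewrite -(setDv setT); exact: cylD.
  move=> X Y cX cY; rewrite -[_ `|` _]setCK setCU; apply: cylinders_setC.
  by apply: cylinders_setI; exact: cylinders_setC.
apply: (@monotone_setring_sub_g_sigma_ring _ G _ _ ringC).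
- split => F ndF GF.
  + have mF : measurable (\bigcup_n F n) by apply: bigcupT_measurable => n; have [] := GF n.
    split => //; have mFn n : measurable (F n) by have [] := GF n.
    have h1 := @nondecreasing_cvg_mu _ _ _ m F mFn mF ndF.
    have h2 := @nondecreasing_cvg_mu _ _ _ mu F mFn mF ndF.
    exact: (lee_cvg_seq h1 h2 (fun n => proj2 (GF n))).
  + have mF : measurable (\bigcap_n F n) by apply: bigcapT_measurable => n; have [] := GF n.
    split => //; have mFn n : measurable (F n) by have [] := GF n.
    have f1 : (m (F 0%N) < +oo)%E.
      by rewrite /m /mscale lte_mul_pinfty // -ge0_fin_numE // fin_num_measure.
    have f2 : (mu (F 0%N) < +oo)%E by rewrite -ge0_fin_numE // fin_num_measure.
    have h1 := @nonincreasing_cvg_mu _ _ _ m F f1 mFn mF ndF.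
    have h2 := @nonincreasing_cvg_mu _ _ _ mu F f2 mFn mF ndF.
    exact: (lee_cvg_seq h1 h2 (fun n => proj2 (GF n))).
- by move=> X cX; split; [case: cX|exact: le_cyl].
(* The sigma-ring generated by the cylinders contains the whole space, hence it is a
   sigma-algebra. *)
- apply: sA; split; last exact: sub_gen_smallest.
  have [sr0 srD srU] := smallest_sigma_ring (@cylinders R).
  split => //; move=> X sX; apply: srD => //.
  exact: sub_gen_smallest.
Qed.

(** * Uniqueness of the Gibbs measure *)

Section uniqueness.
Context (R : realType) (U : circle R -> R) (mU : measurable_fun setT U)
  (C : R) (UC : forall t, `|U t| <= C).

Definition ball_sites (N : nat) : {fset int} := seq_fset tt (sites N.*2).

Lemma mem_ball_sites N k : (k \in ball_sites N) = (`|k| <= N)%N.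
Proof. by rewrite seq_fsetE mem_sites. Qed.

(** Bonds inside the window take the same value at [x] and [y]. Only the bonds -N-1 and N cross its
    border, and each changes the energy by at most 2 C, so the constant does not depend on [N]. *)
Lemma boltzmann_ratio N (x y : conf R) : (forall k, (`|k| <= N)%N -> x k = y k) ->
  boltzmann U (ball_sites N) x <= expR (4 * C) * boltzmann U (ball_sites N) y.
Proof.
move=> xy; rewrite /boltzmann -expRD ler_expR.
pose e := (- N.+1%:Z) :: N%:Z :: edges N.
have ue : uniq e.
  rewrite /e /= !in_cons !mem_edges uniq_edges andbT.
  by apply/andP; split; [rewrite negb_or; apply/andP; split|]; lia.
have te k : touches (ball_sites N) k -> k \in e.
  by rewrite /touches /e !mem_ball_sites !in_cons mem_edges; lia.
rewrite !(hamiltonianE _ _ ue te) /e !big_cons.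
have -> : touches (ball_sites N) (- N.+1%:Z).
  by rewrite /touches !mem_ball_sites; apply/orP; right; lia.
have -> : touches (ball_sites N) N%:Z.
  by rewrite /touches !mem_ball_sites; apply/orP; left; lia.
have -> : \sum_(k <- edges N | touches (ball_sites N) k) - U (bond_at k x) =
    \sum_(k <- edges N | touches (ball_sites N) k) - U (bond_at k y).
  rewrite big_seq_cond [RHS]big_seq_cond; apply: eq_bigr => k /andP[+ _].
  by rewrite mem_edges => kN; rewrite /bond_at !xy //; lia.
set S := \sum_(k <- edges N | _) _.
have b k w : - C <= U (bond_at k w) <= C by rewrite -ler_norml.
have /andP[a1 a2] := b (- N.+1%:Z) x; have /andP[a3 a4] := b N%:Z x.
have /andP[a5 a6] := b (- N.+1%:Z) y; have /andP[a7 a8] := b N%:Z y.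
by lra.
Qed.

Let K : R := expR (4 * C).
Let K0 : 0 < K. Proof. exact: expR_gt0. Qed.

Local Open Scope ereal_scope.

(** One factor [K] comes from the numerator and one from the partition function. *)
Lemma gibbs_kernel_ratio N A (x y : conf R) : measurable A ->
  local_fun N (fun x => x \in A) ->
  gibbs_kernel (nearest_neighbor U) (ball_sites N) A y <=
  (K ^+ 2)%:E * gibbs_kernel (nearest_neighbor U) (ball_sites N) A x.
Proof.
move=> mA lA; set L := ball_sites N.
have mB : measurable_fun setT (fun y => (boltzmann U L y)%:E).
  by apply/measurable_EFinP; exact: measurable_boltzmann.
have B0 w : 0 <= (boltzmann U L w)%:E by rewrite lee_fin boltzmann_ge0.
have mi : measurable_fun setT (fun x : conf R => (\1_A x)%:E : \bar R).
  by apply/measurable_EFinP; exact: measurable_indic.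
have mBA : measurable_fun setT (fun y => (boltzmann U L y * \1_A y)%:E).
  by under eq_fun do rewrite EFinM; exact: emeasurable_funM.
have BA0 w : 0 <= (boltzmann U L w * \1_A w)%:E by rewrite lee_fin mulr_ge0 // boltzmann_ge0.
have agree (v w : conf R) : (forall k, k \in enum_fset L -> v k = w k) -> forall k, (`|k| <= N)%N -> v k = w k.
  by move=> vw k kN; apply: vw; rewrite -[_ \in _]/(k \in ball_sites N) mem_ball_sites.
have hN : unnormalized U L A y <= K%:E * unnormalized U L A x.
  rewrite /unnormalized -(@lebI_Zl R L (cst K%:E) _ mBA BA0) //; last by move=> w; rewrite lee_fin ltW.
  apply: le_lebI2 => //.
  - by apply: emeasurable_funM => //.
  - by move=> w; rewrite mule_ge0 // lee_fin ltW.
  - move=> y' x' yx _ _; rewrite /cst -EFinM lee_fin !indicE (lA _ _ (agree _ _ yx)) mulrA.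
    by rewrite ler_wpM2r //; exact: boltzmann_ratio (agree _ _ yx).
have hZ : partition_fun U L x <= K%:E * partition_fun U L y.
  rewrite /partition_fun -(@lebI_Zl R L (cst K%:E) _ mB B0) //; last by move=> w; rewrite lee_fin ltW.
  apply: le_lebI2 => //.
  - by apply: emeasurable_funM => //.
  - by move=> w; rewrite mule_ge0 // lee_fin ltW.
  - move=> y' x' yx _ _; rewrite /cst -EFinM lee_fin.
    exact: boltzmann_ratio (agree _ _ yx).
have Zx := partition_fun_gt0 mU UC L x; have Zy := partition_fun_gt0 mU UC L y.
move: hZ; rewrite -(fineK (partition_fun_fin mU UC L x)) -(fineK (partition_fun_fin mU UC L y)).
rewrite -EFinM lee_fin => hZ.
have hV : ((fine (partition_fun U L y))^-1 <= K * (fine (partition_fun U L x))^-1)%R.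
  by rewrite -ler_pdivrMr ?invr_gt0 // invrK mulrC ler_pdivrMr.
rewrite !gibbs_kernelE expr2 EFinM.
apply: (@le_trans _ _ ((K * (fine (partition_fun U L x))^-1)%:E * (K%:E * unnormalized U L A x))).
  apply: lee_pmul => //; first by rewrite lee_fin invr_ge0 ltW.
  exact: unnormalized_ge0.
by rewrite EFinM !muleA (muleAC _ _ K%:E).
Qed.

(** Adding 1 makes 0 < d < 1 immediate and keeps d K^2 at most 1. *)
Let d : R := (K ^+ 2 + 1)^-1%R.

Let d0 : (0 < d)%R.
Proof. by rewrite invr_gt0 addr_gt0 // exprn_gt0. Qed.

Let d1 : (d < 1)%R.
Proof. by rewrite invf_lt1 ?ltrDr ?exprn_gt0 // addr_gt0 // exprn_gt0. Qed.

(** By the DLR equation [nu A] is the mean of the kernel over boundary conditions [y], each value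
    being at most K^2 times the value at [x]. *)
Lemma gibbs_kernel_ge (nu : probability (conf R) R) N A x :
  is_gibbs (nearest_neighbor U) nu -> measurable A ->
  local_fun N (fun x => x \in A) ->
  d%:E * nu A <= gibbs_kernel (nearest_neighbor U) (ball_sites N) A x.
Proof.
move=> gnu mA lA; set g := gibbs_kernel _ _ A.
have g0 := gibbs_kernel_ge0 mU UC (ball_sites N) A.
have le : nu A <= (K ^+ 2)%:E * g x.
  rewrite (gnu (ball_sites N) A mA).
  apply: (@le_trans _ _ (\int[nu]_y (cst ((K ^+ 2)%:E * g x) y))).
    apply: ge0_le_integral => //; first exact: measurable_gibbs_kernel.
    by move=> y _; exact: gibbs_kernel_ratio.
  by rewrite (integral_cst nu measurableT) [X in _ * X]probability_setT mule1.
apply: (@le_trans _ _ (d%:E * ((K ^+ 2)%:E * g x))).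
  by rewrite lee_wpmul2l // lee_fin ltW.
rewrite muleA -EFinM -[leRHS]mul1e lee_wpmul2r //.
by rewrite lee_fin /d mulrC ler_pdivrMr ?mul1r ?lerDl // addr_gt0 // exprn_gt0.
Qed.

(** The constant d nu(A) is subtracted from the kernel. The remainder [f] is nonnegative, so the
    domination already known applies to its integrals: mu(A) is at least c (nu(A) - d nu(A)) + d
    nu(A). Equivalently, 1 - c is multiplied by 1 - d. *)
Lemma gibbs_domination_step (mu nu : probability (conf R) R) (c : R) :
  is_gibbs (nearest_neighbor U) mu -> is_gibbs (nearest_neighbor U) nu -> (0 <= c <= 1)%R ->
  (forall A, measurable A -> c%:E * nu A <= mu A) ->
  forall A, measurable A -> (c + d - c * d)%:E * nu A <= mu A.
Proof.
move=> gmu gnu /andP[c0 c1] cA A mA.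
have cd0 : (0 <= c + d - c * d)%R by have := d0; nra.
apply: (@le_measure_cylinders R mu nu (NngNum cd0)) => //= {}A [{}mA [N lA]].
set g := gibbs_kernel (nearest_neighbor U) (ball_sites N) A.
have g0 x : 0 <= g x := gibbs_kernel_ge0 mU UC (ball_sites N) A x.
have mg : measurable_fun setT g by exact: measurable_gibbs_kernel.
have fnu : nu A \is a fin_num by exact: fin_num_measure.
pose e := (d * fine (nu A))%R.
have e0 : (0 <= e)%R by rewrite mulr_ge0 ?fine_ge0 // ltW.
have eE : e%:E = d%:E * nu A by rewrite /e EFinM fineK.
pose f x := g x - e%:E.
have f0 x : 0 <= f x by rewrite /f sube_ge0 // eE; exact: gibbs_kernel_ge.
have mf : measurable_fun setT f by apply: emeasurable_funB.
have gf x : g x = f x + e%:E by rewrite /f subeK.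
have decomp (rho : probability (conf R) R) : is_gibbs (nearest_neighbor U) rho ->
    rho A = \int[rho]_x f x + e%:E.
  move=> /(_ (ball_sites N) A mA) ->; rewrite -/g.
  under eq_integral do rewrite gf.
  rewrite ge0_integralD //.
  by rewrite (integral_cst rho measurableT e%:E) [X in _ * X]probability_setT mule1.
have fmunu : c%:E * \int[nu]_x f x <= \int[mu]_x f x.
  rewrite -(@ge0_integral_mscale _ _ _ nu setT measurableT (NngNum c0) f mf) //.
  by apply: ge0_le_measure_integral => // S mS; exact: cA.
have Fnu := decomp _ gnu; have Fmu := decomp _ gmu.
have nufin : \int[nu]_x f x \is a fin_num.
  by move: fnu; rewrite Fnu fin_numD => /andP[].
rewrite Fmu; apply: (@le_trans _ _ (c%:E * \int[nu]_x f x + e%:E)); last exact: leeD2r.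
move: Fnu; rewrite -(fineK nufin) -(fineK fnu) -!EFinD => -[Fnu].
have -> : fine (\int[nu]_x f x) = (fine (nu A) - d * fine (nu A))%R.
  by move: Fnu; rewrite /e; lra.
rewrite -!EFinM lee_fin /e; set a := fine (nu A).
by have -> : ((c + d - c * d) * a = c * (a - d * a) + d * a)%R by ring.
Qed.

Lemma gibbs_domination n (mu nu : probability (conf R) R) :
  is_gibbs (nearest_neighbor U) mu -> is_gibbs (nearest_neighbor U) nu ->
  forall A, measurable A -> (1 - (1 - d) ^+ n)%:E * nu A <= mu A.
Proof.
move=> gmu gnu; have dd : (0 <= 1 - d <= 1)%R by have := d0; have := d1; lra.
elim: n => [|n IH] A mA; first by rewrite expr0 subrr mul0e.
have := gibbs_domination_step gmu gnu _ IH mA.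
rewrite (_ : 1 - (1 - d) ^+ n + d - (1 - (1 - d) ^+ n) * d = 1 - (1 - d) ^+ n.+1)%R.
  apply; move: dd => /andP[h1 h2].
  have := exprn_ge0 n h1; have := exprn_ile1 n h1 h2; lra.
by rewrite exprS; ring.
Qed.

Theorem gibbs_unique (mu nu : probability (conf R) R) :
  is_gibbs (nearest_neighbor U) mu -> is_gibbs (nearest_neighbor U) nu ->
  forall A, measurable A -> mu A = nu A.
Proof.
have le (mu1 nu1 : probability (conf R) R) A : is_gibbs (nearest_neighbor U) mu1 ->
    is_gibbs (nearest_neighbor U) nu1 -> measurable A -> nu1 A <= mu1 A.
  move=> gmu gnu mA.
  have h n := gibbs_domination n gmu gnu mA.
  have c1 : (fun n => (1 - (1 - d) ^+ n)%:E * nu1 A) @ \oo --> 1%:E * nu1 A.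
    apply: cvgeZr; first exact: fin_num_measure.
    apply: cvg_EFin; first by near=> n.
    rewrite -[X in _ --> X]subr0; apply: cvgB; first exact: cvg_cst.
    by apply: cvg_expr; rewrite ger0_norm; have := d0; have := d1; lra.
  have c2 : (fun _ : nat => mu1 A) @ \oo --> mu1 A by exact: cvg_cst.
  have := lee_cvg_seq c1 c2 h.
  by rewrite mul1e.
by move=> gmu gnu A mA; apply/eqP; rewrite eq_le !le.
Unshelve. all: by end_near. Qed.

End uniqueness.

(** * Existence, and the one-site and bond marginals of every Gibbs measure *)

Lemma uniform_prob_coord1 (R : realType) (A : set (measurableTypeR R)) :
  measurable A -> U01 R (@coord1 R @^-1` A) = U01 R A.
Proof.
move=> mA; have := @uniform_prob_coord R A setT mA measurableT.
by rewrite preimage_setT setIT [X in (_ * X)%E]probability_setT mule1.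
Qed.

Lemma uniform_prob_coord2 (R : realType) (A : set (measurableTypeR R)) :
  measurable A -> U01 R (@coord2 R @^-1` A) = U01 R A.
Proof.
move=> mA; have := @uniform_prob_coord R setT A measurableT mA.
by rewrite preimage_setT setTI [X in (X * _)%E]probability_setT mul1e.
Qed.

Lemma uniform_prob_residue (R : realType) n (A : set (measurableTypeR R)) :
  measurable A -> U01 R (residue n @^-1` A) = U01 R A.
Proof.
elim: n A => [|n IH] A mA; first exact: uniform_prob_coord2.
rewrite -(uniform_prob_coord2 mA) -(IH (@coord2 R @^-1` A)); first by [].
exact: measurable_coord2_preimage.
Qed.

(** A weak form of shift invariance, read off the construction: one uniform marginal and identically
    distributed bonds. *)
Definition stationary (R : realType) (mu : probability (conf R) R) : Prop :=
  (forall A, measurable A -> mu ((fun x => x 0) @^-1` A) = leb R A) /\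
  (forall k A, measurable A -> mu (bond_at k @^-1` A) = mu (@bond R @^-1` A)).

Lemma measurable_preimage_proj (R : realType) k (A : set (circle R)) :
  measurable A -> measurable ((fun x : conf R => x k) @^-1` A).
Proof.
by move=> mA; rewrite -[X in measurable X]setTI; exact: measurable_proj_conf.
Qed.

Lemma measurable_preimage_bond (R : realType) k (A : set (circle R)) :
  measurable A -> measurable (@bond_at R k @^-1` A).
Proof.
by move=> mA; rewrite -[X in measurable X]setTI; exact: measurable_bond_at.
Qed.

Section existence.
Context (R : realType) (U : circle R -> R) (mU : measurable_fun setT U)
  (C : R) (UC : forall t, `|U t| <= C).
Local Open Scope ereal_scope.

Lemma gibbs_exists : exists2 nu : probability (conf R) R,
  is_gibbs (nearest_neighbor U) nu & stationary nu.
Proof.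
have mE : measurable_fun setT (fun t => (expR (U t))%:E : \bar R).
  by apply/measurable_EFinP; exact: (measurableT_comp (@measurable_expR R)).
have cstE (r : R) : \int[leb R]_t (cst r%:E t) = r%:E.
  by rewrite (integral_cst (leb R) measurableT) [X in _ * X]probability_setT mule1.
have lo : (expR (- C))%:E <= \int[leb R]_t (expR (U t))%:E.
  rewrite -cstE; apply: ge0_le_integral => // t _; first by rewrite lee_fin expR_ge0.
  by rewrite lee_fin ler_expR; have := UC t; rewrite ler_norml => /andP[].
have hi : \int[leb R]_t (expR (U t))%:E <= (expR C)%:E.
  rewrite -cstE; apply: ge0_le_integral => // t _.
  by rewrite lee_fin ler_expR; have := UC t; rewrite ler_norml => /andP[].
have Ifin : \int[leb R]_t (expR (U t))%:E \is a fin_num.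
  by rewrite ge0_fin_numE ?(le_lt_trans hi) ?ltry // (le_trans _ lo).
pose z := fine (\int[leb R]_t (expR (U t))%:E).
have z0 : (0 < z)%R.
  by apply: fine_gt0; rewrite (lt_le_trans _ lo) ?lte_fin ?expR_gt0 //= (le_lt_trans hi) ?ltry.
pose h t := (expR (U t) / z)%R.
have mh : measurable_fun setT h.
  by apply: measurable_funM => //; exact: (measurableT_comp (@measurable_expR R)).
have h0 t : (0 <= h t)%R by rewrite divr_ge0 ?expR_ge0 // ltW.
have h1 : \int[leb R]_t (h t)%:E = 1.
  under eq_integral do rewrite /h mulrC EFinM.
  rewrite ge0_integralZl //; last by rewrite lee_fin invr_ge0 ltW.
  by rewrite -(fineK Ifin) -EFinM mulVf // gt_eqF.
have [Q [mQ lawQ]] := exists_sampler mh h0 h1.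
exists (gibbs_law mQ); first exact: (is_gibbs_gibbs_law mU UC z0 mQ lawQ).
have mQp A : measurable A -> measurable (Q @^-1` A : set (measurableTypeR R)).
  by move=> mA; rewrite -[X in measurable X]setTI; exact: mQ.
have bondE n A : measurable A -> gibbs_law mQ (bond_at (edge n) @^-1` A) = U01 R (Q @^-1` A).
  move=> mA; rewrite -[LHS]/(U01 R (Theta Q @^-1` (bond_at (edge n) @^-1` A))).
  rewrite (_ : _ @^-1` _ = residue n @^-1` (@coord1 R @^-1` (Q @^-1` A))).
    rewrite (uniform_prob_residue _ (measurable_coord1_preimage (mQp _ mA))).
    exact: uniform_prob_coord1 (mQp _ mA).
  by apply/seteqP; split => u /=; rewrite Theta_bond.
split => [A mA|k A mA].
  have mB : measurable (@circ R @^-1` A : set (measurableTypeR R)).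
    by rewrite -[X in measurable X]setTI; exact: measurable_circ.
  rewrite -[RHS]/(U01 R (@circ R @^-1` A)) -(uniform_prob_coord1 mB).
  rewrite -[LHS]/(U01 R (Theta Q @^-1` ((fun x => x 0%R) @^-1` A))).
  by congr (U01 R _); apply/seteqP; split => u /=; rewrite Theta0.
have [n ->] : exists n, k = edge n.
  have : k \in edges `|k|.+1 by rewrite mem_edges; lia.
  by move=> /mapP[n _ ->]; exists n.
by rewrite bondE // -(bondE 0%N).
Qed.

Lemma gibbs_stationary (mu : probability (conf R) R) :
  is_gibbs (nearest_neighbor U) mu -> stationary mu.
Proof.
move=> gmu; have [nu gnu [nu0 nub]] := gibbs_exists.
have e := gibbs_unique mU UC gmu gnu.
split => [A mA|k A mA].
  by rewrite e ?nu0 //; exact: measurable_preimage_proj.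
rewrite e ?nub //; last exact: measurable_preimage_bond.
by rewrite e //; exact: (measurable_preimage_bond 0 mA).
Qed.

Lemma is_gibbs_gibbs_measure : is_gibbs (nearest_neighbor U) (gibbs_measure U).
Proof. by have [nu gnu _] := gibbs_exists; apply: getPex; exists nu. Qed.

End existence.

(** * Convergence to the phases *)

Lemma compact_conf (R : realType) : compact [set: conf R].
Proof.
have := @tychonoff int (fun=> circle R) (fun=> setT) (fun=> @compact_circle R).
by rewrite (_ : [set _ | _] = setT) //; apply/seteqP; split.
Qed.

Lemma cvg_conf (R : realType) (T : Type) (F : set_system T) (FF : Filter F)
    (f : T -> conf R) (x : conf R) :
  (forall k, (fun t => f t k) @ F --> x k) -> f @ F --> x.
Proof.
move=> fx; apply/cvg_sup => n V [_ [[W oW <-] Wx] WV].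
have : nbhs (x n) W by apply: open_nbhs_nbhs; split; [exact: oW|exact: Wx].
by move=> /(fx n); apply: (@filterS _ _ FF) => t Wt; exact: WV.
Qed.

Lemma continuous_proj_conf (R : realType) k : continuous (fun x : conf R => x k).
Proof. exact: (@proj_continuous int (fun=> circle R) k). Qed.

Lemma nbhs_circle_ball (R : realType) (s : circle R) (e : R) : 0 < e ->
  nbhs s (@circ R @` ball (crep s) e).
Proof.
move=> e0; apply: (@filterS _ (nbhs s) _ (@circ R @` `]crep s - e, crep s + e[)).
  move=> t [r /=]; rewrite in_itv /= => /andP[r1 r2] <-; exists r => //.
  by rewrite /ball /= ltr_norml; apply/andP; split; lra.
apply: open_nbhs_nbhs; split; first exact: open_circ_itv.
exists (crep s); last exact: crepK.
by rewrite /= in_itv /=; apply/andP; split; lra.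
Qed.

Lemma continuous_conf_sub (R : realType) k l : continuous (fun x : conf R => x k - x l).
Proof.
move=> x W; set p := crep (x k); set q := crep (x l).
have -> : x k - x l = circ (p - q) by rewrite raddfB /= !crepK.
move=> /(@continuous_circ R) /nbhs_ballP[e /= e0 eW].
have e2 : 0 < e / 2 by rewrite divr_gt0.
have nk : nbhs x [set y : conf R | (@circ R @` ball p (e / 2)) (y k)] :=
  @continuous_proj_conf R k x _ (nbhs_circle_ball (x k) e2).
have nl : nbhs x [set y : conf R | (@circ R @` ball q (e / 2)) (y l)] :=
  @continuous_proj_conf R l x _ (nbhs_circle_ball (x l) e2).
suff : nbhs x [set y : conf R | W (y k - y l)] by [].
apply: (@filterS2 _ (nbhs x) _ _ _ _ _ nk nl) => y /= [u pu <-] [v qv <-].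
rewrite -raddfB; apply: eW; move: qv pu; rewrite /ball /= => qv pu.
rewrite (_ : p - q - (u - v) = (p - u) - (q - v)); last by ring.
by rewrite (le_lt_trans (ler_normB _ _)) // (splitr e) ltrD.
Qed.

Lemma measurable_continuous_conf (R : realType) (f : conf R -> R) :
  continuous f -> measurable_fun setT f.
Proof.
move=> cf; apply: (measurability (@RGenOInfty.G R)).
  exact: RGenOInfty.measurableE.
move=> _ [_ [r ->] <-]; rewrite setTI; apply: sub_sigma_algebra.
by apply: open_comp; [move=> x _; exact: cf|exact: interval_open].
Qed.

Lemma continuous_bounded (T : topologicalType) (R : realType) (t0 : T) (f : T -> R) :
  compact [set: T] -> continuous f -> exists2 B, 0 < B & forall x, `|f x| <= B.
Proof.
move=> cT cf; have T0 : [set: T] !=set0 by exists t0.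
have [c _ fc] := compact_EVT_max T0 cT (continuous_subspaceT cf).
have [b _ fb] := compact_EVT_min T0 cT (continuous_subspaceT cf).
exists (`|f c| + `|f b| + 1) => [|x]; first by rewrite ltr_wpDl // addr_ge0.
have := fc x; have := fb x; rewrite !inE => /(_ I) h1 /(_ I) h2.
have := ler_norm (f c); have := ler_norm (- f b); rewrite normrN => h3 h4.
have := normr_ge0 (f c); have := normr_ge0 (f b) => h5 h6.
by rewrite ler_norml; apply/andP; split; lra.
Qed.

(** The radius of the arcs in [concentrated]. *)
Definition radius_ (R : realType) (m : nat) : R := 2 ^- (m.+1 ^ 2).

Lemma radius_le (R : realType) m n : (m <= n)%N -> radius_ R n <= radius_ R m.
Proof.
move=> mn; rewrite lef_pV2 ?posrE ?exprn_gt0 // ler_eXn2l ?ltr1n //.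
by rewrite leq_exp2r.
Qed.

Lemma radius_small (R : realType) (e : R) : 0 < e -> exists m, radius_ R m < e.
Proof.
move=> e0; exists (Num.bound e^-1).
rewrite invf_plt ?posrE ?exprn_gt0 //.
have : e^-1 < (Num.bound e^-1)%:R by rewrite archi_boundP // invr_ge0 ltW.
move=> /lt_le_trans; apply; set n := Num.bound _.
rewrite -natrX ler_nat (leq_trans (ltnW (ltn_expl n (ltnSn 1)))) //.
by rewrite leq_exp2l // (leq_trans (leqnSn n)) // -{1}[n.+1]expn1 leq_pexp2l.
Qed.

Lemma circle_arc_le (R : realType) (a r s : R) : r <= s ->
  circle_arc a r `<=` circle_arc a s.
Proof.
move=> rs t [x /=]; rewrite in_itv /= => /andP[x1 x2] <-; exists x => //.
by rewrite /= in_itv /=; apply/andP; split; lra.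
Qed.

Lemma circle_arc_center (R : realType) (a : R) (t : circle R) :
  (forall m, circle_arc a (radius_ R m) t) -> t = circ a.
Proof.
move=> ta; rewrite -(crepK t); set y := crep t.
have arc m : exists n : int, `|y - a - n%:~R| <= radius_ R m.
  by apply/circle_arcP; rewrite crepK; exact: ta.
(* Level 1, of radius 1/16, and not level 0, whose radius 1/2 would not determine the integer: two
   integers within less than 1/2 of [y - a] coincide, so [n0] serves for all finer levels. *)
have [n0 yn0] := arc 1%N.
have r1 : radius_ R 1 < 1 / 2.
  by rewrite /radius_ /= mul1r ltf_pV2 ?posrE ?exprn_gt0 // -[ltLHS]expr1 ltr_eXn2l // ltr1n.
apply/circ_eqP/intrP; exists n0; apply/eqP; rewrite -subr_eq0 -normr_le0.
apply/ler_addgt0Pr => e e0; rewrite add0r.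
have [m me] := radius_small e0.
have [n yn] := arc (maxn 1 m).
have rn1 : radius_ R (maxn 1 m) <= radius_ R 1 by apply: radius_le; exact: leq_maxl.
have rnm : radius_ R (maxn 1 m) <= radius_ R m by apply: radius_le; exact: leq_maxr.
suff nn0 : n = n0 by rewrite -nn0; lra.
move: yn yn0; rewrite !ler_norml => /andP[h1 h2] /andP[h3 h4].
have : n%:~R - n0%:~R < 1 :> R by lra.
have : -1 < n%:~R - n0%:~R :> R by lra.
rewrite -rmorphB /= -(rmorphN1 intr) -(mulr1z 1) !ltr_int; lia.
Qed.

(* [lift t] is the configuration through t whose bonds are all equal to [circ a]. *)
Section weak_limit.
Context (R : realType) (a : R) (lift : circle R -> conf R).
Hypothesis c_lift : forall k, continuous (fun t => lift t k).
Hypothesis lift0 : forall x : conf R, (forall k, bond_at k x = circ a) -> x = lift (x 0).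

Lemma continuous_lift : continuous lift.
Proof. by move=> t; apply: (@cvg_conf _ _ _ (nbhs_filter t)) => k; exact: c_lift. Qed.

Let back (x : conf R) : conf R := lift (x 0).

Let c_back : continuous back.
Proof.
move=> x; apply: (@continuous_comp _ _ _ (fun x : conf R => x 0) lift).
  exact: continuous_proj_conf.
exact: continuous_lift.
Qed.

(** If it failed, the closed sets [K m] of counterexamples would be nonempty and decreasing, hence
    by compactness have a common point. All bonds of that point equal the centre, so it is its own
    lift, and [f] cannot differ there by [e]. *)
Lemma close_to_lift (f : conf R -> R) (e : R) : continuous f -> 0 < e ->
  exists m : nat, forall x : conf R,
    (forall k, (`|k| <= m)%N -> circle_arc a (radius_ R m) (bond_at k x)) ->
    `|f x - f (lift (x 0))| < e.
Proof.
move=> cf e0; apply: contrapT => /forallNP bad.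
pose K m : set (conf R) := [set x | e <= `|f x - f (back x)|] `&`
  \bigcap_(k in [set k : int | (`|k| <= m)%N]) [set x | circle_arc a (radius_ R m) (bond_at k x)].
have K0 m : K m !=set0.
  have /existsNP[x /not_implyP[xm /negP]] := bad m.
  by rewrite -leNgt => xe; exists x; split => // k km; exact: xm.
have Kle m n : (m <= n)%N -> K n `<=` K m.
  move=> mn x [xe xn]; split => // k /= km.
  apply: (circle_arc_le (radius_le R mn)); apply: xn => /=; exact: leq_trans mn.
have Kcl m : closed (K m).
  apply: closedI.
    have cfb : continuous (fun x => f (back x)).
      by move=> x; apply: (@continuous_comp _ _ _ back f); [exact: c_back|exact: cf].
    have cg : continuous (fun x => f x - f (back x)).
      by move=> x; apply: (cvgB (cf x) (cfb x)).
    rewrite (_ : [set x | _] = (fun x => f x - f (back x)) @^-1`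
        ([set r | r <= - e] `|` [set r | e <= r])).
      apply: preimage_closed => [x _|]; first exact: cg.
      exact: (closedU (@closed_le R (- e)) (@closed_ge R e)).
    apply/seteqP; split => [x|x []] /=; rewrite ler_normr lerNr.
    - by move=> /orP[]; [right|left].
    - by move=> ->; rewrite orbT.
    - by move=> ->.
  apply: closed_bigI => k _.
  apply: (@preimage_closed _ _ (fun x : conf R => x k - x (k + 1)) (circle_arc a (radius_ R m))).
    by move=> x _; exact: continuous_conf_sub.
  exact: closed_circle_arc.
have [x_ Kx_] := choice K0.
have := @compact_conf R (x_ @ \oo) _ filterT.
move=> [x [_ clx]].
have Kx m : K m x.
  apply: Kcl => B Bx; apply: clx => //.
  by exists m => // n /= mn; apply: (Kle _ _ mn); exact: Kx_.
have xE : x = back x.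
  apply: lift0 => k; apply: circle_arc_center => m.
  have [_ h] := Kx (maxn m `|k|%N).
  apply: (circle_arc_le (radius_le R (leq_maxl m `|k|%N))).
  by apply: h => /=; exact: leq_maxr.
by have [+ _] := Kx 0%N; rewrite /= -xE subrr normr0 leNgt e0.
Qed.

Context (phase : probability (conf R) R).
Hypothesis phaseE : forall A, measurable A -> phase A = leb R (lift @^-1` A).

Lemma measurable_lift : measurable_fun setT lift.
Proof. by apply: measurable_borel_conf => k; exact: c_lift. Qed.

Let m_back : measurable_fun setT back.
Proof. exact: (measurableT_comp measurable_lift (@measurable_proj_conf R 0)). Qed.

Let bounded_integrable (mu : probability (conf R) R) (g : conf R -> R) (B : R) :
  measurable_fun setT g -> (forall x, `|g x| <= B) -> mu.-integrable setT (EFin \o g).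
Proof.
move=> mg gB; apply: measurable_bounded_integrable => //.
  by rewrite -ge0_fin_numE // fin_num_measure.
exists B; split; first exact: num_real.
by move=> r Br x _; exact: (le_trans (gB x) (ltW Br)).
Qed.

(** The value at 0 being uniform under [mu], the map [back] carries [mu] to the phase. This couples
    the two measures, so that only [f] and its composition with [back] have to be compared. *)
Lemma Rintegral_phase (mu : probability (conf R) R) (f : conf R -> R) :
  stationary mu -> continuous f -> \int[phase]_x f x = \int[mu]_x f (back x).
Proof.
move=> [mu0 _] cf; congr fine.
have [B _ fB] := continuous_bounded (point : conf R) (@compact_conf R) cf.
have mf := measurable_continuous_conf cf.
transitivity (\int[image_probability mu m_back]_x (f x)%:E)%E.
  apply: eq_measure_integral => A mA _; apply: etrans (phaseE mA) _.
  apply/esym; apply: (mu0 (lift @^-1` A)).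
  by rewrite -[X in measurable X]setTI; exact: measurable_lift.
apply: (integral_pushforward m_back (mu := mu) (D := setT)) => //.
- exact/measurable_EFinP.
- have mfb : measurable_fun setT (f \o back) by exact: (measurableT_comp mf m_back).
  exact: (bounded_integrable mu mfb (fun x => fB (back x))).
Qed.

(** Where the 2m+1 bonds of the window are all close to the centre, the integrand is below [e];
    elsewhere it is bounded, and a union bound controls the probability. The constants are chosen
    before [mu] and [M], which makes the estimate uniform over the measures. *)
Lemma weak_estimate (f : conf R -> R) (e : R) : continuous f -> 0 < e ->
  exists (m : nat) (B : R), forall (mu : probability (conf R) R) (M : nat),
    stationary mu -> (m <= M)%N ->
    ((1 - 2 ^- M)%:E <= mu (@bond R @^-1` circle_arc a (radius_ R M)))%E ->
    `|\int[mu]_x f x - \int[phase]_x f x| <= e + B * 2 ^- M.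
Proof.
move=> cf e0; have [m fm] := close_to_lift cf e0.
have [B B0 fB] := continuous_bounded (point : conf R) (@compact_conf R) cf.
have mf := measurable_continuous_conf cf.
(* The number 2m+1 of bonds, times a bound for the difference of two values of [f]. *)
exists m, ((size (sites m.*2))%:R * (2 * B)) => mu M smu mM lev.
rewrite (Rintegral_phase smu cf).
have mfb : measurable_fun setT (f \o back) by exact: (measurableT_comp mf m_back).
have i1 : mu.-integrable setT (EFin \o f) by exact: (bounded_integrable mu mf fB).
have i2 : mu.-integrable setT (EFin \o (f \o back)).
  exact: (bounded_integrable mu mfb (fun x => fB (back x))).
rewrite -RintegralB //.
pose g x := f x - f (back x).
have mg : measurable_fun setT g by exact: measurable_funB.
have gB x : `|g x| <= 2 * B.
  by rewrite (le_trans (ler_normB _ _)) // mulr2n mulrDl !mul1r lerD // fB.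
have ig : mu.-integrable setT (EFin \o g) by exact: (bounded_integrable mu mg gB).
apply: (le_trans (le_normr_Rintegral measurableT ig)).
rewrite -lee_fin /Rintegral fineK; last first.
  exact: (integrable_fin_num measurableT (integrable_norm ig)).
pose A k := ~` (@bond_at R k @^-1` circle_arc a (radius_ R M)).
have mA k : measurable (A k).
  by apply: measurableC; apply: measurable_preimage_bond; exact: measurable_circle_arc.
have muA k : (mu (A k) <= (2 ^- M)%:E)%E.
  have mb : measurable (@bond_at R k @^-1` circle_arc a (radius_ R M)).
    by apply: measurable_preimage_bond; exact: measurable_circle_arc.
  have [_ stb] := smu.
  (* The concentration is known for the bond at 0 only; equality of the bond laws moves it to
     [k]. *)
  have levk : ((1 - 2 ^- M)%:E <= mu (@bond_at R k @^-1` circle_arc a (radius_ R M)))%E.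
    by rewrite (stb k _ (@measurable_circle_arc R a (radius_ R M))).
  rewrite /A probability_setC //; move: levk.
  by rewrite -(fineK (fin_num_measure mu _ mb)) -EFinB !lee_fin; lra.
pose G x := (e%:E + \sum_(k <- sites m.*2) (2 * B)%:E * (\1_(A k) x)%:E : \bar R)%E.
have mi k : measurable_fun setT (fun x => (2 * B)%:E * (\1_(A k) x)%:E : \bar R)%E.
  by apply: emeasurable_funM => //; apply/measurable_EFinP; exact: measurable_indic.
have i0 k x : (0 <= (2 * B)%:E * (\1_(A k) x)%:E :> \bar R)%E.
  by rewrite mule_ge0 // lee_fin mulr_ge0 // ltW.
have mS : measurable_fun setT (fun x => \sum_(k <- sites m.*2) (2 * B)%:E * (\1_(A k) x)%:E : \bar R)%E.
  exact: emeasurable_sum.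
have S0 x : (0 <= \sum_(k <- sites m.*2) (2 * B)%:E * (\1_(A k) x)%:E :> \bar R)%E.
  by apply: sume_ge0 => k _; exact: i0.
apply: (@le_trans _ _ (\int[mu]_x G x)%E).
  apply: ge0_le_integral => //.
  - by apply/measurable_EFinP; exact: measurableT_comp.
  - exact: emeasurable_funD.
  - move=> x _; rewrite /G.
    have [good|] := pselect (forall k, (`|k| <= m)%N -> circle_arc a (radius_ R m) (bond_at k x)).
      by rewrite -[leLHS]adde0 leeD // lee_fin ltW // fm.
    move=> /existsNP[k /not_implyP[km nk]].
    have xk : A k x.
      by move=> /(circle_arc_le (radius_le R mM)).
    apply: (@le_trans _ _ (2 * B)%:E); first by rewrite lee_fin.
    rewrite -[leLHS]add0e; apply: leeD; first by rewrite lee_fin ltW.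
    rewrite (big_rem k) ?mem_sites //= indicE mem_set // mule1 leeDl //.
    by apply: sume_ge0 => j _; exact: i0.
rewrite /G ge0_integralD //; last by move=> x _; rewrite lee_fin ltW.
rewrite (integral_cst mu measurableT) [X in (_ * X)%E]probability_setT mule1 EFinD leeD2l //.
rewrite ge0_integral_sum //.
apply: (@le_trans _ _ (\sum_(k <- sites m.*2) 2 * B * 2 ^- M)%:E).
  rewrite -sumEFin; apply: lee_sum => k _; rewrite ge0_integralZl //; last first.
  - by rewrite lee_fin mulr_ge0 // ltW.
  - by apply/measurable_EFinP; exact: measurable_indic.
  rewrite integral_indic // setIT [leRHS]EFinM; apply: lee_wpmul2l; last exact: muA.
  by rewrite lee_fin mulr_ge0 // ltW.
by rewrite lee_fin big_const_seq count_predT iter_addr_0 -[leLHS]mulr_natl -!mulrA.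
Qed.

Lemma cvg_weak_eval (T : Type) (F : set_system T) (FF : Filter F)
    (rho : T -> probability (conf R) R) (mu : probability (conf R) R) :
  (forall f : continuousType (conf R) R, \int[rho i]_x f x @[i --> F] --> \int[mu]_x f x) ->
  rho @ F --> mu.
Proof.
move=> h A [_ [[B oB <-] Bmu BA]].
suff : (fun i => weak_eval (rho i) : {ptws continuousType (conf R) R -> R}) @ F --> weak_eval mu.
  move=> /(_ B) H; rewrite nbhs_simpl /=.
  apply: (@filterS _ F _ ((fun i => weak_eval (rho i)) @^-1` B)).
    by move=> i Bi; exact: BA.
  by apply: H; apply: open_nbhs_nbhs.
apply/cvg_sup => f V [_ [[W oW <-] Wx] WV].
have : nbhs (weak_eval mu f) W by apply: open_nbhs_nbhs; split; [exact: oW|exact: Wx].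
by move=> /(h f); apply: (@filterS _ _ FF) => t Wt; exact: WV.
Qed.

Lemma cvg_phase (T : Type) (F : set_system T) (FF : Filter F)
    (rho : T -> probability (conf R) R) :
  (forall i, stationary (rho i)) ->
  (forall M, F [set i | ((1 - 2 ^- M)%:E <= rho i (@bond R @^-1` circle_arc a (radius_ R M)))%E]) ->
  rho @ F --> phase.
Proof.
move=> st lev; apply: cvg_weak_eval => f; apply/cvgrPdist_le => e e0.
have cf : continuous f by exact: cts_fun.
have e2 : 0 < e / 2 by rewrite divr_gt0.
have [m [B est]] := weak_estimate cf e2.
(* Since 2^n exceeds n, this brings the error term below [e / 2]. *)
pose n := Num.bound (`|B| / (e / 2)).
pose M := maxn m n.
have BM : B * 2 ^- M <= e / 2.
  have M0 : 0 < 2 ^+ M :> R by rewrite exprn_gt0.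
  rewrite ler_pdivrMr // (le_trans (ler_norm B)) // mulrC -ler_pdivrMr //.
  have : `|B| / (e / 2) < n%:R by rewrite archi_boundP // divr_ge0 // ltW.
  move=> /ltW/le_trans; apply; rewrite -natrX ler_nat.
  by rewrite (leq_trans (leq_maxr m n)) // ltnW // ltn_expl.
move: (lev M); apply: (@filterS _ F FF) => i /= levi.
have := est (rho i) M (st i) (leq_maxl m n) levi.
by rewrite distrC => /le_trans; apply; lra.
Qed.

End weak_limit.

(** * Zero-temperature limits *)

Lemma smooth_continuous (R : realType) (U : circle R -> R) : smooth U -> continuous U.
Proof.
move=> sU; apply/quotient_continuous => x.
apply: (@differentiable_continuous _ _ _ x (periodic_lift U)).
exact/derivable1_diffP/(sU 0%N).
Qed.

Lemma measurable_continuous_circle (R : realType) (U : circle R -> R) :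
  continuous U -> measurable_fun setT U.
Proof.
move=> cU; apply: (measurability (@RGenOInfty.G R)).
  exact: RGenOInfty.measurableE.
move=> _ [_ [r ->] <-]; rewrite setTI; apply: sub_sigma_algebra.
by apply: open_comp; [move=> x _; exact: cU|exact: interval_open].
Qed.

Lemma scale_nearest_neighbor (R : realType) (b : R) (U : circle R -> R) :
  scale_interaction b (nearest_neighbor U) = nearest_neighbor (fun t => b * U t).
Proof.
apply/funext => D; apply/funext => x; rewrite /scale_interaction /nearest_neighbor.
by rewrite mulr_fsumr; apply: eq_fsbigr => k _; rewrite mulrN.
Qed.

Definition center (R : realType) (e : bool) : R := if e then 0 else 2^-1.

(** Indexing configurations, phases and centres by a sign lets one proof treat both phases. *)
Definition sign_conf (R : realType) (e : bool) : circle R -> conf R :=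
  if e then @ferro_conf R else @antiferro_conf R.

Definition sign_phase (R : realType) (e : bool) : probability (conf R) R :=
  if e then ferro_phase R else antiferro_phase R.

Lemma continuous_sign_conf (R : realType) e k : continuous (fun t : circle R => sign_conf e t k).
Proof.
by case: e => [x|]; [exact: cvg_id|exact: continuous_circle_shift].
Qed.

Lemma half_add_half (R : realType) : Defs.half R + Defs.half R = 0.
Proof.
rewrite /Defs.half -raddfD -[RHS](raddf0 (@circ R)); apply/circ_eqP.
by rewrite subr0 (_ : _ + _ = 1) ?rpred1 //; lra.
Qed.

Lemma bond_at_sign_conf (R : realType) e (t : circle R) k :
  bond_at k (sign_conf e t) = circ (center R e).
Proof.
case: e; rewrite /bond_at /sign_conf /center /=.
  by rewrite /ferro_conf subrr raddf0.
rewrite /antiferro_conf mulrzDr mulr1z addrA opprD addrA subrr sub0r.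
by apply: (@addrI _ (Defs.half R)); rewrite subrr; exact/esym/half_add_half.
Qed.

Lemma bond_at_eq_sign_conf (R : realType) e (x : conf R) :
  (forall k, bond_at k x = circ (center R e)) -> x = sign_conf e (x 0).
Proof.
case: e; rewrite /bond_at /sign_conf /center /= => h.
  apply/ferro_confP => n.
  by rewrite -[RHS](subrK (x (n + 1))) h raddf0 add0r.
apply/antiferro_confP => n.
by rewrite -[x n](subrK (x (n + 1))) h addrAC half_add_half add0r.
Qed.

Lemma sign_phaseE (R : realType) e (A : set (conf R)) :
  sign_phase R e A = leb R (sign_conf e @^-1` A).
Proof. by case: e. Qed.

Lemma Rintegral_sign_phase (R : realType) e (mu : probability (conf R) R) (f : circle R -> R) :
  stationary mu -> continuous f ->
  \int[sign_phase R e]_x f (bond x) = f (circ (center R e)).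
Proof.
move=> smu cf.
have cfb : continuous (f \o @bond R).
  move=> x; apply: (@continuous_comp _ _ _ (@bond R) f); last exact: cf.
  exact: continuous_conf_sub.
rewrite (Rintegral_phase (@continuous_sign_conf R e) (fun A _ => sign_phaseE e A) smu cfb) /=.
transitivity (\int[mu]_x cst (f (circ (center R e))) x).
  by congr fine; apply: eq_integral => x _; congr (f _)%:E; exact: (bond_at_sign_conf e (x 0) 0).
by rewrite Rintegral_cst // [X in fine X]probability_setT mulr1.
Qed.

Lemma cvg_Rintegral_weak (R : realType) (T : Type) (F : set_system T) (FF : Filter F)
    (rho : T -> probability (conf R) R) (mu : probability (conf R) R) (f : conf R -> R) :
  continuous f -> rho @ F --> mu -> \int[rho i]_x f x @[i --> F] --> \int[mu]_x f x.
Proof.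
move=> cf rm; pose g : continuousType (conf R) R := mkcts cf.
have : (fun i => weak_eval (rho i) : {ptws continuousType (conf R) R -> R}) @ F --> weak_eval mu.
  move=> A /(@initial_continuous _ _ (@weak_eval R) mu A) wA.
  exact: (rm _ wA).
move=> h A /(@proj_continuous _ (fun=> R) g (weak_eval mu) A) pA.
exact: (h _ pA).
Qed.

(** The function that separates the phases: 1 at the ferromagnetic bond 0 and -1 at the
    antiferromagnetic bond 1/2. *)
Definition circle_cos (R : realType) (t : circle R) : R := cos (2 * pi * crep t).

Lemma circle_cosE (R : realType) (x : R) : circle_cos (circ x) = cos (2 * pi * x).
Proof.
have /circ_eqP/intrP[n xn] := crepK (circ x).
rewrite /circle_cos; set y := crep _ in xn *.
rewrite (_ : y = x + n%:~R); last by rewrite -xn; ring.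
rewrite mulrDr; case: n {xn} => m.
  by rewrite -pmulrn mulr_natr -(periodicn (@cosD2pi R) m (2 * pi * x)) mulr_natl.
rewrite NegzE mulrNz mulrN -(periodicn (@cosD2pi R) m.+1 (_ - _)) -pmulrn.
by rewrite mulr_natr mulr_natl subrK.
Qed.

Lemma continuous_circle_cos (R : realType) : continuous (@circle_cos R).
Proof.
apply/quotient_continuous; rewrite (_ : _ \o _ = (@cos R \o (fun x => 2 * pi * x))); last first.
  by apply/funext => x /=; exact: circle_cosE.
move=> x; apply: continuous_comp; last exact: continuous_cos.
by apply: cvgM; [exact: cvg_cst|exact: cvg_id].
Qed.

Lemma circle_cos_center (R : realType) :
  circle_cos (circ (center R true)) <> circle_cos (circ (center R false)).
Proof.
rewrite !circle_cosE /center mulr0 cos0 mulrAC mulfV // mul1r cospi; lra.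
Qed.

(** * Gibbs measures at a given inverse temperature *)

Section gibbs_phases.
Context (R : realType) (U : circle R -> R) (cU : continuous U).

Let cbU b : continuous (fun t => b * U t).
Proof.
move=> t; apply: (@continuous_comp _ _ _ U ( *%R b)); first exact: cU.
exact: mulrl_continuous.
Qed.

Let mbU b : measurable_fun setT (fun t => b * U t).
Proof. exact: (measurable_continuous_circle (@cbU b)). Qed.

Let gibbs_scale b (mu : probability (conf R) R) :
  is_gibbs (scale_interaction b (nearest_neighbor U)) mu =
  is_gibbs (nearest_neighbor (fun t => b * U t)) mu.
Proof. by rewrite scale_nearest_neighbor. Qed.

Lemma is_gibbs_scaled_gibbs_measure b :
  is_gibbs (scale_interaction b (nearest_neighbor U)) (gibbs_measure (fun t => b * U t)).
Proof.
rewrite gibbs_scale; have [C _ bUC] := continuous_bounded (0 : circle R) (@compact_circle R) (@cbU b).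
exact: (is_gibbs_gibbs_measure (mbU b) bUC).
Qed.

Lemma scaled_gibbs_stationary b (mu : probability (conf R) R) :
  is_gibbs (scale_interaction b (nearest_neighbor U)) mu -> stationary mu.
Proof.
rewrite gibbs_scale; have [C _ bUC] := continuous_bounded (0 : circle R) (@compact_circle R) (@cbU b).
exact: (gibbs_stationary (mbU b) bUC).
Qed.

Lemma scaled_gibbs_unique b (mu nu : probability (conf R) R) :
  is_gibbs (scale_interaction b (nearest_neighbor U)) mu ->
  is_gibbs (scale_interaction b (nearest_neighbor U)) nu ->
  forall A, measurable A -> mu A = nu A.
Proof.
rewrite !gibbs_scale; have [C _ bUC] := continuous_bounded (0 : circle R) (@compact_circle R) (@cbU b).
exact: (gibbs_unique (mbU b) bUC).
Qed.

Definition near_phase (e : bool) (M : nat) (b : R) : Prop :=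
  ((1 - 2 ^- M)%:E <= gibbs_measure (fun t => b * U t)%R
     (@bond R @^-1` circle_arc (center R e) (radius_ R M)))%E.

Lemma near_phase_le e M N b : (M <= N)%N -> near_phase e N b -> near_phase e M b.
Proof.
move=> MN; rewrite /near_phase => h.
apply: (@le_trans _ _ (1 - 2 ^- N)%:E).
  rewrite lee_fin lerD2l lerN2 lef_pV2 ?posrE ?exprn_gt0 //.
  by rewrite ler_eXn2l ?ltr1n.
apply: (le_trans h); apply: le_measure; rewrite ?inE.
- exact: (measurable_preimage_bond 0 (@measurable_circle_arc R _ _)).
- exact: (measurable_preimage_bond 0 (@measurable_circle_arc R _ _)).
- by move=> x; exact: (circle_arc_le (radius_le R MN)).
Qed.

(** The concentration concerns the selected [gibbs_measure]; uniqueness transfers it to arbitrary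
    Gibbs measures [rho i], as the definition of [chaotic] demands. *)
Lemma cvg_sign_phase e (T : Type) (F : set_system T) (FF : Filter F) (b : T -> R)
    (rho : T -> probability (conf R) R) :
  (forall i, is_gibbs (scale_interaction (b i) (nearest_neighbor U)) (rho i)) ->
  (forall M, F [set i | near_phase e M (b i)]) ->
  rho @ F --> sign_phase R e.
Proof.
move=> grho near; apply: (cvg_phase (@continuous_sign_conf R e)
  (@bond_at_eq_sign_conf R e) (fun A _ => sign_phaseE e A) FF).
  by move=> i; exact: scaled_gibbs_stationary (grho i).
move=> M; move: (near M); apply: (@filterS _ F FF) => i /= nearM.
rewrite (scaled_gibbs_unique (grho i) (is_gibbs_scaled_gibbs_measure (b i))) //.
exact: (measurable_preimage_bond 0 (@measurable_circle_arc R _ _)).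
Qed.

(** Along [u] and [v] the integral of [circle_cos] of the bond would have to tend both to 1 and to
    -1. Uniqueness of limits is thus used in the reals only. *)
Lemma not_cvg_both_phases (rho : nat -> probability (conf R) R) (mu : probability (conf R) R)
    (u v : nat -> nat) : (forall l, stationary (rho l)) ->
  u @ \oo --> \oo -> v @ \oo --> \oo ->
  (rho \o u) @ \oo --> sign_phase R true ->
  (rho \o v) @ \oo --> sign_phase R false -> ~ rho @ \oo --> mu.
Proof.
move=> st uoo voo rhou rhov rhomu.
have cf : continuous (fun x : conf R => circle_cos (bond x)).
  move=> x; apply: (@continuous_comp _ _ _ (@bond R) (@circle_cos R)).
    exact: continuous_conf_sub.
  exact: continuous_circle_cos.
have val w e : w @ \oo --> \oo -> (rho \o w) @ \oo --> sign_phase R e ->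
    \int[mu]_x circle_cos (bond x) = circle_cos (circ (center R e)).
  move=> woo rhow.
  rewrite -(Rintegral_sign_phase e (st 0%N) (@continuous_circle_cos R)).
  have h1 := cvg_Rintegral_weak eventually_filter cf rhow.
  have h2 := cvg_Rintegral_weak eventually_filter cf (cvg_comp _ _ woo rhomu).
  exact: (cvg_unique (@Rhausdorff R) h2 h1).
by apply: (@circle_cos_center R); rewrite -(val u) // -(val v).
Qed.

End gibbs_phases.

(** * Choice of the inverse temperatures *)

Lemma ler_beta (R : realType) m n : (m <= n)%N -> beta_ R m <= beta_ R n.
Proof.
by move=> mn; rewrite ler_eXn2l ?ltr1n // leq_exp2r // leq_add2r.
Qed.

Lemma le_beta (R : realType) m : m%:R <= beta_ R m.
Proof.
rewrite /beta_ -natrX ler_nat (leq_trans (ltnW (ltn_expl m (ltnSn 1)))) // leq_exp2l //.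
rewrite (leq_trans (leq_addr 10 m)) // -[X in (X <= _)%N]expn1 leq_pexp2l //.
by rewrite addn_gt0 orbT.
Qed.

Lemma infinite_set_ge (A : set nat) (n : nat) : infinite_set A ->
  exists2 m, (n <= m)%N & A m.
Proof.
move=> Aoo; apply: contrapT => h; apply: Aoo.
apply: (sub_finite_set _ (finite_II n)) => m Am /=.
by rewrite ltnNge; apply/negP => nm; apply: h; exists m.
Qed.

Section temperatures.
Context (R : realType) (U : cantor_space -> circle R -> R) (U_conc : concentrated U)
  (s : cantor_space).

Lemma near_phase_concentrated m n b : (1 <= m <= n)%N ->
  (forall j, (m <= j <= n)%N -> sgn_at s j = sgn_at s m) ->
  beta_ R m <= b <= beta_ R n -> near_phase (U s) (sgn_at s m) m b.
Proof. exact: U_conc. Qed.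

Lemma near_phase_constant e M :
  (forall m, (0 < m)%N -> sgn_at s m = e) ->
  \forall b \near +oo, near_phase (U s) e M b.
Proof.
move=> se; pose m := M.+1.
apply: (@filterS _ +oo _ [set b | beta_ R m <= b]).
  (* The signs being constant, the run starting at [m] can be ended as late as desired: [n] is taken
     so large that [beta_ R n] is above [b]. *)
  move=> b /= mb; pose n := maxn m (Num.bound b).
  apply: (@near_phase_le _ _ _ _ m) => //.
  rewrite -(se m) //; apply: (@near_phase_concentrated m n).
  - by rewrite leq_maxl.
  - by move=> j /andP[mj _]; rewrite !se // (leq_trans _ mj).
  rewrite mb /=.
  have b0 : 0 <= b by rewrite (le_trans _ mb) // exprn_ge0.
  rewrite (le_trans (ltW (archi_boundP b0))) // (le_trans (le_beta R _)) // ler_beta //.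
  exact: leq_maxr.
exact: nbhs_pinfty_ge (num_real _).
Qed.

(** A run of length one suffices: the concentration is used at the single temperature [beta_ R m],
    where the sign at [m] alone decides. *)
Lemma near_phase_beta e k m : (0 < m)%N -> (k <= m)%N -> sgn_at s m = e ->
  near_phase (U s) e k (beta_ R m).
Proof.
move=> m0 km <-; apply: (near_phase_le km).
apply: (@near_phase_concentrated m m); rewrite ?lexx ?m0 ?leqnn //.
by move=> j; rewrite -eqn_leq => /eqP ->.
Qed.

End temperatures.

Lemma cluster_subsequence (T : Type) (X : topologicalType) (F : set_system T) (g : T -> X)
    (u : nat -> T) (x : X) :
  u @ \oo `=>` F -> (fun l => g (u l)) @ \oo --> x -> cluster (g @ F) x.
Proof.
move=> uF gx A B FA xB.
have uA : \oo [set l | A (g (u l))] := uF _ FA.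
have uB : \oo [set l | B (g (u l))] := gx _ xB.
have [l [Al Bl]] := filter_ex (filterI uA uB).
by exists (g (u l)).
Qed.

Section conclusions.
Context (R : realType) (U : cantor_space -> circle R -> R)
  (U_smooth : forall s, smooth (U s)) (U_conc : concentrated U) (s : cantor_space).

Let cU : continuous (U s).
Proof. exact: smooth_continuous. Qed.

Let G (b : R) := gibbs_measure (fun t => b * U s t).

Let is_gibbs_G b : is_gibbs (scale_interaction b (nearest_neighbor (U s))) (G b).
Proof. exact: (is_gibbs_scaled_gibbs_measure cU). Qed.

Lemma cvg_constant_sign e : (forall m, (0 < m)%N -> sgn_at s m = e) ->
  G @ +oo --> sign_phase R e.
Proof.
move=> se; apply: (@cvg_sign_phase _ _ cU e _ _ _ id) => // M.
exact: (near_phase_constant U_conc).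
Qed.

(** For any temperatures tending to infinity, the Gibbs measures [G (b l)] are a choice that
    converges, by composition with the limit of the one-parameter family. *)
Lemma constant_sign_not_chaotic e : (forall m, (0 < m)%N -> sgn_at s m = e) ->
  ~ chaotic (nearest_neighbor (U s)).
Proof.
move=> se [b [_ boo h]]; apply: (h (fun l => G (b l))) => //.
by exists (sign_phase R e); exact: (cvg_comp _ _ boo (cvg_constant_sign se)).
Qed.

(** The selected indices may repeat; the bound l <= w l is enough to send them to infinity. *)
Lemma sign_indices e : infinite_set [set m : nat | (0 < m)%N /\ sgn_at s m = e] ->
  exists w : nat -> nat, forall l, (l <= w l)%N /\ (0 < w l)%N /\ sgn_at s (w l) = e.
Proof.
move=> Aoo; have h l : exists m, (l <= m)%N /\ (0 < m)%N /\ sgn_at s m = e.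
  by have [m lm mA] := infinite_set_ge l Aoo; exists m.
by have [w wP] := choice h; exists w.
Qed.

(** The bound by l/2 accommodates the interleaving of two sequences of indices, each of which
    advances at half speed. *)
Lemma beta_cvg_pinfty (w : nat -> nat) : (forall l, (l./2 <= w l)%N) ->
  (fun l => beta_ R (w l)) @ \oo --> +oo.
Proof.
move=> wl; apply/cvgryPge => A; exists (Num.bound `|A|).*2 => // l /= Al.
rewrite (le_trans (ler_norm A)) // (le_trans (ltW (archi_boundP (normr_ge0 A)))) //.
by rewrite (le_trans _ (le_beta R _)) // ler_nat (leq_trans _ (wl l)) // geq_half_double.
Qed.

Lemma cvg_sign_subsequence e (w : nat -> nat) (rho : nat -> probability (conf R) R) :
  (forall l, (l <= w l)%N /\ (0 < w l)%N /\ sgn_at s (w l) = e) ->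
  (forall l, is_gibbs (scale_interaction (beta_ R (w l)) (nearest_neighbor (U s))) (rho l)) ->
  rho @ \oo --> sign_phase R e.
Proof.
move=> wP grho; apply: (cvg_sign_phase cU eventually_filter grho) => M.
exists M => // l /= Ml; have [lw [w0 we]] := wP l.
exact: (near_phase_beta U_conc w0 (leq_trans Ml lw) we).
Qed.

Lemma cluster_infinite_sign e :
  infinite_set [set m : nat | (0 < m)%N /\ sgn_at s m = e] ->
  cluster (G @ +oo) (sign_phase R e).
Proof.
move=> /sign_indices[w wP].
have woo : (fun l => beta_ R (w l)) @ \oo --> +oo.
  by apply: beta_cvg_pinfty => l; have [lw _] := wP l; apply: leq_trans lw; lia.
have cvw := cvg_sign_subsequence wP (fun l => is_gibbs_G (beta_ R (w l))).
exact: (cluster_subsequence woo cvw).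
Qed.

Lemma infinite_signs_chaotic :
  infinite_set [set m : nat | (0 < m)%N /\ sgn_at s m = true] ->
  infinite_set [set m : nat | (0 < m)%N /\ sgn_at s m = false] ->
  chaotic (nearest_neighbor (U s)).
Proof.
move=> /sign_indices[u uP] /sign_indices[v vP].
(* The even terms follow indices of sign + and the odd terms indices of sign -, so the two
   subsequences converge to different phases whatever Gibbs measures are chosen. *)
pose w l := if odd l then v l./2 else u l./2.
exists (fun l => beta_ R (w l)); split => [l||rho grho [mu]].
- by rewrite exprn_gt0.
- by apply: beta_cvg_pinfty => l; rewrite /w; case: ifP; [have [] := vP l./2|have [] := uP l./2].
have oo (f : nat -> nat) : (forall k, (k <= f k)%N) -> f @ \oo --> \oo.
  by move=> fk A [N _ NA]; exists N => // k /= Nk; apply: NA => /=; exact: leq_trans (fk k).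
apply: (@not_cvg_both_phases _ rho mu double (fun k => k.*2.+1)).
- by move=> l; exact: (scaled_gibbs_stationary cU (grho l)).
- by apply: oo => k; lia.
- by apply: oo => k; lia.
- apply: (cvg_sign_subsequence uP) => l.
  by have := grho l.*2; rewrite /w odd_double doubleK.
- apply: (cvg_sign_subsequence vP) => l.
  by have := grho l.*2.+1; rewrite /w /= odd_double /= uphalf_double.
Qed.

End conclusions.

Theorem mainTheorem7 (R : realType) (U : cantor_space -> circle R -> R)
    (U_smooth : forall s, smooth (U s))
    (U_cont : Cinfty_continuous U)
    (U_conc : concentrated U)
    (s0 : cantor_space) :
  [/\ (forall m, (0 < m)%N -> sgn_at s0 m = true) ->
        gibbs_measure (fun t => b * U s0 t) @[b --> +oo] --> ferro_phase R /\
        ~ chaotic (nearest_neighbor (U s0)),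
      (forall m, (0 < m)%N -> sgn_at s0 m = false) ->
        gibbs_measure (fun t => b * U s0 t) @[b --> +oo] --> antiferro_phase R /\
        ~ chaotic (nearest_neighbor (U s0)) &
      infinite_set [set m : nat | (0 < m)%N /\ sgn_at s0 m = true] ->
      infinite_set [set m : nat | (0 < m)%N /\ sgn_at s0 m = false] ->
        [/\ cluster (gibbs_measure (fun t => b * U s0 t) @[b --> +oo]) (ferro_phase R),
            cluster (gibbs_measure (fun t => b * U s0 t) @[b --> +oo]) (antiferro_phase R) &
            chaotic (nearest_neighbor (U s0))]].
Proof.
have cst e := cvg_constant_sign U_smooth U_conc (s := s0) (e := e).
have nch e := constant_sign_not_chaotic U_smooth U_conc (s := s0) (e := e).
have clu e := cluster_infinite_sign U_smooth U_conc (s := s0) (e := e).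
split=> [h|h|p m]; first by split; [exact: (cst true)|exact: (nch true)].
  by split; [exact: (cst false)|exact: (nch false)].
split; [exact: (clu true)|exact: (clu false)|].
exact: infinite_signs_chaotic.
Qed.
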